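(* Let $W$ be a bounded linear operator on $H_E^2\oplus H_F^2$ with $WY=XW$, where $X=S_E\oplus S_F^*$ and $Y=S_E\oplus S_F$. Then $W=V_\Phi$ for some $$\Phi=\begin{bmatrix}A&B\\C&D\end{bmatrix}\in\Gamma^\infty_{E\oplus F}.$$ Furthermore, $$\|V_\Phi\|=\inf_{L_1\in H^\infty_{B(E,F)},\ L_2\in H^\infty_{B(F)}}\left\|\begin{bmatrix}A&B\\C&D\end{bmatrix}-\begin{bmatrix}0&0\\L_1&L_2\end{bmatrix}\right\|_{L^\infty}.$$
   Context: $E$ and $F$ are complex separable Hilbert spaces. $L_E^2$ is the space of square integrable $E$-valued functions on the unit circle $\mathbb T$ and $H_E^2\subset L_E^2$ the $E$-valued Hardy space. $L^\infty_{B(E,F)}$ is the space of bounded measurable functions on $\mathbb T$ with values in $B(E,F)$ (bounded operators from $E$ to $F$), with the essential supremum norm $\|\cdot\|_{L^\infty}$, and $H^\infty_{B(E,F)}$ the bounded analytic ones; $B(E)=B(E,E)$. $P$ is the orthogonal projection of a vector-valued $L^2$ space onto the corresponding $H^2$. $S_E=T_z$ is the shift (multiplication by $z$) on $H_E^2$. For $\Phi\in L^\infty_{B(E,F)}$ the Toeplitz operator $T_\Phi:H_E^2\to H_F^2$ is $T_\Phi h=P[\Phi h]$, and the Hankel operator $H_\Phi:H_E^2\to H_F^2$ is $H_\Phi h=PJ[\Phi h]$, where $Jf(z)=\overline z f(\overline z)$ for $f\in L_F^2$. (Likewise for other pairs of spaces.) $\Gamma^\infty_{E\oplus F}$ is the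 set of all symbols $$\Phi(z)=\begin{bmatrix} A(z)&B(z)\\ C(z)&D(z)\end{bmatrix}:E\oplus F\to E\oplus F$$ with $A\in H^\infty_{B(E)}$, $B\in H^\infty_{B(F,E)}$, $C\in L^\infty_{B(E,F)}$, $D\in L^\infty_{B(F)}$. For such $\Phi$, $$V_\Phi=\begin{bmatrix} T_A&T_B\\ H_C&H_D\end{bmatrix}:H_E^2\oplus H_F^2\to H_E^2\oplus H_F^2 .$$ *)

(* Defs.v *)
From HB Require Import structures.
From mathcomp Require Import all_boot all_order all_algebra.
From mathcomp Require Import all_classical all_reals all_analysis ess_sup_inf.
From mathcomp Require Import complex.

Set Implicit Arguments.
Unset Strict Implicit.
Unset Printing Implicit Defensive.
Import Order.TTheory GRing.Theory Num.Theory.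
Import numFieldNormedType.Exports.

Local Open Scope classical_set_scope.
Local Open Scope complex_scope.
Local Open Scope ring_scope.

(* The form is linear in its first argument, conjugate-linear in the second. *)
HB.mixin Record isHilbert (R : realType) E of CompleteNormedModule R[i] E := {
  inner : {dot E for (@Num.conj R[i])} ;
  inner_norm : forall x : E, inner x x = `|x| ^+ 2
}.

#[short(type="hilbertType")]
HB.structure Definition Hilbert (R : realType) :=
  {E of isHilbert R E & CompleteNormedModule R[i] E}.

Definition separable (T : topologicalType) :=
  exists2 A : set T, countable A & dense A.

(* The library norm is R[i]-valued; this is the same number as a real. *)
Definition hnorm (R : realType) (E : hilbertType R) (x : E) : R :=
  complex.Re `|x|.

(* Hilbert-sum norm; the library norm on products is the max norm. *)
Definition sum_norm (R : realType) X Y (nX : X -> R) (nY : Y -> R)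
    (p : X * Y) : R :=
  Num.sqrt (nX p.1 ^+ 2 + nY p.2 ^+ 2).

(* Least bound of T on D; +oo when T is not bounded on D. *)
Definition opnorm (R : realType) X Y (nX : X -> R) (nY : Y -> R)
    (D : set X) (T : X -> Y) : \bar R :=
  ereal_inf [set c%:E | c in
    [set c : R | 0 <= c /\ forall x, D x -> nY (T x) <= c * nX x]].

Definition circle (R : realType) := {z : R[i] | `|z| == 1}.

Section circle.
Variable R : realType.
Implicit Types z : circle R.

HB.instance Definition _ := gen_eqMixin (circle R).
HB.instance Definition _ := gen_choiceMixin (circle R).

Lemma cis_subproof (t : R) : `|(cos t +i* sin t)%C| == 1.
Proof. by rewrite normc_def cos2Dsin2 sqrtr1. Qed.

(* t |-> e^(it) *)
Definition cis (t : measurableTypeR R) : circle R :=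
  exist (fun z : R[i] => is_true (`|z| == 1)) _ (cis_subproof t).

Lemma circle_conj_subproof z : `|((sval z)^*)%C| == 1.
Proof. by rewrite normcJ; exact: (svalP z). Qed.

Definition circle_conj z : circle R :=
  exist (fun z : R[i] => is_true (`|z| == 1)) _ (circle_conj_subproof z).

HB.instance Definition _ := isPointed.Build (circle R) (cis 0).

Fact circle_display : measure_display. Proof. exact: default_measure_display. Qed.

(* A is Borel in the circle iff its preimage under t |-> e^(it) is Borel in R *)
Definition circle_measurable : set (set (circle R)) :=
  [set A | measurable (cis @^-1` A)].

Lemma circle_measurable0 : circle_measurable set0.
Proof. by rewrite /circle_measurable/= preimage_set0. Qed.

Lemma circle_measurableC A : circle_measurable A -> circle_measurable (~` A).
Proof. by rewrite /circle_measurable/= preimage_setC; exact: measurableC. Qed.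

Lemma circle_measurable_bigcup (F : (set (circle R))^nat) :
  (forall i, circle_measurable (F i)) -> circle_measurable (\bigcup_i F i).
Proof.
move=> mF; rewrite /circle_measurable/= preimage_bigcup.
by apply: bigcup_measurable => i _; exact: mF.
Qed.

HB.instance Definition _ := isMeasurable.Build circle_display (circle R)
  circle_measurable0 circle_measurableC circle_measurable_bigcup.

Lemma measurable_cis : measurable_fun setT cis.
Proof. by move=> _ A mA; rewrite setTI. Qed.

HB.instance Definition _ := isMeasurableFun.Build _ _ _ _ cis measurable_cis.

Lemma ltNpipi : - pi < pi :> R.
Proof. by rewrite gtrN// pi_gt0. Qed.

(* Normalized arc length: image of the uniform probability on [-pi, pi]. *)
Definition haar : probability (circle R) R :=
  distribution (uniform_prob ltNpipi) cis.

Definition cmeasurable (g : circle R -> R[i]) :=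
  measurable_fun setT (fun z => complex.Re (g z)) /\
  measurable_fun setT (fun z => complex.Im (g z)).

Definition cintegral (g : circle R -> R[i]) : R[i] :=
  ((\int[haar]_z complex.Re (g z)) +i* (\int[haar]_z complex.Im (g z)))%C.

End circle.

(* Elements of L^2 and H^2 are represented by functions; equality in these
   spaces is almost everywhere equality. *)
Definition aeeq (R : realType) T (f g : circle R -> T) :=
  {ae haar R, forall z, f z = g z}.

Section hardy.
Variables (R : realType) (E : hilbertType R).
Implicit Types f g : circle R -> E.

(* Weak measurability, which for separable E is strong measurability. *)
Definition L2 : set (circle R -> E) :=
  [set f | (forall x, cmeasurable (fun z => inner (f z) x)) /\
    (\int[haar R]_z ((hnorm (f z)) ^+ 2)%:E < +oo)%E].

Definition L2inner f g : R[i] := cintegral (fun z => inner (f z) (g z)).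

Definition L2norm f : R := Num.sqrt (\int[haar R]_z (hnorm (f z)) ^+ 2).

(* The Fourier coefficients of negative index vanish. *)
Definition H2 : set (circle R -> E) :=
  [set f | L2 f /\ forall n x, (0 < n)%N ->
    cintegral (fun z => sval z ^+ n * inner (f z) x) = 0].

(* Orthogonal projection of L^2 onto H^2. *)
Definition hardy_proj f : circle R -> E :=
  xget (fun=> 0) [set g | H2 g /\ forall h, H2 h -> L2inner (f \- g) h = 0].

Definition flip f : circle R -> E :=
  fun z => (sval z)^*%C *: f (circle_conj z).

Definition shift f : circle R -> E := fun z => sval z *: f z.

End hardy.
Arguments L2 {R} E.
Arguments H2 {R} E.

(* Adjoint of an operator on H^2. *)
Definition H2adjoint (R : realType) (E : hilbertType R)
    (T : (circle R -> E) -> circle R -> E) (k : circle R -> E) : circle R -> E :=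
  xget (fun=> 0) [set g | H2 E g /\
    forall h, H2 E h -> L2inner (T h) k = L2inner h g].

Section symbols.
Variables (R : realType) (E F : hilbertType R).
Implicit Types Phi : circle R -> E -> F.

(* Measurability is with respect to the weak operator topology. *)
Definition Linfty : set (circle R -> E -> F) :=
  [set Phi | [/\ forall z, linear (Phi z),
    forall z, (opnorm (@hnorm R E) (@hnorm R F) setT (Phi z) < +oo)%E,
    forall x y, cmeasurable (fun z => inner (Phi z x) y) &
    (ess_sup (haar R) (fun z => opnorm (@hnorm R E) (@hnorm R F) setT (Phi z))
      < +oo)%E]].

Definition Hinfty : set (circle R -> E -> F) :=
  [set Phi | Linfty Phi /\ forall n x y, (0 < n)%N ->
    cintegral (fun z => sval z ^+ n * inner (Phi z x) y) = 0].

Definition toeplitz Phi (h : circle R -> E) : circle R -> F :=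
  hardy_proj (fun z => Phi z (h z)).

Definition hankel Phi (h : circle R -> E) : circle R -> F :=
  hardy_proj (flip (fun z => Phi z (h z))).

End symbols.
Arguments Linfty {R} E F.
Arguments Hinfty {R} E F.

Record symbol (R : realType) (E F : hilbertType R) := Symbol {
  symA : circle R -> E -> E ;
  symB : circle R -> F -> E ;
  symC : circle R -> E -> F ;
  symD : circle R -> F -> F }.

Section direct_sum.
Variables (R : realType) (E F : hilbertType R).
Implicit Types Phi : symbol E F.

Definition symbol_fun Phi (z : circle R) (p : E * F) : E * F :=
  (symA Phi z p.1 + symB Phi z p.2, symC Phi z p.1 + symD Phi z p.2).

Definition Gamma_infty : set (symbol E F) :=
  [set Phi | [/\ Hinfty E E (symA Phi), Hinfty F E (symB Phi),
    Linfty E F (symC Phi) & Linfty F F (symD Phi)]].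

Definition lower_row (C : circle R -> E -> F) (D : circle R -> F -> F)
    : symbol E F :=
  Symbol (fun=> fun=> 0) (fun=> fun=> 0) C D.

Definition Linfty_norm (G : circle R -> E * F -> E * F) : \bar R :=
  ess_sup (haar R) (fun z =>
    opnorm (sum_norm (@hnorm R E) (@hnorm R F))
      (sum_norm (@hnorm R E) (@hnorm R F)) setT (G z)).

(* Representatives of elements of H^2_E (+) H^2_F. *)
Notation pairs := ((circle R -> E) * (circle R -> F))%type.

Definition H2sum : set pairs := H2 E `*` H2 F.

Definition pair_aeeq (p q : pairs) := aeeq p.1 q.1 /\ aeeq p.2 q.2.

Definition H2sum_opnorm (W : pairs -> pairs) : \bar R :=
  opnorm (sum_norm (@L2norm R E) (@L2norm R F))
    (sum_norm (@L2norm R E) (@L2norm R F)) H2sum W.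

(* W is a map on representatives that induces a bounded linear operator on the
   space H^2_E (+) H^2_F of almost everywhere classes. *)
Record bounded_operator (W : pairs -> pairs) : Prop := {
  bo_stable : forall p, H2sum p -> H2sum (W p) ;
  bo_ext : forall p q, H2sum p -> H2sum q ->
    pair_aeeq p q -> pair_aeeq (W p) (W q) ;
  bo_linear : forall (a : R[i]) p q, H2sum p -> H2sum q ->
    pair_aeeq (W (a *: p + q)) (a *: W p + W q) ;
  bo_bounded : (H2sum_opnorm W < +oo)%E }.

Definition operator_eq (W W' : pairs -> pairs) :=
  forall p, H2sum p -> pair_aeeq (W p) (W' p).

Definition opX (p : pairs) : pairs :=
  (shift p.1, H2adjoint (@shift R F) p.2).

Definition opY (p : pairs) : pairs := (shift p.1, shift p.2).

Definition opV Phi (p : pairs) : pairs :=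
  (toeplitz (symA Phi) p.1 + toeplitz (symB Phi) p.2,
   hankel (symC Phi) p.1 + hankel (symD Phi) p.2).

End direct_sum.

(* Main.v *)
(* For h in H^2_E (+) H^2_F and k in L^2_E (+) H^2_F put beta(h, k) = <W h, k>.
   The relation WY = XW says beta(Y h, k) = beta(h, Q k) with
   Q (k1, k2) = (conj z k1, z k2).  For g > |W| the form
   g<h,h'> + beta(h,k') + conj beta(h',k) + g<k,k'> is an inner product in which
   (h, Q k) |-> (Y h, k) is isometric, and powers of the adjoint of this isometry
   extend beta along Q: they produce vectors l_i(h) of F with
   |W h|^2 + sum_i |l_i(h)|^2 <= g^2 |h|^2.  Hence
   G h = ((W h)_1, J (W h)_2 + sum_i z^i l_i(h)) commutes with multiplication by z
   and has norm at most g.  Since G commutes with polynomials in z, testing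
   |p|^2 against the pointwise defect shows that G is multiplication by a symbol
   whose norm is at most g almost everywhere, and W is the operator V of that
   symbol.  This proves the representation and one half of the norm formula, as two
   symbols with the same operator differ by an analytic lower row; the other half
   holds because J maps H^2 into its orthogonal complement. *)

Require Import Defs.
From HB Require Import structures.
From mathcomp Require Import all_boot all_order all_algebra.
From mathcomp Require Import all_classical all_reals all_analysis ess_sup_inf.
From mathcomp Require Import complex.
From mathcomp Require Import measurable_realfun ring lra.

Set Implicit Arguments.
Unset Strict Implicit.
Unset Printing Implicit Defensive.
Import Order.TTheory GRing.Theory Num.Theory.
Import numFieldNormedType.Exports.

Local Open Scope classical_set_scope.
Local Open Scope ring_scope.

(** The first slot of k is all of L^2_E because conj z does not preserve H^2_E. With L^2_E there Q
    is an isometry, and the complement of its range consists of the constants of F in the second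
    slot; this is why each l_i(h) is a single vector of F and can serve as the Fourier coefficient
    of index i. Strictness of g > |W| makes the Gram norm equivalent to the product norm, hence
    complete, so adjoints come from Riesz representation. The price is a bound g instead of |W|; the
    infimum in the norm formula absorbs it, so no limit of symbols is taken. Functions stand for
    their classes: forms are only semidefinite, adjoint vectors are chosen, and identities between
    them hold modulo null vectors. Likewise an operator fixes z |-> Phi z x only up to a null set
    depending on x. Separability reduces pointwise claims to countably many x, and off one common
    null set the values on a dense sequence are extended to a bounded linear map. The bound of that
    extension is crude; the sharp constant is recovered afterwards by density. *)

Lemma complex_extR (R : realType) (x y : R[i]) :
  complex.Re x = complex.Re y -> complex.Im x = complex.Im y -> x = y.
Proof. by case: x y => [a b] [c d] /= -> ->. Qed.

Lemma conjC_conjc (R : realType) (x : R[i]) : x^* = (x^*)%C.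
Proof. by []. Qed.

Lemma Re0 (R : realType) : complex.Re (0 : R[i]) = 0. Proof. by []. Qed.

(** * Real and imaginary parts, elementary real inequalities *)

Section re_im.
Variable R : realType.
Implicit Types x y : R[i].
Local Notation Re := (@complex.Re R).
Local Notation Im := (@complex.Im R).

Lemma ReD x y : Re (x + y) = Re x + Re y. Proof. by case: x y => [? ?] []. Qed.
Lemma ImD x y : Im (x + y) = Im x + Im y. Proof. by case: x y => [? ?] []. Qed.
Lemma ReN x : Re (- x) = - Re x. Proof. by case: x. Qed.
Lemma ImN x : Im (- x) = - Im x. Proof. by case: x. Qed.
Lemma Re_mul x y : Re (x * y) = Re x * Re y - Im x * Im y.
Proof. by case: x y => [? ?] []. Qed.
Lemma Im_mul x y : Im (x * y) = Re x * Im y + Im x * Re y.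
Proof. by case: x y => [? ?] []. Qed.
Lemma ReJ x : Re x^* = Re x. Proof. by rewrite conjC_conjc; case: x. Qed.
Lemma ImJ x : Im x^* = - Im x. Proof. by rewrite conjC_conjc; case: x. Qed.
End re_im.
Definition ReImE := (ReD, ImD, ReN, ImN, Re_mul, Im_mul, ReJ, ImJ).

(** Discriminant criterion, degenerate case a = 0 included; the Cauchy-Schwarz estimates below rest
    on it. *)
Lemma quadratic_ge0 (R : realType) (a b e : R) : 0 <= a ->
  (forall t, 0 <= t ^+ 2 * a + 2 * t * b + e) -> b ^+ 2 <= a * e.
Proof.
move=> a0 q; have [a00|an0] := eqVneq a 0.
  have [->|b0] := eqVneq b 0; first by rewrite a00; nra.
  (* With a = 0 this t makes the polynomial equal to -1. *)
  have := q (- (e + 1) / (2 * b)); rewrite a00 mulr0 add0r.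
  have -> : 2 * (- (e + 1) / (2 * b)) * b = - (e + 1) by field.
  lra.
have := q (- b / a).
have -> : (- b / a) ^+ 2 * a + 2 * (- b / a) * b + e = (a * e - b ^+ 2) / a.
  by field.
by rewrite pmulr_lge0 ?subr_ge0// invr_gt0 lt0r an0.
Qed.

Lemma amgm2 (R : realType) (r m q : R) : r ^+ 2 <= m * q -> 0 <= m -> 0 <= q ->
  2 * r <= m + q.
Proof.
move=> h m0 q0; rewrite leNgt; apply/negP => lt.
have : (m + q) * (m + q) < (2 * r) * (2 * r) by rewrite ltr_pM//; lra.
have := sqr_ge0 (m - q); lra.
Qed.

Lemma sqr_le_eps0 (R : realType) (x : R) :
  (forall e : R, 0 < e -> x ^+ 2 <= e) -> x = 0.
Proof.
move=> h; apply/eqP; rewrite -sqrf_eq0 eq_le sqr_ge0 andbT.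
by apply/ler_addgt0Pr => e e0; rewrite add0r; exact: h.
Qed.

(** * Semi-inner products and Riesz representation *)

(* Functions represent their almost everywhere classes, so the L^2 product is only
   semidefinite, and it behaves well only on the set [S] of admissible functions. *)
Record semi_inner (R : realType) (V : lmodType R[i]) (S : set V)
    (B : V -> V -> R[i]) : Prop := SemiInner {
  si0 : S 0 ;
  siP : forall a x y, S x -> S y -> S (a *: x + y) ;
  si_linear : forall a x y z, S x -> S y -> S z ->
    B (a *: x + y) z = a * B x z + B y z ;
  siC : forall x y, S x -> S y -> B y x = (B x y)^* ;
  si_ge0 : forall x, S x -> 0 <= complex.Re (B x x) }.

(** Distances enter squared, so that no square root is needed; the limit is determined only up to a
    vector of zero norm. *)
Definition si_complete (R : realType) (V : lmodType R[i]) (S : set V)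
    (B : V -> V -> R[i]) := forall u : nat -> V, (forall n, S (u n)) ->
  (forall e : R, 0 < e -> exists N, forall m n, (N <= m)%N -> (N <= n)%N ->
    complex.Re (B (u m - u n) (u m - u n)) <= e) ->
  exists2 l, S l & forall e : R, 0 < e -> exists N, forall n, (N <= n)%N ->
    complex.Re (B (u n - l) (u n - l)) <= e.

Section semi_inner_theory.
Variables (R : realType) (V : lmodType R[i]) (S : set V) (B : V -> V -> R[i]).
Hypothesis SB : semi_inner S B.
Local Notation Re := (@complex.Re R).
Local Notation Im := (@complex.Im R).
Local Notation nsq x := (Re (B x x)).

Lemma siZ a x : S x -> S (a *: x).
Proof. by move=> Sx; rewrite -[a *: x]addr0; apply: (siP SB) => //; exact: (si0 SB). Qed.

Lemma siD x y : S x -> S y -> S (x + y).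
Proof. by move=> Sx Sy; rewrite -[x]scale1r; exact: (siP SB). Qed.

Lemma siN x : S x -> S (- x).
Proof. by move=> Sx; rewrite -scaleN1r; exact: siZ. Qed.

Lemma siB x y : S x -> S y -> S (x - y).
Proof. by move=> Sx Sy; apply: siD => //; exact: siN. Qed.

Lemma siDl x y z : S x -> S y -> S z -> B (x + y) z = B x z + B y z.
Proof.
by move=> Sx Sy Sz; rewrite -[x in LHS]scale1r (si_linear SB)// mul1r.
Qed.

Lemma si0l z : S z -> B 0 z = 0.
Proof.
move=> Sz; have := siDl (si0 SB) (si0 SB) Sz.
by rewrite addr0 => /eqP; rewrite addrC -subr_eq subrr => /eqP.
Qed.

Lemma siZl a x z : S x -> S z -> B (a *: x) z = a * B x z.
Proof.
move=> Sx Sz; rewrite -[a *: x]addr0 (si_linear SB)//; last exact: (si0 SB).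
by rewrite si0l// addr0.
Qed.

Lemma siNl x z : S x -> S z -> B (- x) z = - B x z.
Proof. by move=> Sx Sz; rewrite -scaleN1r siZl// mulN1r. Qed.

Lemma siBl x y z : S x -> S y -> S z -> B (x - y) z = B x z - B y z.
Proof. by move=> Sx Sy Sz; rewrite siDl ?siNl//; exact: siN. Qed.

Lemma siDr x y z : S x -> S y -> S z -> B z (x + y) = B z x + B z y.
Proof.
move=> Sx Sy Sz; rewrite (siC SB (siD Sx Sy) Sz) siDl// rmorphD/=.
by rewrite -!(siC SB).
Qed.

Lemma si0r z : S z -> B z 0 = 0.
Proof. by move=> Sz; rewrite (siC SB (si0 SB) Sz) si0l// rmorph0. Qed.

Lemma siZr a x z : S x -> S z -> B z (a *: x) = a^* * B z x.
Proof.
by move=> Sx Sz; rewrite (siC SB (siZ a Sx) Sz) siZl// rmorphM/= -(siC SB).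
Qed.

Lemma siNr x z : S x -> S z -> B z (- x) = - B z x.
Proof. by move=> Sx Sz; rewrite -scaleN1r siZr// rmorphN1 mulN1r. Qed.

Lemma siBr x y z : S x -> S y -> S z -> B z (x - y) = B z x - B z y.
Proof. by move=> Sx Sy Sz; rewrite siDr ?siNr//; exact: siN. Qed.

Lemma si_ReC x y : S x -> S y -> Re (B y x) = Re (B x y).
Proof. by move=> Sx Sy; rewrite (siC SB Sx Sy) ReJ. Qed.

Lemma si_Im x : S x -> Im (B x x) = 0.
Proof. by move=> Sx; have := congr1 Im (siC SB Sx Sx); rewrite ImJ; lra. Qed.

Lemma si_nsq x : S x -> B x x = (nsq x)%:C%C.
Proof. by move=> Sx; apply: complex_extR => //=; rewrite si_Im. Qed.

Lemma nsqD x y : S x -> S y -> nsq (x + y) = nsq x + nsq y + 2 * Re (B x y).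
Proof.
move=> Sx Sy; rewrite siDl//; last exact: siD.
by rewrite !siDr// !ReImE (si_ReC Sx Sy); ring.
Qed.

Lemma nsqN x : S x -> nsq (- x) = nsq x.
Proof. by move=> Sx; rewrite siNl ?siNr ?opprK//; exact: siN. Qed.

Lemma nsqB x y : S x -> S y -> nsq (x - y) = nsq x + nsq y - 2 * Re (B x y).
Proof.
move=> Sx Sy; rewrite nsqD//; last exact: siN.
by rewrite nsqN// siNr// ReN; ring.
Qed.

Lemma nsqBC x y : S x -> S y -> nsq (x - y) = nsq (y - x).
Proof. by move=> Sx Sy; rewrite -opprB nsqN//; exact: siB. Qed.

Lemma nsqZ a x : S x -> nsq (a *: x) = (Re a ^+ 2 + Im a ^+ 2) * nsq x.
Proof.
move=> Sx; rewrite siZl ?siZr//; last exact: siZ.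
by rewrite !ReImE (si_Im Sx); ring.
Qed.

(** Expand nsq (x + t y) >= 0 in real t. Bounding the real part suffices: with y replaced by i y it
    bounds the imaginary part. *)
Lemma si_CS x y : S x -> S y -> Re (B x y) ^+ 2 <= nsq x * nsq y.
Proof.
move=> Sx Sy; rewrite mulrC; apply: quadratic_ge0; first exact: (si_ge0 SB).
move=> t; have Sty : S (t%:C%C *: y) by exact: siZ.
have := si_ge0 SB (siD Sx Sty).
rewrite nsqD// nsqZ//= siZr// ReImE ReJ ImJ /=.
by nra.
Qed.

Lemma si_null x y : S x -> S y -> nsq x = 0 -> B x y = 0.
Proof.
move=> Sx Sy x0; apply: complex_extR => /=.
  by have := si_CS Sx Sy; rewrite x0; nra.
have Siy := siZ (0 +i* 1)%C Sy.
by have := si_CS Sx Siy; rewrite x0 siZr// ReImE ReJ ImJ /=; nra.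
Qed.

Lemma nsqD_le x y : S x -> S y -> nsq (x + y) <= 2 * nsq x + 2 * nsq y.
Proof.
move=> Sx Sy; have := si_ge0 SB (siB Sx Sy); rewrite nsqB// nsqD//; lra.
Qed.

Lemma nsq_triangle x y z : S x -> S y -> S z ->
  nsq (x - z) <= 2 * nsq (x - y) + 2 * nsq (y - z).
Proof.
move=> Sx Sy Sz; have -> : x - z = (x - y) + (y - z) by rewrite addrA subrK.
by apply: nsqD_le; exact: siB.
Qed.

Lemma siPr a x y z : S x -> S y -> S z -> B z (a *: x + y) = a^* * B z x + B z y.
Proof. by move=> Sx Sy Sz; rewrite siDr ?siZr//; exact: siZ. Qed.

End semi_inner_theory.

Section riesz.
Variables (R : realType) (V : lmodType R[i]) (S : set V) (B : V -> V -> R[i]).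
Hypothesis SB : semi_inner S B.
Hypothesis cB : si_complete S B.
Local Notation Re := (@complex.Re R).
Local Notation Im := (@complex.Im R).
Local Notation nsq x := (Re (B x x)).
Variable phi : V -> R[i].
Hypothesis phi_linear : forall a x y, S x -> S y ->
  phi (a *: x + y) = a * phi x + phi y.
Variable M : R.
Hypothesis phi_bounded : forall x, S x -> Re (phi x) ^+ 2 <= M * nsq x.

Let phi0 : phi 0 = 0.
Proof.
have := phi_linear 1 (si0 SB) (si0 SB); rewrite scale1r addr0 mul1r.
by move=> /eqP; rewrite addrC -subr_eq subrr => /eqP.
Qed.

Let phiZ a x : S x -> phi (a *: x) = a * phi x.
Proof.
by move=> Sx; rewrite -[a *: x]addr0 phi_linear ?phi0 ?addr0//; exact: (si0 SB).
Qed.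

Let phiD x y : S x -> S y -> phi (x + y) = phi x + phi y.
Proof. by move=> Sx Sy; rewrite -[x in LHS]scale1r phi_linear// mul1r. Qed.

(** If phi is represented by r, this is |x - r|^2 - |r|^2, so the Riesz vector is its minimiser. *)
Let J x := nsq x - 2 * Re (phi x).

Let J_lb x : S x -> - `|M| <= J x.
Proof.
move=> Sx; rewrite /J; have h := phi_bounded Sx; have p := si_ge0 SB Sx.
have h2 : Re (phi x) ^+ 2 <= `|M| * nsq x.
  by apply: (le_trans h); rewrite ler_wpM2r// ler_norm.
by have := amgm2 h2 (normr_ge0 M) p; lra.
Qed.

Let JS := [set J x | x in S].
Let i := inf JS.

Let has_infJ : has_inf JS.
Proof.
split; first by exists (J 0), 0 => //; exact: (si0 SB).
by exists (- `|M|) => _ [x Sx <-]; exact: J_lb.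
Qed.

Let i_lb x : S x -> i <= J x.
Proof. by move=> Sx; apply: ge_inf; [exact: has_infJ.2|exists x]. Qed.

(* First-order optimality of an almost minimiser of [J]. *)
Let almost_min x (e : R) y : S x -> S y -> J x <= i + e ->
  (Re (B y x) - Re (phi y)) ^+ 2 <= nsq y * e.
Proof.
move=> Sx Sy Jx; apply: quadratic_ge0; first exact: (si_ge0 SB).
move=> t; have Sty : S (t%:C%C *: y) by exact: (siZ SB).
have := i_lb (siD SB Sty Sx); rewrite /J (nsqD SB)// (nsqZ SB)//= phiD// phiZ//.
rewrite (siZl SB)// !ReImE /=; move: Jx; rewrite /J; lra.
Qed.

(** A minimising sequence of [J] is Cauchy by the parallelogram identity, and the limit in
    [almost_min] identifies the real parts; replacing x by i x gives the imaginary ones. *)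
Theorem riesz_representation : exists2 r, S r & forall x, S x -> phi x = B x r.
Proof.
have : forall n : nat, exists s, S s /\ J s <= i + n.+1%:R^-1.
  move=> n; have [_ [s Ss <-] h] := inf_adherent (ltac:(by rewrite invr_gt0 ltr0Sn) : 0 < n.+1%:R^-1 :> R) has_infJ.
  by exists s; split => //; exact: ltW.
move=> /choice[s hs]; have Ss n := (hs n).1; have Js n := (hs n).2.
have archi (e : R) : 0 < e -> exists N : nat, forall n, (N <= n)%N -> n.+1%:R^-1 <= e.
  move=> e0; exists (Num.truncn e^-1) => n Nn.
  rewrite -[leRHS]invrK lef_pV2 ?posrE ?invr_gt0 ?ltr0Sn//.
  apply/ltW/(lt_le_trans (truncnS_gt _)).
  by rewrite ler_nat ltnS.
have [|l Sl hl] := cB Ss.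
  move=> /= e e0.
  have [N hN] := archi (e / 4) (ltac:(by rewrite divr_gt0)).
  exists N => m n Nm Nn; have Sd := siB SB (Ss m) (Ss n).
  (* [J] at the midpoint of s m and s n is at least i, which bounds |s m - s n|^2 by 2/(m+1) +
     2/(n+1). *)
  have Sh : S (2^-1%:C%C *: (s m + s n)) by apply: (siZ SB); exact: (siD SB).
  have Sa := siD SB (Ss m) (Ss n).
  have := i_lb Sh; rewrite /J (nsqZ SB _ Sa) (phiZ _ Sa) (phiD (Ss m) (Ss n)).
  rewrite (nsqD SB)// (nsqB SB)// !ReImE /=.
  have := Js m; have := Js n; rewrite /J.
  have -> : (2^-1 : R) ^+ 2 + 0 ^+ 2 = 4^-1 by field.
  have := hN _ Nm; have := hN _ Nn.
  move: (m.+1%:R^-1) (n.+1%:R^-1) => e1 e2.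
  move: (complex.Re (B (s n) (s n))) (complex.Re (B (s m) (s m))) (complex.Re (B (s m) (s n))) => a b c.
  move: (complex.Re (phi (s m))) (complex.Re (phi (s n))) (complex.Im (phi (s m))) (complex.Im (phi (s n))) => p q p' q'.
  lra.
have real_part x : S x -> Re (phi x) = Re (B x l).
  move=> Sx; apply/eqP; rewrite -subr_eq0; apply/eqP.
  apply: sqr_le_eps0 => e e0.
  (* Two errors, each entering with a factor 2, must stay below e / 4; the summand 1 covers null
     x. *)
  have q0 : 0 < 4 * (nsq x + 1) by have := si_ge0 SB Sx; lra.
  have [N1 hN1] := archi (e / (4 * (nsq x + 1))) (ltac:(by rewrite divr_gt0)).
  have [N2 hN2] := hl (e / (4 * (nsq x + 1))) (ltac:(by rewrite divr_gt0)).
  set n := maxn N1 N2.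
  have h1 := almost_min (Ss n) Sx (Js n).
  have Sd := siB SB (Ss n) Sl.
  have h2 := si_CS SB Sx Sd.
  rewrite (siBr SB) // ReD ReN in h2.
  have k1 := hN1 n (leq_maxl _ _); have k2 := hN2 n (leq_maxr _ _).
  have p := si_ge0 SB Sx.
  rewrite ler_pdivlMr // in k1; rewrite ler_pdivlMr // in k2.
  have i0 : 0 <= n.+1%:R^-1 :> R by rewrite invr_ge0.
  have d0 := si_ge0 SB Sd.
  move: h1 h2 k1 k2 i0 d0 p; clear.
  move: (Re (phi x)) (Re (B x (s n))) (Re (B x l)) (n.+1%:R^-1) (Re (B (s n - l) (s n - l))) (Re (B x x)) => a b c u v w.
  move=> h1 h2 g1 g2 i0 d0 p.
  have : (a - c) ^+ 2 <= 2 * (b - a) ^+ 2 + 2 * (b - c) ^+ 2.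
    have := sqr_ge0 ((b - a) + (b - c)); lra.
  lra.
exists l => // x Sx; apply: complex_extR; first exact: real_part.
have := real_part _ (siZ SB (0 +i* 1)%C Sx).
by rewrite phiZ// (siZl SB)// !ReImE /=; lra.
Qed.

End riesz.

(** * Integration on the circle *)

Section circle_measure.
Variable R : realType.
Local Notation mu := (@lebesgue_measure R).
Local Notation circ := (circle R).
Local Notation seg := (`[(- pi)%R, pi%R]%classic : set (measurableTypeR R)).
Local Notation Re := (@complex.Re R).
Local Notation Im := (@complex.Im R).

Lemma measurable_circleP d (T : measurableType d) (g : circ -> T) :
  measurable_fun setT (g \o @cis R) -> measurable_fun setT g.
Proof. by move=> mg _ A mA; rewrite setTI; have := mg measurableT A mA; rewrite setTI. Qed.

Lemma measurable_cisP d (T : measurableType d) (g : circ -> T) :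
  measurable_fun setT g -> measurable_fun setT (g \o @cis R).
Proof. by move=> mg; apply: measurableT_comp => //; exact: measurable_cis. Qed.

Lemma measurable_Re_sval : measurable_fun setT (fun z : circ => Re (sval z)).
Proof. by apply: measurable_circleP => /=; apply: continuous_measurable_fun; exact: continuous_cos. Qed.

Lemma measurable_Im_sval : measurable_fun setT (fun z : circ => Im (sval z)).
Proof. by apply: measurable_circleP => /=; apply: continuous_measurable_fun; exact: continuous_sin. Qed.

Lemma circle_val_inj (z w : circ) : sval z = sval w -> z = w.
Proof. by case: z w => [z hz] [w hw] /= zw; subst w; congr exist; exact: bool_irrelevance. Qed.

Lemma circle_conj_cis t : circle_conj (cis t) = cis (- t) :> circ.
Proof. by apply: circle_val_inj => /=; rewrite cosN sinN. Qed.

Lemma circle_conjK : involutive (@circle_conj R).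
Proof. by move=> z; apply: circle_val_inj; exact: conjcK. Qed.

Lemma measurable_circle_conj : measurable_fun setT (@circle_conj R).
Proof.
apply: measurable_circleP; rewrite (_ : _ \o _ = @cis R \o -%R).
  by apply: measurableT_comp; [exact: measurable_cis|exact: oppr_measurable].
by apply/funext => t /=; rewrite circle_conj_cis.
Qed.

Lemma circle_normE (z : circ) : Re (sval z) ^+ 2 + Im (sval z) ^+ 2 = 1.
Proof.
have := add_Re2_Im2 (sval z); rewrite (eqP (svalP z)) expr1n => /(congr1 Re).
by [].
Qed.

Lemma ge0_integral_haar (f : circ -> \bar R) : measurable_fun setT f ->
  (forall z, 0 <= f z)%E ->
  (\int[haar R]_z f z =
   ((pi *+ 2)^-1)%:E * \int[mu]_(t in seg) f (cis t))%E.
Proof.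
move=> mf f0; rewrite /haar ge0_integral_distribution//.
by rewrite integral_uniform//= opprK -mulr2n.
Qed.

(** By uniqueness of Lebesgue measure half-open intervals suffice; reflection swaps their open and
    closed ends, which does not change the length. *)
Lemma lebesgue_measureN (A : set (measurableTypeR R)) : measurable A ->
  mu (-%R @^-1` A) = mu A.
Proof.
move=> mA.
have mN : measurable_fun setT (-%R : measurableTypeR R -> measurableTypeR R).
  exact: oppr_measurable.
symmetry; apply: (@lebesgue_measure_unique R
  (pushforward mu (-%R : measurableTypeR R -> measurableTypeR R))) => // X.
move=> /ocitvP[->|[[a b] /= ab ->]]; first by rewrite measure0.
rewrite /pushforward (_ : _ @^-1` _ = `[- b, - a[%classic); last first.
  by apply/seteqP; split => x /=; rewrite !in_itv/= => /andP[? ?]; apply/andP; split; lra.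
by rewrite !lebesgue_measure_itv /= !lte_fin ltrN2 ab -!EFinD opprK addrC.
Qed.

Lemma ge0_integral_haar_conj (f : circ -> \bar R) : measurable_fun setT f ->
  (forall z, 0 <= f z)%E ->
  (\int[haar R]_z f (circle_conj z) = \int[haar R]_z f z)%E.
Proof.
move=> mf f0.
have mfc : measurable_fun setT (f \o @circle_conj R).
  by apply: measurableT_comp => //; exact: measurable_circle_conj.
rewrite (ge0_integral_haar mf)// (ge0_integral_haar mfc)//=; congr *%E.
have mN : measurable_fun setT (-%R : measurableTypeR R -> measurableTypeR R).
  exact: oppr_measurable.
under eq_integral do rewrite circle_conj_cis.
have mfi : measurable_fun seg (f \o @cis R).
  by apply: measurable_funTS; exact: measurable_cisP.
have := @ge0_integral_pushforward _ _ _ _ R _ mN mu seg (f \o @cis R) _ mfi.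
rewrite /= (_ : _ @^-1` _ = seg); last first.
  by apply/seteqP; split => x /=; rewrite !in_itv/= => /andP[? ?]; apply/andP; split; lra.
move=> <-//.
apply: eq_measure_integral => A mA _; rewrite /= /pushforward lebesgue_measureN//.
Qed.
End circle_measure.

(** * Hilbert spaces as complete semi-inner product spaces *)

Section hilbert.
Variables (R : realType) (E : hilbertType R).
Local Notation Re := (@complex.Re R).
Local Notation Im := (@complex.Im R).
Implicit Types x y : E.

Lemma hnormE x : `|x| = (hnorm x)%:C%C.
Proof. by rewrite /hnorm RRe_real// realE normr_ge0. Qed.

Lemma hnorm_ge0 x : 0 <= hnorm x.
Proof. by have := normr_ge0 x; rewrite hnormE ler0c. Qed.

Lemma inner_hnorm x : inner x x = (hnorm x ^+ 2)%:C%C.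
Proof. by rewrite inner_norm hnormE -rmorphXn. Qed.

Lemma hnorm_sqr x : hnorm x ^+ 2 = Re (inner x x).
Proof. by rewrite inner_hnorm. Qed.

Lemma semi_inner_hilbert : @semi_inner R E setT (@inner R E).
Proof.
split => //.
- by move=> a x y z _ _ _; rewrite linearPl.
- by move=> x y _ _; rewrite hermC expr0 mul1r.
- by move=> x _; rewrite -hnorm_sqr sqr_ge0.
Qed.

Lemma hnorm_ltP x (e : R) : 0 < e -> (`|x| < e%:C%C) = (Re (inner x x) < e ^+ 2).
Proof.
move=> e0; rewrite -hnorm_sqr hnormE ltcR -subr_gt0 -[RHS]subr_gt0 subr_sqr.
by rewrite pmulr_lgt0// ltr_wpDr// hnorm_ge0.
Qed.

Lemma complex_gt0 (e : R[i]) : 0 < e -> 0 < Re e /\ e = (Re e)%:C%C.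
Proof. by case: e => a b; rewrite ltcE /= => /andP[/eqP -> ->]. Qed.

Lemma si_complete_hilbert : @si_complete R E setT (@inner R E).
Proof.
move=> u _ cu.
have cvgu : cvg (u @ \oo).
  apply: cauchy_cvg; apply/cauchy_ballP => e e0.
  have [r0 ->] := complex_gt0 e0; set r := Re e in r0 *.
  have [N hN] := cu (r ^+ 2 / 2) ltac:(by rewrite divr_gt0// exprn_gt0).
  pose A := [set u n | n in [set n | (N <= n)%N]].
  have uA : (u @ \oo) A by exists N => // n Nn; exists n.
  exists (A, A) => // -[_ _] [/= [m Nm <-] [n Nn <-]].
  rewrite -ball_normE /ball_/= hnorm_ltP//; apply: le_lt_trans (hN m n Nm Nn) _.
  by rewrite ltr_pdivrMr// ltr_pMr ?exprn_gt0// ltr1n.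
exists (lim (u @ \oo)) => // e e0.
have /cvgrPdist_lt h := cvgu.
have s0 : 0 < Num.sqrt e by rewrite sqrtr_gt0.
have := h (Num.sqrt e)%:C%C; rewrite ltcR => /(_ s0)[N _ hN].
exists N => n Nn; have := hN n Nn; rewrite hnorm_ltP//= sqr_sqrtr; last exact: ltW.
by move=> /ltW; rewrite (nsqBC semi_inner_hilbert).
Qed.

Lemma dense_seq : separable E -> exists d : nat -> E,
  forall x (e : R), 0 < e -> exists n, Re (inner (x - d n) (x - d n)) < e.
Proof.
move=> [A cA dA].
have A0 : A !=set0.
  by have [|x [_ Ax]] := dA setT _ openT; [exists 0|exists x].
have /pfcard_geP[A00|[f]] := cA; first by move: A0; rewrite A00 => -[].
exists f => x e e0.
have s0 : (0 : R[i]) < (Num.sqrt e)%:C%C by rewrite ltcR sqrtr_gt0.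
have [|y []] := dA (ball x (Num.sqrt e)%:C%C) _ (ball_open _ _).
  by exists x; exact: ballxx.
rewrite -ball_normE /ball_/= hnorm_ltP ?sqrtr_gt0// sqr_sqrtr; last exact: ltW.
move=> xy Ay.
by have [n _ fn] := 'surj_f Ay; exists n; rewrite fn.
Qed.

End hilbert.

(** * Integrals of complex functions on the circle *)

Section complex_integral.
Variable R : realType.
Local Notation circ := (circle R).
Local Notation P := (haar R).
Local Notation Re := (@complex.Re R).
Local Notation Im := (@complex.Im R).
Implicit Types f g : circ -> R[i].

Definition cintegrable f :=
  P.-integrable setT (EFin \o (fun z => Re (f z))) /\
  P.-integrable setT (EFin \o (fun z => Im (f z))).

Lemma cmeasurable_cst (a : R[i]) : cmeasurable (fun=> a).
Proof. by split. Qed.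

Lemma cmeasurableD f g : cmeasurable f -> cmeasurable g ->
  cmeasurable (fun z => f z + g z).
Proof.
move=> [f1 f2] [g1 g2]; split.
  by under eq_fun do rewrite ReD; exact: measurable_funD.
by under eq_fun do rewrite ImD; exact: measurable_funD.
Qed.

Lemma cmeasurableM f g : cmeasurable f -> cmeasurable g ->
  cmeasurable (fun z => f z * g z).
Proof.
move=> [f1 f2] [g1 g2]; split.
  by under eq_fun do rewrite Re_mul; apply: measurable_funB; exact: measurable_funM.
by under eq_fun do rewrite Im_mul; apply: measurable_funD; exact: measurable_funM.
Qed.

Lemma cmeasurable_conj f : cmeasurable f -> cmeasurable (fun z => (f z)^*).
Proof.
move=> [f1 f2]; split; first by under eq_fun do rewrite ReJ.
by under eq_fun do rewrite ImJ; apply: measurableT_comp.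
Qed.

Lemma cmeasurable_sval : cmeasurable (fun z : circ => sval z).
Proof. by split; [exact: measurable_Re_sval|exact: measurable_Im_sval]. Qed.

Lemma cmeasurableX f n : cmeasurable f -> cmeasurable (fun z => f z ^+ n).
Proof.
move=> mf; elim: n => [|n IH]; first by under eq_fun do rewrite expr0; exact: cmeasurable_cst.
by under eq_fun do rewrite exprS; exact: cmeasurableM.
Qed.

Lemma cmeasurable_circle_conj f : cmeasurable f ->
  cmeasurable (fun z => f (circle_conj z)).
Proof.
by move=> [f1 f2]; split; [move: f1|move: f2] => mf;
  apply: (measurableT_comp mf); exact: measurable_circle_conj.
Qed.

Lemma cintegrableD f g : cintegrable f -> cintegrable g ->
  cintegrable (fun z => f z + g z).
Proof.
move=> [f1 f2] [g1 g2]; split.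
  by apply: eq_integrable (integrableD _ f1 g1) => //= z _; rewrite ReD.
by apply: eq_integrable (integrableD _ f2 g2) => //= z _; rewrite ImD.
Qed.

Lemma cintegrableZ (a : R[i]) f : cintegrable f ->
  cintegrable (fun z => a * f z).
Proof.
move=> [f1 f2]; split.
  apply: eq_integrable (integrableB _ (integrableZl _ (Re a) f1) (integrableZl _ (Im a) f2)) => //=.
  by move=> z _; rewrite Re_mul.
apply: eq_integrable (integrableD _ (integrableZl _ (Re a) f2) (integrableZl _ (Im a) f1)) => //=.
by move=> z _; rewrite Im_mul.
Qed.

Lemma cintegrable_le f (g : circ -> R) : cmeasurable f ->
  P.-integrable setT (EFin \o g) ->
  (forall z, `|Re (f z)| <= g z) -> (forall z, `|Im (f z)| <= g z) ->
  cintegrable f.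
Proof.
move=> [f1 f2] ig fg1 fg2; split; apply: le_integrable ig => //=.
- exact/measurable_EFinP.
- by move=> z _; rewrite lee_fin (le_trans (fg1 z))// ler_norm.
- exact/measurable_EFinP.
- by move=> z _; rewrite lee_fin (le_trans (fg2 z))// ler_norm.
Qed.

Lemma cintegralD f g : cintegrable f -> cintegrable g ->
  cintegral (fun z => f z + g z) = cintegral f + cintegral g.
Proof.
move=> [f1 f2] [g1 g2]; apply: complex_extR => /=.
  by under eq_Rintegral do rewrite ReD; rewrite RintegralD.
by under eq_Rintegral do rewrite ImD; rewrite RintegralD.
Qed.

Lemma integrable_mulr (a : R) (f : circ -> R) :
  P.-integrable setT (EFin \o f) ->
  P.-integrable setT (EFin \o (fun z => a * f z)).
Proof. by move=> If; exact: eq_integrable (integrableZl _ a If). Qed.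

Lemma integrable_addr (f g : circ -> R) :
  P.-integrable setT (EFin \o f) -> P.-integrable setT (EFin \o g) ->
  P.-integrable setT (EFin \o (fun z => f z + g z)).
Proof. by move=> If Ig; exact: eq_integrable (integrableD _ If Ig). Qed.

Lemma Rintegral_haar_cst (c : R) : \int[P]_z c = c.
Proof.
rewrite /Rintegral (integral_cst P measurableT c%:E).
by rewrite [X in (_ * X)%E](_ : _ = 1%E) ?mule1//; exact: probability_setT.
Qed.

Lemma cintegralZ (a : R[i]) f : cintegrable f ->
  cintegral (fun z => a * f z) = a * cintegral f.
Proof.
move=> [f1 f2]; apply: complex_extR; rewrite ?Re_mul ?Im_mul /=.
  under eq_Rintegral do rewrite Re_mul.
  rewrite RintegralB//; try exact: integrable_mulr.
  by rewrite !RintegralZl.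
under eq_Rintegral do rewrite Im_mul.
rewrite RintegralD//; try exact: integrable_mulr.
by rewrite !RintegralZl.
Qed.

Lemma cintegral_conj f : cintegrable f ->
  cintegral (fun z => (f z)^*) = (cintegral f)^*.
Proof.
move=> [f1 f2]; apply: complex_extR; rewrite ?ReJ ?ImJ /=.
  by under eq_Rintegral do rewrite ReJ.
under eq_Rintegral do rewrite ImJ -mulN1r.
by rewrite RintegralZl// mulN1r.
Qed.

Lemma ae_Rintegral (f g : circ -> R) : measurable_fun setT f ->
  measurable_fun setT g -> aeeq f g -> \int[P]_z f z = \int[P]_z g z.
Proof.
move=> mf mg fg; rewrite /Rintegral; congr fine; apply: ae_eq_integral => //.
- exact/measurable_EFinP.
- exact/measurable_EFinP.
- by apply: filterS fg => z /= ->.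
Qed.

Lemma ae_cintegral f g : cmeasurable f -> cmeasurable g -> aeeq f g ->
  cintegral f = cintegral g.
Proof.
move=> [f1 f2] [g1 g2] fg; rewrite /cintegral.
by congr Complex; apply: ae_Rintegral => //; apply: filterS fg => z ->.
Qed.

Lemma Rintegral_haar_conj (f : circ -> R) : measurable_fun setT f ->
  \int[P]_z f (circle_conj z) = \int[P]_z f z.
Proof.
move=> mf; rewrite /Rintegral; congr fine.
have mF : measurable_fun setT (EFin \o f) by exact/measurable_EFinP.
rewrite integralE [RHS]integralE; congr (_ - _)%E.
  rewrite -(ge0_integral_haar_conj (measurable_funepos mF) (funepos_ge0 _)).
  by apply: eq_integral => z _; rewrite !funeposE.
rewrite -(ge0_integral_haar_conj (measurable_funeneg mF) (funeneg_ge0 _)).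
  by apply: eq_integral => z _; rewrite !funenegE.
Qed.

Lemma cintegral_haar_conj f : cmeasurable f ->
  cintegral (fun z => f (circle_conj z)) = cintegral f.
Proof.
move=> [f1 f2]; rewrite /cintegral.
by rewrite (Rintegral_haar_conj f1) (Rintegral_haar_conj f2).
Qed.

End complex_integral.

(** * Square integrable functions *)

Section L2_space.
Variables (R : realType) (E : hilbertType R).
Hypothesis sepE : separable E.
Local Notation circ := (circle R).
Local Notation P := (haar R).
Local Notation Re := (@complex.Re R).
Local Notation Im := (@complex.Im R).
Local Notation SE := (semi_inner_hilbert E).
Implicit Types f g h : circ -> E.

Definition wmeasurable f := forall x, cmeasurable (fun z => inner (f z) x).

Lemma wmeasurableP (a : R[i]) f g : wmeasurable f -> wmeasurable g ->
  wmeasurable (a *: f + g).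
Proof.
move=> mf mg x; under eq_fun do rewrite (si_linear SE)//.
by apply: cmeasurableD => //; apply: cmeasurableM => //; exact: cmeasurable_cst.
Qed.

Lemma wmeasurable_mul (u : circ -> R[i]) f : cmeasurable u -> wmeasurable f ->
  wmeasurable (fun z => u z *: f z).
Proof.
move=> mu mf x; under eq_fun do rewrite (siZl SE)//.
exact: cmeasurableM.
Qed.

Lemma wmeasurable_cst (e : E) : wmeasurable (fun=> e).
Proof. by move=> x; exact: cmeasurable_cst. Qed.

Lemma wmeasurable_circle_conj f : wmeasurable f ->
  wmeasurable (fun z => f (circle_conj z)).
Proof. by move=> mf x; exact: (cmeasurable_circle_conj (mf x)). Qed.

(* [|x|^2] is the supremum of [2 Re <x, d> - |d|^2] over a dense set of [d]. *)
Lemma measurable_hnorm_sqr f : wmeasurable f ->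
  measurable_fun setT (fun z => hnorm (f z) ^+ 2).
Proof.
move=> mf; have [d dd] := dense_seq sepE.
pose G n z := 2 * Re (inner (f z) (d n)) - hnorm (d n) ^+ 2.
have mG n : measurable_fun setT (G n).
  apply: measurable_funB => //; apply: measurable_funM => //.
  exact: (mf (d n)).1.
have GE n z : G n z = hnorm (f z) ^+ 2 - Re (inner (f z - d n) (f z - d n)).
  rewrite /G !hnorm_sqr (nsqB SE)//; lra.
move=> mD; apply: (measurability _ (RGenOInfty.measurableE R)) => //.
move=> /= _ [_ [x ->] <-]; rewrite setTI.
rewrite (_ : _ @^-1` _ = \bigcup_n (G n @^-1` `]x, +oo[)); last first.
  apply/seteqP; split => z /=; rewrite ?in_itv/= ?andbT => xz.
    have [n hn] := dd (f z) _ (ltac:(by rewrite subr_gt0) : 0 < hnorm (f z) ^+ 2 - x).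
    by exists n => //=; rewrite in_itv/= andbT GE; lra.
  have [n _ /=] := xz; rewrite in_itv/= andbT GE => h.
  by have := si_ge0 SE (x := f z - d n) I; lra.
by apply: bigcup_measurable => n _; rewrite -[X in measurable X]setTI; exact: mG.
Qed.

Lemma Re_inner_polar (x y : E) :
  Re (inner x y) = (hnorm (x + y) ^+ 2 - hnorm x ^+ 2 - hnorm y ^+ 2) / 2.
Proof. by rewrite !hnorm_sqr (nsqD SE)//; field. Qed.

Lemma Im_inner (x y : E) : Im (inner x y) = Re (inner x ((0 +i* 1)%C *: y)).
Proof. by rewrite (siZr SE)// Re_mul ReJ ImJ /=; ring. Qed.

(** Polarisation expresses the real part through squared norms of f, g and f + g; the imaginary part
    is the real part against i g. *)
Lemma cmeasurable_inner f g : wmeasurable f -> wmeasurable g ->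
  cmeasurable (fun z => inner (f z) (g z)).
Proof.
move=> mf mg.
have mRe h : wmeasurable h -> measurable_fun setT (fun z => Re (inner (f z) (h z))).
  move=> mh; under eq_fun do rewrite Re_inner_polar.
  apply: measurable_funM => //; apply: measurable_funB; last exact: measurable_hnorm_sqr.
  apply: measurable_funB; last exact: measurable_hnorm_sqr.
  have := wmeasurableP 1 mf mh; rewrite scale1r; exact: measurable_hnorm_sqr.
split; first exact: mRe.
under eq_fun do rewrite Im_inner; apply: (mRe (fun z => _ *: g z)).
by apply: wmeasurable_mul => //; exact: cmeasurable_cst.
Qed.

Lemma L2E f : L2 E f <-> wmeasurable f /\
  P.-integrable setT (EFin \o (fun z => hnorm (f z) ^+ 2)).
Proof.
split=> -[mf fi]; split => //.
  apply/integrableP; split; first by apply/measurable_EFinP; exact: measurable_hnorm_sqr.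
  apply: le_lt_trans fi; rewrite le_eqVlt; apply/orP; left; apply/eqP.
  by apply: eq_integral => z _ /=; rewrite ger0_norm// sqr_ge0.
have /integrableP[_] := fi; apply: le_lt_trans; rewrite le_eqVlt; apply/orP; left.
by apply/eqP/eq_integral => z _ /=; rewrite ger0_norm// sqr_ge0.
Qed.

Lemma Re_inner_le (x y : E) : `|Re (inner x y)| <= hnorm x ^+ 2 + hnorm y ^+ 2.
Proof.
rewrite !hnorm_sqr ler_norml; have := si_ge0 SE (x := x + y) I.
have := si_ge0 SE (x := x - y) I; rewrite (nsqB SE)// (nsqD SE)//.
have := si_ge0 SE (x := x) I; have := si_ge0 SE (x := y) I.
by move=> *; apply/andP; split; lra.
Qed.

Lemma Im_inner_le (x y : E) : `|Im (inner x y)| <= hnorm x ^+ 2 + hnorm y ^+ 2.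
Proof.
rewrite Im_inner; apply: le_trans (Re_inner_le _ _) _.
by rewrite lerD2l !hnorm_sqr (nsqZ SE)//= expr0n expr1n /= add0r mul1r.
Qed.

Lemma cintegrable_inner f g : L2 E f -> L2 E g ->
  cintegrable (fun z => inner (f z) (g z)).
Proof.
move=> /L2E[mf fi] /L2E[mg gi].
apply: (@cintegrable_le _ _ (fun z => hnorm (f z) ^+ 2 + hnorm (g z) ^+ 2)).
- exact: cmeasurable_inner.
- exact: integrable_addr.
- by move=> z; exact: Re_inner_le.
- by move=> z; exact: Im_inner_le.
Qed.

Lemma L2_le f (g : circ -> R) : wmeasurable f ->
  P.-integrable setT (EFin \o g) -> (forall z, hnorm (f z) ^+ 2 <= g z) ->
  L2 E f.
Proof.
move=> mf gi fg; apply/L2E; split => //; apply: le_integrable gi => //.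
  by apply/measurable_EFinP; exact: measurable_hnorm_sqr.
by move=> z _ /=; rewrite lee_fin ger0_norm ?sqr_ge0// (le_trans (fg z))// ler_norm.
Qed.

Lemma integrable_cst (c : R) : P.-integrable setT (EFin \o (fun=> c)).
Proof. exact: finite_measure_integrable_cst. Qed.

Lemma L2_cst (e : E) : L2 E (fun=> e).
Proof.
by apply: (L2_le _ (integrable_cst (hnorm e ^+ 2))) => //; exact: wmeasurable_cst.
Qed.

Lemma L2P (a : R[i]) f g : L2 E f -> L2 E g -> L2 E (a *: f + g).
Proof.
move=> /L2E[mf fi] /L2E[mg gi].
apply: (@L2_le _ (fun z => (2 * (Re a ^+ 2 + Im a ^+ 2)) * hnorm (f z) ^+ 2 +
    2 * hnorm (g z) ^+ 2)).
- exact: wmeasurableP.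
- by apply: integrable_addr; exact: integrable_mulr.
- move=> z; rewrite !hnorm_sqr; apply: le_trans (nsqD_le SE _ _) _ => //.
  by rewrite (nsqZ SE)// mulrA.
Qed.

Lemma L2_mul (u : circ -> R[i]) f (M : R) : cmeasurable u ->
  (forall z, Re (u z) ^+ 2 + Im (u z) ^+ 2 <= M) -> L2 E f ->
  L2 E (fun z => u z *: f z).
Proof.
move=> mu uM /L2E[mf fi].
apply: (@L2_le _ (fun z => M * hnorm (f z) ^+ 2)).
- exact: wmeasurable_mul.
- exact: integrable_mulr.
- by move=> z; rewrite !hnorm_sqr (nsqZ SE)// ler_wpM2r// -hnorm_sqr sqr_ge0.
Qed.

Lemma semi_inner_L2 : semi_inner (L2 E) (@L2inner R E).
Proof.
split.
- exact: L2_cst.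
- exact: L2P.
- move=> a f g h Lf Lg Lh; have ifh := cintegrable_inner Lf Lh.
  have igh := cintegrable_inner Lg Lh.
  rewrite /L2inner -(cintegralZ a ifh) -(cintegralD (cintegrableZ a ifh) igh).
  by congr cintegral; apply/funext => z; rewrite (si_linear SE).
- move=> f g Lf Lg; rewrite /L2inner -(cintegral_conj (cintegrable_inner Lf Lg)).
  by congr cintegral; apply/funext => z; rewrite (siC SE).
- move=> f Lf; apply: Rintegral_ge0 => z _; exact: (si_ge0 SE).
Qed.

Lemma Re_L2inner f : Re (L2inner f f) = \int[P]_z (hnorm (f z) ^+ 2).
Proof. by apply: eq_Rintegral => z _; rewrite hnorm_sqr. Qed.

Lemma Re_L2inner_ge0 f : 0 <= Re (L2inner f f).
Proof. by apply: Rintegral_ge0 => z _; exact: (si_ge0 SE). Qed.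

Lemma L2norm_sqr f : L2norm f ^+ 2 = Re (L2inner f f).
Proof. by rewrite /L2norm sqr_sqrtr ?Re_L2inner// -Re_L2inner Re_L2inner_ge0. Qed.

Lemma L2inner_ae f g h : L2 E f -> L2 E g -> L2 E h -> aeeq f g ->
  L2inner f h = L2inner g h.
Proof.
move=> [mf _] [mg _] [mh _] fg.
apply: ae_cintegral; [exact: cmeasurable_inner|exact: cmeasurable_inner|].
by apply: filterS fg => z ->.
Qed.

Lemma L2_null f : L2 E f -> Re (L2inner f f) = 0 -> aeeq f 0.
Proof.
move=> /L2E[mf fi]; rewrite Re_L2inner => f0.
have mn := measurable_hnorm_sqr mf.
have : (\int[P]_z `|(hnorm (f z) ^+ 2)%:E| = 0)%E.
  rewrite -[RHS]/(0%R%:E) -f0 fineK.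
    by apply: eq_integral => z _ /=; rewrite ger0_norm// sqr_ge0.
  exact: integrable_fin_num.
move/ae_eq_integral_abs => /(_ measurableT) h.
have := h ltac:(exact/measurable_EFinP); apply: filterS => z /(_ I) [] /=.
by move/eqP; rewrite expf_eq0/= /hnorm => /eqP z0; apply/normr0_eq0; rewrite hnormE /hnorm z0.
Qed.

Lemma aeeqB f g : aeeq f g <-> aeeq (f - g) 0.
Proof.
split; apply: filterS => z; first by move=> fg; rewrite /= /GRing.add /= fg subrr.
by move/eqP; rewrite subr_eq0 => /eqP.
Qed.

End L2_space.

(** * Completeness of the space of square integrable functions *)

Section L2_complete.
Variables (R : realType) (E : hilbertType R).
Hypothesis sepE : separable E.
Local Notation circ := (circle R).
Local Notation P := (haar R).
Local Notation Re := (@complex.Re R).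
Local Notation Im := (@complex.Im R).
Local Notation SE := (semi_inner_hilbert E).
Local Notation SL := (semi_inner_L2 sepE).

Lemma hnorm_triangle (x y : E) : hnorm (x + y) <= hnorm x + hnorm y.
Proof. by have := ler_normD x y; rewrite !hnormE -rmorphD/= lecR. Qed.

Lemma hnormN (x : E) : hnorm (- x) = hnorm x.
Proof. by rewrite /hnorm normrN. Qed.

Lemma hnormB_sum (v : nat -> E) (D : nat -> R) n m :
  (forall k, hnorm (v k.+1 - v k) <= D k) -> (n <= m)%N ->
  hnorm (v m - v n) <= \sum_(k < m) D k - \sum_(k < n) D k.
Proof.
move=> vD; elim: m => [|m IH] nm.
  by move: nm; rewrite leqn0 => /eqP ->; rewrite !subrr /hnorm normr0.
have [->|nm'] := eqVneq n m.+1; first by rewrite !subrr /hnorm normr0.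
rewrite big_ord_recr/= (_ : v m.+1 - v n = (v m.+1 - v m) + (v m - v n)); last first.
  by rewrite addrA subrK.
apply: le_trans (hnorm_triangle _ _) _.
have := vD m; have := IH ltac:(by rewrite -ltnS ltn_neqAle nm' nm); lra.
Qed.

(** The sums of [D] increase and are bounded; beyond an index where they are within d of their
    supremum, v moves by at most d. *)
Lemma bounded_sum_cauchy (v : nat -> E) (D : nat -> R) (M : R) :
  (forall k, hnorm (v k.+1 - v k) <= D k) ->
  (forall n, \sum_(k < n) D k <= M) ->
  exists l, forall e : R, 0 < e ->
    exists N, forall n, (N <= n)%N -> Re (inner (v n - l) (v n - l)) <= e.
Proof.
move=> vD SM; have D0 k : 0 <= D k by apply: le_trans (vD k); exact: hnorm_ge0.
have [|l _ hl] := @si_complete_hilbert R E v (fun=> I); last by exists l.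
move=> e e0; pose S n := \sum_(k < n) D k.
have hS : has_sup (range S).
  by split; [exists (S 0%N), 0%N|exists M => _ [n _ <-]; exact: SM].
pose d : R := Num.sqrt e / 2; have d0 : 0 < d by rewrite divr_gt0// sqrtr_gt0.
have [_ [N _ <-] hN] := sup_adherent d0 hS.
have Sle n : S n <= sup (range S) by apply: ub_le_sup; [exact: hS.2|exists n].
exists N => m n Nm Nn.
have hm : hnorm (v m - v N) <= d.
  by have := hnormB_sum vD Nm; have := Sle m; rewrite /S; rewrite /S in hN; lra.
have hn : hnorm (v n - v N) <= d.
  by have := hnormB_sum vD Nn; have := Sle n; rewrite /S; rewrite /S in hN; lra.
rewrite -hnorm_sqr (_ : v m - v n = (v m - v N) + (- (v n - v N))); last first.
  by rewrite opprB addrA subrK.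
have := hnorm_triangle (v m - v N) (- (v n - v N)); rewrite hnormN => h.
rewrite -[leRHS]sqr_sqrtr; last exact: ltW.
rewrite ler_pXn2r ?nnegrE ?hnorm_ge0 ?sqrtr_ge0//.
have := (ltac:(by rewrite /d; field) : Num.sqrt e = 2 * d); lra.
Qed.

Lemma fatou_bound (f : nat -> circ -> R) (g : circ -> R) (c : R) :
  (forall n, measurable_fun setT (f n)) -> (forall n z, 0 <= f n z) ->
  (forall z, f n z @[n --> \oo] --> g z) ->
  (forall n, (\int[P]_z (f n z)%:E <= c%:E)%E) ->
  (\int[P]_z (g z)%:E <= c%:E)%E.
Proof.
move=> mf f0 fg fc.
have := @fatou _ _ _ P setT measurableT (fun n z => (f n z)%:E) _ _.
move=> h; apply: le_trans (le_trans (h _ _) _) => //.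
- rewrite le_eqVlt; apply/orP; left; apply/eqP/eq_integral => z _.
  have hz : (f n z)%:E @[n --> \oo] --> (g z)%:E.
    by apply: cvg_EFin; [exact: nearW|exact: fg].
  by rewrite (cvg_limn_einf_sup hz).1.
- by move=> n; exact/measurable_EFinP.
- by move=> n z _; rewrite lee_fin.
- rewrite limn_einf_lim; apply: lime_le; first exact: is_cvg_einfs.
  apply: nearW => n; apply: le_trans (fc n); apply: ereal_inf_lbound.
  by exists n => /=.
Qed.

Lemma norm_le_sqr (x e : R) : 0 < e -> x ^+ 2 <= e ^+ 2 -> `|x| <= e.
Proof.
move=> e0 h; rewrite -(@ler_pXn2r _ 2) ?nnegrE ?normr_ge0 ?(ltW e0)//.
by rewrite real_normK ?num_real.
Qed.

Lemma nsq_cvg (v : nat -> E) (l x : E) :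
  (forall e : R, 0 < e ->
    exists N, forall n, (N <= n)%N -> Re (inner (v n - l) (v n - l)) <= e) ->
  Re (inner (v n) x) @[n --> \oo] --> Re (inner l x).
Proof.
move=> h; apply/cvgrPdist_le => e e0; pose q := Re (inner x x) + 1.
have q0 : 0 < q by have := si_ge0 SE (x := x) I; rewrite /q; lra.
have [N hN] := h (e ^+ 2 / q) ltac:(by rewrite divr_gt0// exprn_gt0).
exists N => // n Nn; have := hN n Nn.
move=> hn; apply: norm_le_sqr => //.
have := si_CS SE (x := v n - l) (y := x) I I; rewrite (siBl SE)// ReD ReN.
have := si_ge0 SE (x := x) I.
have := si_ge0 SE (x := v n - l) I.
rewrite ler_pdivlMr// in hn; rewrite /q in hn.
move: hn; move: (Re (inner (v n - l) (v n - l))) (Re (inner x x)) (Re (inner l x)) (Re (inner (v n) x)) => a b c d.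
move=> h1 h2 h3 h4; have -> : (c - d) ^+ 2 = (d - c) ^+ 2 by ring.
by apply: (le_trans h4); lra.
Qed.

Lemma hnorm_sqr_cvg (v : nat -> E) (l x : E) :
  (forall e : R, 0 < e ->
    exists N, forall n, (N <= n)%N -> Re (inner (v n - l) (v n - l)) <= e) ->
  hnorm (v n - x) ^+ 2 @[n --> \oo] --> hnorm (l - x) ^+ 2.
Proof.
move=> h.
have h1 : Re (inner (v n - l) (v n - l)) @[n --> \oo] --> (0 : R).
  apply/cvgrPdist_le => e e0; have [N hN] := h e e0; exists N => // n Nn /=.
  by rewrite sub0r normrN ger0_norm ?hN//; exact: (si_ge0 SE).
have -> : (fun n => hnorm (v n - x) ^+ 2) = (fun n => Re (inner (v n - l) (v n - l))
    + 2 * (Re (inner (v n) (l - x)) - Re (inner l (l - x))) + hnorm (l - x) ^+ 2).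
  apply/funext => n; rewrite (_ : v n - x = (v n - l) + (l - x)); last first.
    by rewrite addrA subrK.
  by rewrite !hnorm_sqr (nsqD SE)// [in X in 2 * X](siBl SE)// ReD ReN; ring.
rewrite -[X in _ --> X]add0r; apply: cvgD; last exact: cvg_cst.
rewrite -[X in _ --> X]addr0; apply: cvgD => //.
rewrite -[X in _ --> X](mulr0 2) -[X in _ * X](subrr (Re (inner l (l - x)))).
by apply: cvgMr; apply: cvgB; [exact: nsq_cvg|exact: cvg_cst].
Qed.

Lemma wmeasurable_cvg (w : nat -> circ -> E) (l : circ -> E) :
  (forall n, wmeasurable (w n)) ->
  (forall z (e : R), 0 < e -> exists N, forall n, (N <= n)%N ->
    Re (inner (w n z - l z) (w n z - l z)) <= e) -> wmeasurable l.
Proof.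
move=> mw wl x.
have mRe y : measurable_fun setT (fun z => Re (inner (l z) y)).
  apply: (@measurable_fun_cvg _ _ _ _ (fun n z => Re (inner (w n z) y))).
    by move=> n; exact: (mw n y).1.
  by move=> z _; exact: (@nsq_cvg (fun n => w n z) (l z) y (wl z)).
by split => //; under eq_fun do rewrite Im_inner; exact: mRe.
Qed.

Let weight (k : nat) : R := (2 ^ k.+1)%:R^-1.

Let weight_gt0 k : 0 < weight k.
Proof. by rewrite invr_gt0 ltr0n expn_gt0. Qed.

(** Tonelli: the weights sum to 1, so the sum of the q k is integrable and therefore finite almost
    everywhere. *)
Lemma summable_ae (q : nat -> circ -> R) :
  (forall k, measurable_fun setT (q k)) -> (forall k z, 0 <= q k z) ->
  (forall k, (\int[P]_z (q k z)%:E <= (weight k)%:E)%E) ->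
  {ae P, forall z, exists M : R, forall n, \sum_(k < n) q k z <= M}.
Proof.
move=> mq q0 qw.
have mE k : measurable_fun setT (fun z => (q k z)%:E) by exact/measurable_EFinP.
pose G z := (\sum_(0 <= k <oo) (q k z)%:E)%E.
have mG : measurable_fun setT G.
  by apply: ge0_emeasurable_sum => // k z _ _; rewrite lee_fin.
have IG : P.-integrable setT G.
  apply/integrableP; split => //.
  under eq_integral.
    move=> z _; rewrite gee0_abs; last by apply: nneseries_ge0 => k _ _; rewrite lee_fin.
    over.
  rewrite integral_nneseries//; last by move=> k z _; rewrite lee_fin.
  apply: (@le_lt_trans _ _ (\sum_(0 <= k <oo) (weight k)%:E)%E).
    by apply: lee_nneseries => // k _ _; apply: integral_ge0 => z _; rewrite lee_fin.
  have := @cvg_geometric_eseries_half R 1 0.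
  rewrite (_ : (fun k => _) = (fun k => (weight k)%:E)); last first.
    by apply/funext => k; rewrite /weight addn1 mul1r.
  by move/cvg_lim => ->//; rewrite ltry.
have := integrable_ae measurableT IG; apply: filterS => z /(_ I) Gz.
exists (fine (G z)) => n; rewrite -lee_fin fineK// -sumEFin -(big_mkord xpredT (fun k => (q k z)%:E)).
by apply: nneseries_lim_ge => k _ _; rewrite lee_fin.
Qed.

(** Riesz-Fischer. A fast subsequence converges almost everywhere to a function l; Fatou's lemma
    then bounds the distance from l to every late u m, not only along the subsequence. *)
Theorem L2_complete : si_complete (L2 E) (@L2inner R E).
Proof.
move=> u Lu cu.
have /choice[N hN] : forall k, exists N, forall m n, (N <= m)%N -> (N <= n)%N ->
    Re (L2inner (u m - u n) (u m - u n)) <= weight k ^+ 2.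
  by move=> k; apply: cu; rewrite exprn_gt0.
(* A sum of thresholds dominates each of them, so s k lies beyond N j for all j <= k. *)
pose s k := (\sum_(j < k.+1) N j)%N; pose v k := u (s k).
have sN k j : (j <= k)%N -> (N j <= s k)%N.
  by move=> jk; rewrite /s (bigD1 (Ordinal (ltac:(by []) : (j < k.+1)%N)))//= leq_addr.
have vk k : Re (L2inner (v k.+1 - v k) (v k.+1 - v k)) <= weight k ^+ 2.
  by apply: hN; exact: sN.
have Lv k : L2 E (v k) by exact: Lu.
(* By the arithmetic-geometric mean inequality q k dominates the norm of the increment, and its
   integral is at most weight k; in this form only squared norms are integrated. *)
pose q k z := (weight k + (weight k)^-1 * hnorm (v k.+1 z - v k z) ^+ 2) / 2.
have Lvv k : L2 E (v k.+1 - v k) by exact: (siB SL).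
have mh k : measurable_fun setT (fun z => hnorm (v k.+1 z - v k z) ^+ 2).
  by apply: (@measurable_hnorm_sqr _ _ sepE (v k.+1 - v k)); exact: (Lvv k).1.
have mq k : measurable_fun setT (q k).
  by apply: measurable_funM => //; apply: measurable_funD => //; exact: measurable_funM.
have q0 k z : 0 <= q k z.
  by have w0 := weight_gt0 k; rewrite /q divr_ge0// addr_ge0 ?(ltW w0)// mulr_ge0 ?sqr_ge0// invr_ge0 (ltW w0).
have vq k z : hnorm (v k.+1 z - v k z) <= q k z.
  rewrite /q; have := weight_gt0 k; move: (weight k) (hnorm _) => a b a0.
  have := sqr_ge0 (a - b) => h.
  have -> : (a + a^-1 * b ^+ 2) / 2 = b + (a - b) ^+ 2 / (2 * a).
    by field; rewrite gt_eqF.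
  by rewrite lerDl divr_ge0// mulr_ge0// ltW.
have Iq k : (\int[P]_z (q k z)%:E <= (weight k)%:E)%E.
  have Ih := ((L2E sepE _).1 (Lvv k)).2.
  have Ihh := integrable_mulr ((weight k)^-1 / 2) Ih.
  have Ic := integrable_cst (weight k / 2).
  have qE : q k = (fun z => weight k / 2 + (weight k)^-1 / 2 * hnorm ((v k.+1 - v k) z) ^+ 2).
    by apply/funext => z; rewrite /q -/(GRing.add _ _) mulrDl mulrAC.
  have Iq : P.-integrable setT (EFin \o q k) by rewrite qE; exact: integrable_addr.
  rewrite -(fineK (integrable_fin_num measurableT Iq)) lee_fin -/(Rintegral _ _ _) qE.
  rewrite (RintegralD measurableT Ic Ihh) (RintegralZl _ measurableT Ih).
  rewrite Rintegral_haar_cst -Re_L2inner.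
  have := vk k; have := weight_gt0 k; move: (weight k) (Re _) => a b a0 ab.
  have : a^-1 / 2 * b <= a / 2.
    by rewrite mulrAC ler_pM2r// mulrC ler_pdivrMr// -expr2.
  lra.
have sum_ae := summable_ae mq q0 Iq.
pose Z := [set z | exists M : R, forall n, \sum_(k < n) q k z <= M].
have mZ : measurable Z.
  rewrite (_ : Z = \bigcup_M \bigcap_n [set z | \sum_(k < n) q k z <= M%:R]); last first.
    apply/seteqP; split => z [M].
      move=> hM; exists (Num.truncn M).+1 => // n _ /=.
      by apply: le_trans (hM n) (ltW _); exact: truncnS_gt.
    by move=> _ h; exists M%:R => n; exact: h.
  apply: bigcup_measurable => M _; apply: bigcap_measurable => // n _.
  rewrite -[X in measurable X]setTI; apply: measurable_fun_le => //.
  by apply: measurable_sum => k.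
(* Cutting off outside the measurable set [Z] makes the subsequence converge at every point, so its
   limit is weakly measurable. *)
pose w k z := (\1_Z z)%:C%C *: v k z.
have wv k : aeeq (w k) (v k).
  apply: filterS sum_ae => z Zz; rewrite /w indicE mem_set// scale1r//.
have mw k : wmeasurable (w k).
  apply: wmeasurable_mul; last exact: (Lv k).1.
  by split => /=; [exact: measurable_indic|exact: measurable_cst].
have /choice[l wl] : forall z, exists l, forall e : R, 0 < e -> exists N,
    forall n, (N <= n)%N -> Re (inner (w n z - l) (w n z - l)) <= e.
  move=> z; have [[M hM]|Zz] := pselect (Z z).
    have [l hl] := bounded_sum_cauchy (fun k => vq k z) hM.
    exists l => e e0; have [N' hN'] := hl e e0; exists N' => n Nn.
    rewrite /w indicE mem_set ?scale1r//; first exact: hN'.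
    by exists M.
  exists 0 => e e0; exists 0%N => n _.
  by rewrite /w indicE memNset// scale0r subr0 (si0l SE)//= ltW.
have ml : wmeasurable l by exact: wmeasurable_cvg mw wl.
have key k m : (N k <= m)%N ->
    (\int[P]_z (hnorm (l z - u m z) ^+ 2)%:E <= (weight k ^+ 2)%:E)%E.
  move=> Nm; apply: (@fatou_bound (fun n z => hnorm (w (n + k)%N z - u m z) ^+ 2)).
  - move=> n; have := @wmeasurableP _ _ (-1) _ _ (Lu m).1 (mw (n + k)%N).
    by move/(measurable_hnorm_sqr sepE); under eq_fun do rewrite /= addrC scaleN1r.
  - by move=> n z; rewrite sqr_ge0.
  - move=> z; apply: hnorm_sqr_cvg => e e0; have [N' hN'] := wl z e e0.
    by exists N' => n Nn; apply: hN'; rewrite (leq_trans Nn)// leq_addr.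
  - move=> n; have Ld : L2 E (v (n + k)%N - u m) by exact: (siB SL).
    have : Re (L2inner (v (n + k)%N - u m) (v (n + k)%N - u m)) <= weight k ^+ 2.
      by apply: hN => //; apply: sN; exact: leq_addl.
    have Ih := ((L2E sepE _).1 Ld).2.
    rewrite Re_L2inner /Rintegral -lee_fin fineK; last exact: integrable_fin_num Ih.
    apply: le_trans; rewrite le_eqVlt; apply/orP; left; apply/eqP.
    apply: ge0_ae_eq_integral => //.
    + apply/measurable_EFinP; have := @wmeasurableP _ _ (-1) _ _ (Lu m).1 (mw (n + k)%N).
      by move/(measurable_hnorm_sqr sepE); under eq_fun do rewrite /= addrC scaleN1r.
    + by apply/measurable_EFinP; exact: (measurable_hnorm_sqr sepE Ld.1).
    + by move=> z _; rewrite lee_fin sqr_ge0.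
    + by move=> z _; rewrite lee_fin sqr_ge0.
    + by apply: filterS (wv (n + k)%N) => z /= ->.
have small (e : R) : 0 < e -> exists k, weight k ^+ 2 <= e.
  move=> e0; exists (Num.truncn e^-1).
  set k := Num.truncn _; have wk : weight k <= k.+1%:R^-1.
    by rewrite lef_pV2 ?posrE ?ltr0n ?expn_gt0// ler_nat ltnW// ltn_expl.
  have ke : k.+1%:R^-1 <= e.
    by rewrite -[leRHS]invrK lef_pV2 ?posrE ?invr_gt0 ?ltr0Sn// ltW// truncnS_gt.
  have w1 : weight k <= 1 by rewrite invf_le1 ?ltr0n ?expn_gt0// ler1n expn_gt0.
  have := weight_gt0 k; move: wk ke w1; move: (weight k) (k.+1%:R^-1) => a b *.
  by rewrite expr2; nra.
have Ldif k m : (N k <= m)%N -> L2 E (l - u m).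
  move=> Nm; split; last by apply: le_lt_trans (key k m Nm) _; rewrite ltry.
  have := @wmeasurableP _ _ (-1) _ _ (Lu m).1 ml.
  by move=> h x; have := h x; under eq_fun do rewrite /= addrC scaleN1r.
have Ll : L2 E l.
  rewrite -(subrK (u (N 0%N)) l); apply: (siD SL) => //; exact: (Ldif 0%N).
exists l => // e e0; have [k hk] := small e e0; exists (N k) => n Nn.
rewrite (nsqBC SL)//; apply: le_trans hk.
have Ih := ((L2E sepE _).1 (Ldif k n Nn)).2.
rewrite Re_L2inner /Rintegral -lee_fin fineK; last exact: integrable_fin_num Ih.
exact: key.
Qed.

End L2_complete.

(** * Testing against squared moduli of polynomials *)

Section trigonometric_density.
Variable R : realType.
Local Notation circ := (circle R).
Local Notation P := (haar R).
Local Notation mu := (@lebesgue_measure R).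
Local Notation seg := (`[(- pi)%R, pi%R]%classic : set (measurableTypeR R)).
Local Notation Re := (@complex.Re R).
Local Notation Im := (@complex.Im R).

Lemma integral_haar (f : circ -> \bar R) : P.-integrable setT f ->
  mu.-integrable seg (f \o @cis R) /\
  (\int[P]_z f z = ((pi *+ 2)^-1)%:E * \int[mu]_(t in seg) f (cis t))%E.
Proof.
move=> /integrableP[mf fi].
have ma : measurable_fun setT (fun z => `|f z|%E) by exact: measurableT_comp.
have pi2 : 0 < (pi *+ 2)^-1 :> R by rewrite invr_gt0 pmulrn_rgt0// pi_gt0.
have fin : mu.-integrable seg (f \o @cis R).
  apply/integrableP; split.
    by apply: measurable_funTS; exact: measurable_cisP.
  move: fi; rewrite (ge0_integral_haar ma)//= => fi.
  rewrite ltNge leye_eq; apply/negP => /eqP h; move: fi.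
  by rewrite h mulry gtr0_sg// mul1e.
split => //.
have -> : (\int[mu]_(t in seg) f (cis t) =
    \int[mu]_(t in seg) (f \o @cis R)^\+ t - \int[mu]_(t in seg) (f \o @cis R)^\- t)%E.
  by rewrite -integralE.
rewrite integralE (ge0_integral_haar (measurable_funepos mf) (funepos_ge0 _)).
rewrite (ge0_integral_haar (measurable_funeneg mf) (funeneg_ge0 _)).
have fB : (\int[mu]_(t in seg) (f \o @cis R)^\- t)%E \is a fin_num.
  by apply: integrable_fin_num => //; exact: integrable_funeneg.
rewrite (@muleBr _ _ _ (\int[mu]_(t in seg) (f \o @cis R)^\- t)%E)//; last first.
  by apply: fin_num_adde_defl; rewrite fin_numN.
by rewrite (funepos_comp f (@cis R)) (funeneg_comp f (@cis R)).
Qed.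

Lemma ber_lower (y : R) N : 0 <= y <= 1 -> 1 - N%:R * y <= (1 - y) ^+ N.
Proof.
move=> /andP[y0 y1]; elim: N => [|N IH]; first by rewrite mul0r subr0 expr0.
rewrite exprS; apply: (@le_trans _ _ ((1 - y) * (1 - N%:R * y))).
  rewrite -natr1; have : 0 <= N%:R :> R by []. move: (N%:R : R) => c c0; nra.
by rewrite ler_wpM2l// subr_ge0.
Qed.

(** The quantity (1 - y)^N (1 + N y) does not increase with N. *)
Lemma ber_upper (y : R) N : 0 <= y <= 1 -> (1 - y) ^+ N * (N%:R * y) <= 1.
Proof.
move=> /andP[y0 y1]; suff : (1 - y) ^+ N * (1 + N%:R * y) <= 1.
  apply: le_trans; rewrite ler_wpM2l ?exprn_ge0 ?subr_ge0//.
  by rewrite lerDr.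
elim: N => [|N IH]; first by rewrite mul0r addr0 expr0 mulr1.
apply: le_trans IH; rewrite exprSr -mulrA ler_wpM2l ?exprn_ge0 ?subr_ge0//.
rewrite -natr1; have : 0 <= N%:R :> R by []. move: (N%:R : R) => c c0.
have := mulr_ge0 c0 (sqr_ge0 y); have := sqr_ge0 y; lra.
Qed.

(** The polynomials of the elementary proof of the Stone-Weierstrass theorem: [cutoff s n] tends to
    0 below s and to 1 above s. As the exponent is just above s^-n, its product with x^n tends to 0
    or to infinity according to the side of s on which x lies. *)
Definition cutoff_exp (s : R) n := (Num.truncn (s^-1 ^+ n)).+1.
Definition cutoff (s : R) n (x : R) := 1 - (1 - x ^+ n) ^+ cutoff_exp s n.

Lemma cutoff_ge0 (s : R) n (x : R) : 0 <= x <= 1 -> 0 <= cutoff s n x <= 1.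
Proof.
move=> /andP[x0 x1]; have y0 : 0 <= 1 - x ^+ n by rewrite subr_ge0 exprn_ile1.
rewrite /cutoff subr_ge0 exprn_ile1//=; last by rewrite gerBl exprn_ge0.
by rewrite gerBl exprn_ge0.
Qed.

Lemma cutoff_cvg0 (s x : R) : 0 < s <= 1 -> 0 <= x < s -> cutoff s n x @[n --> \oo] --> (0 : R).
Proof.
move=> /andP[s0 s1] /andP[x0 xs].
have x1 : x < 1 by exact: lt_le_trans xs s1.
apply: (@squeeze_cvgr _ _ _ _ (fun=> 0) (fun n => (x / s) ^+ n + x ^+ n)).
- apply: nearW => n; have /andP[-> _] /= := cutoff_ge0 s n (ltac:(by rewrite x0 ltW) : 0 <= x <= 1).
  have y01 : 0 <= x ^+ n <= 1 by rewrite exprn_ge0//= exprn_ile1// ltW.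
  rewrite /cutoff lerBlDl -lerBlDr.
  apply: le_trans (ber_lower (cutoff_exp s n) y01).
  rewrite lerD2l lerNr opprK -natr1 mulrDl mul1r lerD2r expr_div_n mulrC.
  rewrite ler_wpM2l ?exprn_ge0// -exprVn.
  by have /andP[] := truncn_itv (ltac:(by rewrite exprn_ge0// invr_ge0 ltW) : 0 <= s^-1 ^+ n).
- exact: cvg_cst.
- rewrite -[X in _ --> X]addr0; apply: cvgD; apply: cvg_expr.
    by rewrite ger0_norm ?divr_ge0 ?(ltW s0)// ltr_pdivrMr// mul1r.
  by rewrite ger0_norm.
Qed.

Lemma cutoff_cvg1 (s x : R) : 0 < s <= 1 -> s < x <= 1 -> cutoff s n x @[n --> \oo] --> (1 : R).
Proof.
move=> /andP[s0 s1] /andP[sx x1]; have x0 : 0 < x by exact: lt_trans sx.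
rewrite -[X in _ --> X]subr0; apply: cvgB; first exact: cvg_cst.
apply: (@squeeze_cvgr _ _ _ _ (fun=> 0) (fun n => (s / x) ^+ n)).
- apply: nearW => n.
  have y01 : 0 <= x ^+ n <= 1 by rewrite exprn_ge0 ?(ltW x0)//= exprn_ile1// ltW.
  have y1 : 0 <= 1 - x ^+ n by rewrite subr_ge0; case/andP: y01.
  rewrite exprn_ge0//=.
  have := ber_upper (cutoff_exp s n) y01.
  have h : s^-1 ^+ n <= (cutoff_exp s n)%:R.
    by apply: ltW; exact: truncnS_gt.
  rewrite expr_div_n ler_pdivlMr ?exprn_gt0//.
  have e0 := exprn_ge0 (cutoff_exp s n) y1.
  move: h e0; rewrite exprVn; move: (_ ^+ cutoff_exp s n) (cutoff_exp s n)%:R => a c h a0 le1.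
  have sn0 : 0 < s ^+ n by rewrite exprn_gt0.
  have xn0 : 0 < x ^+ n by rewrite exprn_gt0.
  rewrite -[leRHS]mulr1 -ler_pdivrMl//; apply: le_trans le1.
  by rewrite mulrC -mulrA ler_wpM2l// mulrC ler_wpM2r// ltW.
- exact: cvg_cst.
- apply: cvg_expr; rewrite ger0_norm ?divr_ge0 ?(ltW s0) ?(ltW x0)//.
  by rewrite ltr_pdivrMr// mul1r.
Qed.

(** Equal to |e^(it) + e^(i t0)|^2 / 4; it decreases with the distance from t0 along the circle. *)
Definition arc_bump (t0 t : R) := (1 + cos (t - t0)) / 2.

Lemma arc_bump01 t0 t : 0 <= arc_bump t0 t <= 1.
Proof.
rewrite /arc_bump; have := cos_geN1 (t - t0); have := cos_le1 (t - t0) => *.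
by apply/andP; split; lra.
Qed.

Definition normsq (a : R[i]) := Re a ^+ 2 + Im a ^+ 2.

Lemma normsqM a b : normsq (a * b) = normsq a * normsq b.
Proof. by rewrite /normsq !ReImE; ring. Qed.

Lemma normsqX a n : normsq (a ^+ n) = normsq a ^+ n.
Proof.
elim: n => [|n IH]; first by rewrite !expr0 /normsq /= expr1n expr0n addr0.
by rewrite !exprS normsqM IH.
Qed.

Lemma normsq_real (a : R) : normsq a%:C%C = a ^+ 2.
Proof. by rewrite /normsq /= expr0n addr0. Qed.

Lemma normsq_circle (z : circ) : normsq (sval z) = 1.
Proof. exact: circle_normE. Qed.

(* On the circle [z * arc_bump] is a polynomial in [z], so [cutoff] of [arc_bump] is
   the modulus of a polynomial. *)
Lemma cutoff_poly t0 s n : exists p : {poly R[i]},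
  forall t, normsq (p.[sval (cis t : circ)]) = cutoff s n (arc_bump t0 t) ^+ 2.
Proof.
pose w0 := sval (cis t0 : circ); pose N := cutoff_exp s n.
pose q : {poly R[i]} := ('X + w0%:P) ^+ 2 * (w0^* * (4^-1)%:C%C)%:P.
(* A homogenised [cutoff]: at z the power z^(n N) factors out, and it has modulus one. *)
exists ('X ^+ n ^+ N - ('X ^+ n - q ^+ n) ^+ N) => t.
set z := sval _.
have qz : q.[z] = z * (arc_bump t0 t)%:C%C.
  rewrite /q !hornerE /=; set k := (4^-1)%:C%C.
  have zz : z * z^* = 1.
    by apply: complex_extR; rewrite !ReImE /=; have := cos2Dsin2 t; rewrite !expr2; lra.
  have ww : w0 * w0^* = 1.
    by apply: complex_extR; rewrite !ReImE /=; have := cos2Dsin2 t0; rewrite !expr2; lra.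
  have -> : (arc_bump t0 t)%:C%C = (2%:C%C + z * w0^* + z^* * w0) * k.
    by apply: complex_extR; rewrite !ReImE /= /arc_bump ?cosB; field.
  have -> : (z + w0) ^+ 2 * w0^* * k =
      (z ^+ 2 * w0^* + 2 * z * (w0 * w0^*) + w0 * (w0 * w0^*)) * k by ring.
  have -> : z * ((2%:C%C + z * w0^* + z^* * w0) * k) =
      (z ^+ 2 * w0^* + 2%:C%C * z * 1 + w0 * (z * z^*)) * k by ring.
  by rewrite zz ww (rmorph_nat (real_complex R) 2).
have -> : ('X ^+ n ^+ N - ('X ^+ n - q ^+ n) ^+ N).[z] =
    (z ^+ n) ^+ N * (cutoff s n (arc_bump t0 t))%:C%C.
  rewrite hornerD hornerN !horner_exp hornerD hornerN !horner_exp hornerX qz.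
  rewrite /cutoff rmorphB/= rmorphXn/= rmorphB/= rmorphXn/= mulrBr mulr1 -exprMn.
  by rewrite [in LHS]exprMn [in RHS]mulrBr mulr1.
by rewrite normsqM normsq_real !normsqX normsq_circle !expr1n mul1r.
Qed.

Lemma normsqD_le (a b : R[i]) : normsq (a + b) <= 2 * normsq a + 2 * normsq b.
Proof.
rewrite /normsq !ReImE; have := sqr_ge0 (Re a - Re b).
have := sqr_ge0 (Im a - Im b); lra.
Qed.

Lemma normsq_ge0 (a : R[i]) : 0 <= normsq a.
Proof. by rewrite addr_ge0 ?sqr_ge0. Qed.

Lemma cmeasurable_horner (p : {poly R[i]}) :
  cmeasurable (fun z : circ => p.[sval z]).
Proof.
elim/poly_ind: p => [|p c IH].
  by under eq_fun do rewrite horner0; exact: cmeasurable_cst.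
under eq_fun do rewrite hornerMXaddC.
apply: cmeasurableD; last exact: cmeasurable_cst.
by apply: cmeasurableM => //; exact: cmeasurable_sval.
Qed.

Lemma normsq_horner_bounded (p : {poly R[i]}) : exists M,
  forall z : circ, normsq p.[sval z] <= M.
Proof.
elim/poly_ind: p => [|p c [M IH]].
  by exists 0 => z; rewrite horner0 /normsq /= expr0n addr0.
exists (2 * M + 2 * normsq c) => z; rewrite hornerMXaddC.
apply: le_trans (normsqD_le _ _) _; rewrite normsqM normsq_circle mulr1 lerD2r.
by rewrite ler_pM2l.
Qed.

Lemma measurable_normsq f : cmeasurable f ->
  measurable_fun setT (fun z : circ => normsq (f z)).
Proof.
by move=> [f1 f2]; apply: measurable_funD; exact: measurable_funX.
Qed.

Lemma integrable_bounded_mul (u w : circ -> R) (M : R) :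
  measurable_fun setT u -> (forall z, `|u z| <= M) ->
  P.-integrable setT (EFin \o w) ->
  P.-integrable setT (EFin \o (fun z => u z * w z)).
Proof.
move=> mu' uM wi; have /measurable_EFinP mw := measurable_int _ wi.
have M0 : 0 <= M by apply: le_trans (uM (cis 0)).
apply: le_integrable (integrable_mulr M wi) => //.
  by apply/measurable_EFinP; exact: measurable_funM.
move=> z _ /=; rewrite lee_fin !normrM (ger0_norm M0) ler_wpM2r//.
Qed.

Lemma integrable_horner_mul (p : {poly R[i]}) (w : circ -> R) :
  P.-integrable setT (EFin \o w) ->
  P.-integrable setT (EFin \o (fun z => normsq p.[sval z] * w z)).
Proof.
have [M hM] := normsq_horner_bounded p.
apply: (@integrable_bounded_mul _ _ M).
  by apply: measurable_normsq; exact: cmeasurable_horner.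
by move=> z; rewrite ger0_norm ?normsq_ge0.
Qed.

Lemma cos_lt1 (r : R) : 0 < r <= pi -> cos r < 1.
Proof.
move=> /andP[r0 rpi].
by rewrite -cos0 ltr_cos// in_itv/= ?lexx ?pi_ge0 ?rpi ?(ltW r0).
Qed.

Lemma cos_gtN1 (r : R) : 0 <= r < pi -> -1 < cos r.
Proof.
move=> /andP[r0 rpi].
by rewrite -cospi ltr_cos// in_itv/= ?lexx ?pi_ge0 ?r0 ?(ltW rpi).
Qed.

Lemma cos_norm (x : R) : cos `|x| = cos x.
Proof. by case: (ler0P x) => _ //; rewrite cosN. Qed.

(** Cosine decreases with the distance to the multiples of 2 pi; the hypothesis on x keeps it
    farther than r from 2 pi and -2 pi. *)
Lemma cos_lt_radius (r x : R) : 0 < r < pi -> `|x| < 2 * pi - r ->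
  (`|x| < r -> cos r < cos x) /\ (r < `|x| -> cos x < cos r).
Proof.
move=> /andP[r0 rpi] xr; rewrite -(cos_norm x); have x0 := normr_ge0 x.
have rI : r \in `[0, pi] by rewrite in_itv/= (ltW r0) (ltW rpi).
split=> h.
  by rewrite ltr_cos// in_itv/= x0 ltW// (lt_trans h).
have [xpi|xpi] := leP `|x| pi.
  by rewrite ltr_cos// in_itv/= x0.
have -> : cos `|x| = cos (2 * pi - `|x|).
  by rewrite -[RHS]cosN -[RHS]cosD2pi; congr cos; ring.
have xI : 2 * pi - `|x| \in `[0, pi] by rewrite in_itv/=; apply/andP; split; lra.
by rewrite ltr_cos//; lra.
Qed.

Section interval.
Variable w : circ -> R.
Hypothesis wi : P.-integrable setT (EFin \o w).
Hypothesis w_le0 : forall p : {poly R[i]},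
  \int[P]_z (normsq p.[sval z] * w z) <= 0.
Let f := (w \o @cis R) \_ seg.

(** The squares of [cutoff s n (arc_bump t0 t)] tend to the indicator of the ball, each is the
    squared modulus of a polynomial, and all are at most 1; dominated convergence carries the sign
    hypothesis over to the arc. Staying strictly inside the segment avoids wrapping around at pi. *)
Lemma interval_integral_le0 (t0 r : R) : 0 < r -> - pi < t0 - r -> t0 + r < pi ->
  (\int[mu]_(t in ball t0 r) (f t)%:E <= 0)%E.
Proof.
move=> r0 tr1 tr2; have rpi : 0 < r < pi by rewrite r0; lra.
(* The value of [arc_bump t0] at the ends t0 - r and t0 + r of the arc. *)
pose s := (1 + cos r) / 2.
have s01 : 0 < s <= 1.
  have := cos_lt1 (ltac:(lra) : 0 < r <= pi); have := cos_gtN1 (ltac:(lra) : 0 <= r < pi).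
  by rewrite /s => *; apply/andP; split; lra.
pose g n t := (cutoff s n (arc_bump t0 t) ^+ 2 * w (cis t))%:E.
pose h t := (\1_(ball t0 r) t * w (cis t))%:E.
have mw : measurable_fun setT w by have /measurable_EFinP := measurable_int _ wi.
have mwc : measurable_fun setT (w \o @cis R) by exact: measurable_cisP.
have mg n : measurable_fun seg (g n).
  have [p hp] := cutoff_poly t0 s n.
  apply: measurable_funTS; apply/measurable_EFinP; apply: measurable_funM => //.
  under eq_fun do rewrite -hp.
  apply: (@measurable_cisP _ _ _ (fun z => normsq p.[sval z])).
  by apply: measurable_normsq; exact: cmeasurable_horner.
have mh : measurable_fun seg h.
  apply: measurable_funTS; apply/measurable_EFinP; apply: measurable_funM => //.
  by apply: measurable_indic; exact: measurable_ball.
have [wci _] := integral_haar wi.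
(* The two ends are left out: there [arc_bump] equals s and the limit of the cutoffs is not
   controlled. *)
have cv : \forall t \ae mu, seg t -> g n t @[n --> \oo] --> h t.
  have na a : \forall t \ae mu, t <> a.
    exists [set a]; split; [exact: measurable_set1|exact: lebesgue_measure_set1|].
    by move=> t /= /contrapT.
  apply: filterS2 (na (t0 - r)) (na (t0 + r)) => t ta tb.
  rewrite /= in_itv/= => /andP[pt tp].
  apply: cvg_EFin; first exact: nearW.
  apply: cvgMl; rewrite indicE.
  have tr : `|t - t0| < 2 * pi - r by rewrite ltr_norml; apply/andP; split; lra.
  have [c1 c2] := cos_lt_radius rpi tr.
  rewrite (_ : (t \in _) = (`|t - t0| < r)); last first.
    by apply/idP/idP; rewrite inE /ball/= distrC.
  case: ltgtP => tt.
  + rewrite [X in _ --> X](_ : _ = 1 * 1); last by rewrite mulr1.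
    have cc : s < arc_bump t0 t <= 1.
      have /andP[_ ->] := arc_bump01 t0 t; rewrite andbT.
      by rewrite /s /arc_bump; have := c1 tt; lra.
    by under eq_fun do rewrite expr2; apply: cvgM; exact: cutoff_cvg1.
  + rewrite [X in _ --> X](_ : _ = 0 * 0); last by rewrite mulr0.
    have cc : 0 <= arc_bump t0 t < s.
      have /andP[-> _] /= := arc_bump01 t0 t.
      by rewrite /s /arc_bump; have := c2 tt; lra.
    by under eq_fun do rewrite expr2; apply: cvgM; exact: cutoff_cvg0.
  + exfalso; move: tt; have [d0|d0] := leP 0 (t - t0).
      by rewrite ger0_norm// => tt; apply: tb; lra.
    by rewrite ltr0_norm// => tt; apply: ta; lra.
have [_ _] := dominated_convergence (ltac:(exact: measurable_itv) : measurable seg) mg mh cv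
  (integrable_abse wci) (ltac:(apply: nearW => t n _; rewrite /g /= lee_fin normrM ler_piMl//;
    have /andP[c0 c1] := cutoff_ge0 s n (arc_bump01 t0 t); rewrite ger0_norm ?sqr_ge0// expr_le1//)).
move=> cvi.
have -> : (\int[mu]_(t in ball t0 r) (f t)%:E = \int[mu]_(t in seg) h t)%E.
  rewrite integral_mkcond [RHS]integral_mkcond; apply: eq_integral => t _.
  rewrite /f /h !patchE indicE; case: ifPn => tb; case: ifPn => ts //.
  - by rewrite mul1r.
  - by rewrite mul0r.
apply: (cvge_to_le cvi); apply: nearW => n /=.
have [p hp] := cutoff_poly t0 s n.
have [_ hi] := integral_haar (integrable_horner_mul p wi).
have : (\int[P]_z (normsq p.[sval z] * w z)%:E <= 0)%E.
  rewrite -(fineK (integrable_fin_num measurableT (integrable_horner_mul p wi))).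
  by rewrite lee_fin; exact: w_le0.
rewrite hi /=; under eq_integral do rewrite hp.
by rewrite pmule_rle0// lte_fin invr_gt0 pmulrn_rgt0// pi_gt0.
Qed.

End interval.
End trigonometric_density.

(** * Uniqueness of Fourier coefficients *)

Section fourier_uniqueness.
Variable R : realType.
Local Notation circ := (circle R).
Local Notation P := (haar R).
Local Notation mu := (@lebesgue_measure R).
Local Notation seg := (`[(- pi)%R, pi%R]%classic : set (measurableTypeR R)).
Local Notation Re := (@complex.Re R).
Local Notation Im := (@complex.Im R).

(** Passes from Lebesgue measure on the segment to [haar]: the positive part of w has integral zero
    over the segment, hence for [haar], so it vanishes almost everywhere on the circle. *)
Lemma ae_circle (Q : circ -> Prop) (w : circ -> R) : measurable_fun setT w ->
  (forall z, w z <= 0 -> Q z) ->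
  {ae mu, forall t, seg t -> w (cis t) <= 0} -> {ae P, forall z, Q z}.
Proof.
move=> mw wQ aew; pose wp z := Num.max (w z) 0.
have mwp : measurable_fun setT wp by exact: measurable_maxr.
have wp0 z : 0 <= wp z by rewrite le_max lexx orbT.
have mE : measurable_fun setT (EFin \o wp) by exact/measurable_EFinP.
have : (\int[P]_z `|(wp z)%:E| = 0)%E.
  under eq_integral do rewrite gee0_abs ?lee_fin//.
  rewrite (ge0_integral_haar mE) //=.
  rewrite (@ae_eq_integral _ _ _ mu seg (cst 0%E)) ?integral0 ?mule0//.
    by apply: measurable_funTS; exact: (measurable_cisP mE).
  by apply: filterS aew => t h st /=; rewrite /wp max_r// h.
move/ae_eq_integral_abs => /(_ measurableT) h; have := h mE.
by apply: filterS => z /(_ I) [] /= z0; apply: wQ; rewrite -z0 le_max lexx.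
Qed.

(* A Lebesgue-differentiation argument over small arcs. *)
Theorem ae_le0_of_horner (w : circ -> R) : P.-integrable setT (EFin \o w) ->
  (forall p : {poly R[i]}, \int[P]_z (normsq p.[sval z] * w z) <= 0) ->
  {ae P, forall z, w z <= 0}.
Proof.
move=> wi w_le0; have mw : measurable_fun setT w.
  by have /measurable_EFinP := measurable_int _ wi.
have [wci _] := integral_haar wi.
pose f := (w \o @cis R) \_ seg.
have fi : mu.-integrable setT (EFin \o f).
  rewrite (_ : EFin \o f = (EFin \o (w \o @cis R)) \_ seg); last first.
    by rewrite /f restrict_EFin.
  by apply/integrable_restrict => //; rewrite setTI.
have lf : locally_integrable setT f by apply: open_integrable_locally => //; exact: openT.
pose E (x : R) n : set R := ball x n.+1%:R^-1.
have hE x : nicely_shrinking x (E x).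
  split; first by move=> n; exact: measurable_ball.
  exists (1, fun n => PosNum (ltac:(by rewrite invr_gt0 ltr0Sn) : 0 < n.+1%:R^-1)); split => //=.
  - exact: cvg_harmonic.
  - by move=> n y.
  - by move=> n; rewrite mul1e.
apply: (ae_circle mw) => [//|].
(* The ends of the segment are discarded so that small balls around x stay inside it. *)
have na a : \forall t \ae mu, t <> a.
  exists [set a]; split; [exact: measurable_set1|exact: lebesgue_measure_set1|].
  by move=> t /= /contrapT.
have ld : \forall t \ae mu, lebesgue_pt f t := lebesgue_differentiation lf.
have FF : Filter (almost_everywhere mu) by exact: ae_filter_ringOfSetsType.
apply: (@filterS3 _ (almost_everywhere mu) FF _ _ _ _ _ ld (na (- pi)) (na pi)) => x lx x1 x2.
rewrite /= in_itv/= => /andP[p1 p2].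
have px : - pi < x by rewrite lt_neqAle p1 andbT; apply/eqP => /esym.
have xp : x < pi by rewrite lt_neqAle p2 andbT; apply/eqP.
have -> : w (cis x) = f x by rewrite /f patchE mem_set//= in_itv/= p1.
have cx := nice_lebesgue_differentiation hE lf lx.
rewrite -lee_fin; apply: (cvge_to_le cx).
pose d := Num.min (pi - x) (x + pi).
have d0 : 0 < d by rewrite lt_min !subr_gt0 xp/=; lra.
exists (Num.truncn d^-1) => // n /= Nn.
have rd : n.+1%:R^-1 < d.
  rewrite -[ltRHS]invrK ltf_pV2 ?posrE ?invr_gt0 ?ltr0Sn//.
  by apply: lt_le_trans (truncnS_gt _) _; rewrite ler_nat ltnS.
move: rd; rewrite lt_min => /andP[rd1 rd2].
have r0 : 0 < n.+1%:R^-1 :> R by rewrite invr_gt0 ltr0Sn.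
have := interval_integral_le0 wi w_le0 (t0 := x) r0
  (ltac:(by rewrite ltrBrDl -ltrBrDr opprK)) (ltac:(by rewrite -ltrBrDl)).
by apply: mule_ge0_le0; rewrite inve_ge0.
Qed.

Definition fourier_null (g : circ -> R[i]) := [/\ cintegrable g,
  forall n, cintegral (fun z => sval z ^+ n * g z) = 0 &
  forall n, cintegral (fun z => (sval z)^* ^+ n * g z) = 0].

Lemma circle_mulJ (z : circ) : sval z * (sval z)^* = 1.
Proof.
apply: complex_extR; rewrite !ReImE /=; last by ring.
by rewrite mulrN opprK -!expr2 circle_normE.
Qed.

Lemma circle_conjE (z : circ) : sval (circle_conj z) = (sval z)^*.
Proof. by []. Qed.

Lemma normr_normsq_le (a : R[i]) (M : R) : 0 <= M -> normsq a <= M ^+ 2 ->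
  `|Re a| <= M /\ `|Im a| <= M.
Proof.
rewrite /normsq => M0 h; split; rewrite -(ler_pXn2r (n := 2)) ?nnegrE ?normr_ge0//;
  rewrite real_normK ?num_real//; apply: le_trans h.
  by rewrite lerDl sqr_ge0.
by rewrite lerDr sqr_ge0.
Qed.

Lemma cintegrable_mul (u g : circ -> R[i]) (M : R) : cmeasurable u -> 0 <= M ->
  (forall z, normsq (u z) <= M ^+ 2) -> cintegrable g ->
  cintegrable (fun z => u z * g z).
Proof.
move=> [u1 u2] M0 uM [g1 g2].
have b1 z := (normr_normsq_le M0 (uM z)).1.
have b2 z := (normr_normsq_le M0 (uM z)).2.
have i11 := integrable_bounded_mul u1 b1 g1.
have i12 := integrable_bounded_mul u1 b1 g2.
have i21 := integrable_bounded_mul u2 b2 g1.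
have i22 := integrable_bounded_mul u2 b2 g2.
split.
  apply: eq_integrable (integrable_addr i11 (integrable_mulr (-1) i22)) => //.
  by move=> z _ /=; rewrite Re_mul mulN1r.
apply: eq_integrable (integrable_addr i12 i21) => //.
by move=> z _ /=; rewrite Im_mul.
Qed.

Lemma cintegrable_sval g : cintegrable g -> cintegrable (fun z : circ => sval z * g z).
Proof.
apply: (@cintegrable_mul _ _ 1) => //; first exact: cmeasurable_sval.
by move=> z; rewrite normsq_circle expr1n.
Qed.

Lemma cintegrable_svalJ g : cintegrable g ->
  cintegrable (fun z : circ => (sval z)^* * g z).
Proof.
apply: (@cintegrable_mul _ _ 1) => //.
  by apply: cmeasurable_conj; exact: cmeasurable_sval.
by move=> z; rewrite -circle_conjE normsq_circle expr1n.
Qed.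

Lemma cintegrable_svalX g n : cintegrable g ->
  cintegrable (fun z : circ => sval z ^+ n * g z).
Proof.
move=> ig; elim: n => [|n IH]; first by under eq_fun do rewrite expr0 mul1r.
by under eq_fun do rewrite exprS -mulrA; exact: cintegrable_sval.
Qed.

Lemma cintegrable_svalJX g n : cintegrable g ->
  cintegrable (fun z : circ => (sval z)^* ^+ n * g z).
Proof.
move=> ig; elim: n => [|n IH]; first by under eq_fun do rewrite expr0 mul1r.
by under eq_fun do rewrite exprS -mulrA; exact: cintegrable_svalJ.
Qed.

Lemma fourier_nullD f g : fourier_null f -> fourier_null g ->
  fourier_null (fun z => f z + g z).
Proof.
move=> [fi f1 f2] [gi g1 g2]; split; first exact: cintegrableD.
  move=> n; under eq_fun do rewrite mulrDr.
  by rewrite cintegralD ?f1 ?g1 ?addr0//; exact: cintegrable_svalX.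
move=> n; under eq_fun do rewrite mulrDr.
by rewrite cintegralD ?f2 ?g2 ?addr0//; exact: cintegrable_svalJX.
Qed.

Lemma fourier_nullZ a g : fourier_null g -> fourier_null (fun z => a * g z).
Proof.
move=> [gi g1 g2]; split; first exact: cintegrableZ.
  move=> n; under eq_fun do rewrite mulrCA.
  by rewrite cintegralZ ?g1 ?mulr0//; exact: cintegrable_svalX.
move=> n; under eq_fun do rewrite mulrCA.
by rewrite cintegralZ ?g2 ?mulr0//; exact: cintegrable_svalJX.
Qed.

Lemma fourier_null_sval g : fourier_null g -> fourier_null (fun z => sval z * g z).
Proof.
move=> [gi g1 g2]; split; first exact: cintegrable_sval.
  by move=> n; rewrite -[RHS](g1 n.+1); congr cintegral; apply/funext => z;
    rewrite exprSr mulrA.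
case=> [|n].
  by rewrite -[RHS](g1 1%N); congr cintegral; apply/funext => z; rewrite expr0 mul1r.
rewrite -[RHS](g2 n); congr cintegral; apply/funext => z.
by rewrite exprSr -mulrA (mulrA _ (sval z)) (mulrC _ (sval z)) circle_mulJ mul1r.
Qed.

Lemma fourier_null_svalJ g : fourier_null g ->
  fourier_null (fun z => (sval z)^* * g z).
Proof.
move=> [gi g1 g2]; split; first exact: cintegrable_svalJ.
  case=> [|n].
    by rewrite -[RHS](g2 1%N); congr cintegral; apply/funext => z; rewrite expr0 mul1r.
  rewrite -[RHS](g1 n); congr cintegral; apply/funext => z.
  by rewrite exprSr -mulrA (mulrA (sval z)) circle_mulJ mul1r.
by move=> n; rewrite -[RHS](g2 n.+1); congr cintegral; apply/funext => z;
  rewrite exprSr mulrA.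
Qed.

Lemma fourier_null_horner (p : {poly R[i]}) g : fourier_null g ->
  fourier_null (fun z => p.[sval z] * g z).
Proof.
elim/poly_ind: p g => [|p c IH] g ng.
  by under eq_fun do rewrite horner0; exact: fourier_nullZ.
under eq_fun do rewrite hornerMXaddC mulrDl -mulrA.
by apply: fourier_nullD; [apply: IH; exact: fourier_null_sval|exact: fourier_nullZ].
Qed.

Lemma fourier_null_hornerJ (p : {poly R[i]}) g : fourier_null g ->
  fourier_null (fun z => (p.[sval z])^* * g z).
Proof.
elim/poly_ind: p g => [|p c IH] g ng.
  by under eq_fun do rewrite horner0 rmorph0; exact: fourier_nullZ.
under eq_fun do rewrite hornerMXaddC rmorphD rmorphM/= mulrDl -mulrA.
by apply: fourier_nullD; [apply: IH; exact: fourier_null_svalJ|exact: fourier_nullZ].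
Qed.

(** The class is stable under multiplication by polynomials and their conjugates, so the integral of
    |p|^2 g is a zeroth coefficient and vanishes: the sign test for Re g is met with equality. *)
Lemma fourier_null_Re_le0 g : fourier_null g -> {ae P, forall z, Re (g z) <= 0}.
Proof.
move=> ng; have [[g1 g2] _ _] := ng; apply: ae_le0_of_horner => // p.
have [_ h _] := fourier_null_hornerJ p (fourier_null_horner p ng).
have := congr1 Re (h 0%N); rewrite /= => hz.
rewrite le_eqVlt; apply/orP; left; apply/eqP; rewrite -[RHS]hz.
apply: eq_Rintegral => z _; rewrite expr0 mul1r mulrA.
rewrite /normsq !ReImE; ring.
Qed.

(** The sign test is applied to g, -g, i g and -i g. *)
Theorem fourier_null_ae0 g : fourier_null g -> aeeq g (fun=> 0).
Proof.
move=> ng.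
have h1 := fourier_null_Re_le0 ng.
have h2 := fourier_null_Re_le0 (fourier_nullZ (-1) ng).
have h3 := fourier_null_Re_le0 (fourier_nullZ (0 +i* 1)%C ng).
have h4 := fourier_null_Re_le0 (fourier_nullZ (0 -i* 1)%C ng).
apply: filterS2 (filterI h1 h2) (filterI h3 h4) => z [] /= + + [].
rewrite mulN1r !ReImE /= => *; apply: complex_extR => /=; lra.
Qed.

End fourier_uniqueness.

Arguments L2inner : simpl never.

(** * Hardy space *)

Section orthogonal_subspace.
Variables (R : realType) (V : lmodType R[i]) (S K : set V) (B : V -> V -> R[i]).
Hypothesis SB : semi_inner S B.
Hypothesis KS : K `<=` S.
Local Notation Re := (@complex.Re R).

Lemma semi_inner_orth : semi_inner [set f | S f /\ forall k, K k -> B f k = 0] B.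
Proof.
split => /=.
- split; first exact: (si0 SB).
  by move=> k Kk; rewrite (si0l SB)//; exact: KS.
- move=> a x y [Sx hx] [Sy hy]; split; first exact: (siP SB).
  by move=> k Kk; rewrite (si_linear SB) ?hx ?hy ?mulr0 ?addr0//; exact: KS.
- by move=> a x y z [Sx _] [Sy _] [Sz _]; exact: (si_linear SB).
- by move=> x y [Sx _] [Sy _]; exact: (siC SB).
- by move=> x [Sx _]; exact: (si_ge0 SB).
Qed.

Lemma si_cvg_orth (u : nat -> V) l k : (forall n, S (u n)) -> S l -> S k ->
  (forall e : R, 0 < e -> exists N, forall n, (N <= n)%N ->
    Re (B (u n - l) (u n - l)) <= e) ->
  (forall n, B (u n) k = 0) -> B l k = 0.
Proof.
move=> Su Sl Sk ul uk.
have key y : S y -> (forall n, Re (B (u n) y) = 0) -> Re (B l y) = 0.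
  move=> Sy uy; apply: sqr_le_eps0 => e e0.
  have p := si_ge0 SB Sy; have q0 : 0 < Re (B y y) + 1 by lra.
  have [N /(_ N (leqnn _)) hN] := ul (e / (Re (B y y) + 1)) (divr_gt0 e0 q0).
  rewrite ler_pdivlMr// in hN.
  have Sd := siB SB (Su N) Sl.
  have := si_CS SB Sd Sy; rewrite (siBl SB)// ReD ReN uy add0r sqrrN.
  move/le_trans; apply; apply: le_trans hN; rewrite ler_wpM2l ?(si_ge0 SB)//.
  by rewrite lerDl.
apply: complex_extR; first by apply: key => // n; rewrite uk.
have Sik := siZ SB (0 +i* 1)%C Sk.
have := key _ Sik (fun n => _); rewrite (siZr SB)// !ReImE /= => h.
have := h (ltac:(by move=> n; rewrite (siZr SB)// uk mulr0)); lra.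
Qed.

Lemma si_complete_orth : si_complete S B ->
  si_complete [set f | S f /\ forall k, K k -> B f k = 0] B.
Proof.
move=> cB u hu cu; have Su n := (hu n).1.
have [l Sl hl] := cB _ Su cu; exists l => //; split => // k Kk.
apply: (@si_cvg_orth u) => //; first exact: KS.
by move=> n; exact: (hu n).2.
Qed.

End orthogonal_subspace.

(** * Moments of the coordinate function *)

Section moments.
Variable R : realType.
Local Notation circ := (circle R).
Local Notation mu := (@lebesgue_measure R).
Local Notation seg := (`[(- pi)%R, pi%R]%classic : set (measurableTypeR R)).
Local Notation Re := (@complex.Re R).
Local Notation Im := (@complex.Im R).

Lemma cis_exp (t : R) n :
  sval (cis t : circ) ^+ n = (cos (n%:R * t) +i* sin (n%:R * t))%C.
Proof.
elim: n => [|n IH]; first by rewrite expr0 mul0r cos0 sin0.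
rewrite exprS IH -natr1 mulrDl mul1r cosD sinD.
by apply: complex_extR; rewrite ?Re_mul ?Im_mul /=; ring.
Qed.

Lemma sin_natpi n : sin (n%:R * pi) = 0 :> R.
Proof.
elim: n => [|n IH]; first by rewrite mul0r sin0.
by rewrite -natr1 mulrDl mul1r sinDpi IH oppr0.
Qed.

Lemma integral_cos n : (0 < n)%N ->
  (\int[mu]_(t in seg) (cos (n%:R * t))%:E = 0)%E.
Proof.
move=> n0; have nR : n%:R != 0 :> R by rewrite pnatr_eq0 -lt0n.
pose F : R -> R := n%:R^-1 \*: (@sin R \o (n%:R \*: id)).
have dF (t : R) : is_derive t (1 : R) F (cos (n%:R * t)).
  by apply: is_derive_eq; rewrite /= /GRing.scale /= mulr1 mulrCA mulVf// mulr1.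
have cF : continuous F.
  by move=> t; apply: differentiable_continuous; apply/derivable1_diffP; have [] := dF t.
rewrite (@continuous_FTC2 _ _ F).
- by rewrite /F /= /GRing.scale /= mulrN sinN sin_natpi oppr0 mulr0 subee.
- exact: ltNpipi.
- apply: continuous_subspaceT => t; apply: (@continuous_comp _ _ _ (fun t : R => n%:R * t) cos).
    exact: mulrl_continuous.
  exact: continuous_cos.
- split.
  + by move=> t _; have [] := dF t.
  + by apply: cvg_at_right_filter; exact: cF.
  + by apply: cvg_at_left_filter; exact: cF.
- by move=> t _; rewrite derive1E; have [_ ->] := dF t.
Qed.

Lemma cintegrable_cst (a : R[i]) : cintegrable (fun _ : circ => a).
Proof. by split; exact: integrable_cst. Qed.

Lemma cintegrable_exp n : cintegrable (fun z : circ => sval z ^+ n).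
Proof.
have := cintegrable_svalX n (cintegrable_cst 1).
by under eq_fun do rewrite mulr1.
Qed.

Lemma cintegral_exp n : cintegral (fun z : circ => sval z ^+ n) = (n == 0)%:R.
Proof.
have [->|n0] := eqVneq n 0%N.
  rewrite (_ : (fun z : circ => _) = (fun=> 1)); last by apply/funext => z; rewrite expr0.
  by apply: complex_extR => /=; exact: Rintegral_haar_cst.
have [i1 i2] := cintegrable_exp n.
apply: complex_extR => /=.
  have [_ h] := integral_haar i1; rewrite /Rintegral h.
  under eq_integral do rewrite /= cis_exp /=.
  by rewrite integral_cos ?lt0n// mule0.
(* The imaginary part changes sign under conjugation, which preserves [haar]. *)
have := @Rintegral_haar_conj R (fun z => Im (sval z ^+ n)) _.
rewrite (@eq_Rintegral _ _ _ _ _ (fun z : circ => - 1 * Im (sval z ^+ n))); last first.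
  by move=> z _; rewrite circle_conjE -rmorphXn/= ImJ mulN1r.
rewrite RintegralZl//.
have /measurable_EFinP mI := measurable_int _ i2.
move/(_ mI); lra.
Qed.

End moments.

(** * Monomials, projection and uniqueness in the Hardy space *)

Section hardy_space.
Variables (R : realType) (E : hilbertType R).
Hypothesis sepE : separable E.
Local Notation circ := (circle R).
Local Notation P := (haar R).
Local Notation Re := (@complex.Re R).
Local Notation Im := (@complex.Im R).
Local Notation SE := (semi_inner_hilbert E).
Local Notation SL := (semi_inner_L2 sepE).
Implicit Types f g h : circ -> E.

Definition zmon n (x : E) : circ -> E := fun z => sval z ^+ n *: x.
Definition zmonJ n (x : E) : circ -> E := fun z => (sval z)^* ^+ n *: x.

Lemma L2_svalX n f : L2 E f -> L2 E (fun z => sval z ^+ n *: f z).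
Proof.
apply: (@L2_mul _ _ sepE _ _ 1).
  by apply: cmeasurableX; exact: cmeasurable_sval.
by move=> z; have := normsqX (sval z) n; rewrite normsq_circle expr1n /normsq => ->.
Qed.

Lemma L2_svalJX n f : L2 E f -> L2 E (fun z => (sval z)^* ^+ n *: f z).
Proof.
apply: (@L2_mul _ _ sepE _ _ 1).
  by apply/cmeasurableX/cmeasurable_conj; exact: cmeasurable_sval.
move=> z; rewrite -circle_conjE.
by have := normsqX (sval (circle_conj z)) n; rewrite normsq_circle expr1n /normsq => ->.
Qed.

Lemma L2_zmon n x : L2 E (zmon n x).
Proof. by apply: L2_svalX; exact: L2_cst. Qed.

Lemma L2_zmonJ n x : L2 E (zmonJ n x).
Proof. by apply: L2_svalJX; exact: L2_cst. Qed.

Lemma L2inner_zmonJ f n x :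
  L2inner f (zmonJ n x) = cintegral (fun z => sval z ^+ n * inner (f z) x).
Proof.
by congr cintegral; apply/funext => z; rewrite (siZr SE)// rmorphXn/= conjCK.
Qed.

Lemma L2inner_zmon f n x :
  L2inner f (zmon n x) = cintegral (fun z => (sval z)^* ^+ n * inner (f z) x).
Proof. by congr cintegral; apply/funext => z; rewrite (siZr SE)// rmorphXn. Qed.

Let K : set (circ -> E) := [set k | exists n x, (0 < n)%N /\ k = zmonJ n x].

Let KL2 : K `<=` L2 E.
Proof. by move=> _ [n [x [_ ->]]]; exact: L2_zmonJ. Qed.

(** As an orthogonal complement, [H2] inherits completeness from [L2]. *)
Lemma H2_orthE : H2 E = [set f | L2 E f /\ forall k, K k -> L2inner f k = 0].
Proof.
apply/seteqP; split => f [Lf hf]; split => //.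
  by move=> _ [n [x [n0 ->]]]; rewrite L2inner_zmonJ hf.
by move=> n x n0; rewrite -L2inner_zmonJ; apply: hf; exists n, x.
Qed.

Lemma semi_inner_H2 : semi_inner (H2 E) (@L2inner R E).
Proof. by rewrite H2_orthE; exact: (semi_inner_orth SL KL2). Qed.

Lemma H2_complete : si_complete (H2 E) (@L2inner R E).
Proof. by rewrite H2_orthE; exact: (si_complete_orth SL KL2 (L2_complete sepE)). Qed.

Lemma L2inner_zmon_zmon n m x y :
  L2inner (zmon n x) (zmon m y) = (n == m)%:R * inner x y.
Proof.
rewrite L2inner_zmon /zmon.
have cz k : cintegral (fun z : circ => sval z ^+ k * inner x y) = (k == 0)%:R * inner x y.
  under eq_fun do rewrite mulrC.
  by rewrite cintegralZ ?cintegral_exp 1?mulrC//; exact: cintegrable_exp.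
have czJ k : cintegral (fun z : circ => (sval z)^* ^+ k * inner x y) = (k == 0)%:R * inner x y.
  rewrite -cz -[RHS]cintegral_haar_conj //.
  by apply: cmeasurableM; [exact/cmeasurableX/cmeasurable_sval|exact: cmeasurable_cst].
have mulJ k (z : circ) : (sval z)^* ^+ k * sval z ^+ k = 1.
  by rewrite -exprMn mulrC circle_mulJ expr1n.
have [nm|mn] := leqP m n.
  rewrite (_ : (n == m) = ((n - m)%N == 0%N)); last by rewrite subn_eq0 eqn_leq nm andbT.
  rewrite -cz; congr cintegral; apply/funext => z; rewrite (siZl SE)// mulrA.
  by rewrite -[in sval z ^+ n](subnK nm) exprD mulrCA mulJ mulr1.
rewrite (_ : (n == m) = ((m - n)%N == 0%N)); last first.
  by rewrite subn_eq0 (leqNgt m n) mn; apply/negbTE; rewrite ltn_eqF.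
rewrite -czJ; congr cintegral; apply/funext => z; rewrite (siZl SE)// mulrA.
by congr (_ * _); rewrite -[in LHS](subnK (ltnW mn)) exprD -mulrA mulJ mulr1.
Qed.

Lemma H2_zmon n x : H2 E (zmon n x).
Proof.
split; first exact: L2_zmon.
move=> m y m0; have := L2inner_zmon_zmon (n + m) 0 x y.
rewrite L2inner_zmon addn_eq0 (gtn_eqF m0) andbF mul0r => <-.
congr cintegral; apply/funext => z; rewrite /zmon !(siZl SE)// expr0 mul1r.
by rewrite mulrA -exprD addnC.
Qed.

Lemma H2_L2 f : H2 E f -> L2 E f. Proof. by case. Qed.

(** Pairing with a dense sequence of vectors reduces the claim to scalar uniqueness off one null
    set; a vector orthogonal to a dense sequence is zero. *)
Lemma L2_fourier_ae0 f : L2 E f -> (forall n x, L2inner f (zmon n x) = 0) ->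
  (forall n x, L2inner f (zmonJ n x) = 0) -> aeeq f 0.
Proof.
move=> Lf f1 f2; have [d dd] := dense_seq sepE.
have h n : aeeq (fun z => inner (f z) (d n)) (fun=> 0).
  apply: fourier_null_ae0; split.
  - exact: (cintegrable_inner sepE Lf (L2_cst sepE (d n))).
  - by move=> m; rewrite -L2inner_zmonJ.
  - by move=> m; rewrite -L2inner_zmon.
have : {ae P, forall z, forall n, inner (f z) (d n) = 0} by exact/ae_foralln.
apply: filterS => z hz; apply/eqP; rewrite -(dnorm_eq0 (@inner R E)).
apply/eqP; rewrite (si_nsq SE)// (_ : Re _ = 0)//; apply/eqP; rewrite eq_le.
rewrite (si_ge0 SE) // andbT; apply/ler_addgt0Pr => e e0; rewrite add0r.
have [n hn] := dd (f z) e e0; apply: ltW; apply: le_lt_trans hn.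
by rewrite (nsqB SE)// hz /= mulr0 subr0 lerDl (si_ge0 SE).
Qed.

Lemma riesz_H2 (phi : (circ -> E) -> R[i]) (M : R) :
  (forall a f g, H2 E f -> H2 E g -> phi (a *: f + g) = a * phi f + phi g) ->
  (forall f, H2 E f -> Re (phi f) ^+ 2 <= M * Re (L2inner f f)) ->
  exists2 g, H2 E g & forall h, H2 E h -> phi h = L2inner h g.
Proof. by move=> pl pb; exact: (riesz_representation semi_inner_H2 H2_complete pl pb). Qed.

Lemma H2_projection f : L2 E f ->
  exists2 g, H2 E g & forall h, H2 E h -> L2inner h f = L2inner h g.
Proof.
move=> Lf; apply: (@riesz_H2 (fun h => L2inner h f) (Re (L2inner f f))).
  by move=> a g h /H2_L2 Lg /H2_L2 Lh; rewrite (si_linear SL).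
by move=> h /H2_L2 Lh; rewrite mulrC; exact: (si_CS SL).
Qed.

(* The analytic monomials are total in H^2. *)
Lemma H2_orth f : L2 E f -> (forall n x, L2inner (zmon n x) f = 0) ->
  forall h, H2 E h -> L2inner h f = 0.
Proof.
move=> Lf f0 h Hh; have [r Hr hr] := H2_projection Lf.
(* The coefficients of r of index at least 0 vanish by hypothesis, the others because r lies in
   [H2]. *)
have r0 : aeeq r 0.
  apply: L2_fourier_ae0; first exact: H2_L2.
    move=> n x; rewrite (siC SL (L2_zmon n x) (H2_L2 Hr)) -hr ?f0 ?rmorph0//.
    exact: H2_zmon.
  case=> [|n] x; last by rewrite L2inner_zmonJ; apply: Hr.2.
  rewrite (_ : zmonJ 0 x = zmon 0 x); last by apply/funext => z; rewrite /zmon /zmonJ !expr0.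
  rewrite (siC SL (L2_zmon 0 x) (H2_L2 Hr)) -hr ?f0 ?rmorph0//.
  exact: H2_zmon.
rewrite hr// (siC SL (H2_L2 Hr) (H2_L2 Hh)).
by rewrite (L2inner_ae sepE (H2_L2 Hr) (L2_cst sepE 0) (H2_L2 Hh) r0) (si0l SL) ?rmorph0//; exact: H2_L2.
Qed.

(** Riesz representation on [H2] provides a projection, so the default value of [xget] is never
    taken. *)
Lemma hardy_projP f : L2 E f -> H2 E (hardy_proj f) /\
  forall h, H2 E h -> L2inner (f - hardy_proj f) h = 0.
Proof.
move=> Lf; rewrite /hardy_proj; case: xgetP => [g -> [Hg hg]|/(_ _) nog].
  by split.
exfalso; have [g Hg hg] := H2_projection Lf; apply: (nog g); split => // h Hh.
have Lg := H2_L2 Hg; have Lh := H2_L2 Hh.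
rewrite -/(f - g) (siBl SL)// (siC SL Lh Lf) (siC SL Lh Lg) hg// subrr//.
Qed.

Lemma hardy_proj_unique f g : L2 E f -> H2 E g ->
  (forall h, H2 E h -> L2inner (f - g) h = 0) -> aeeq (hardy_proj f) g.
Proof.
move=> Lf Hg hg; have [Hp hp] := hardy_projP Lf; apply/aeeqB.
have Hd := siB semi_inner_H2 Hp Hg.
have Lp := H2_L2 Hp; have Lg := H2_L2 Hg; have Ld := H2_L2 Hd.
apply: (L2_null sepE) => //.
rewrite [X in L2inner X _](_ : _ = (f - g) - (f - hardy_proj f)); last first.
  by rewrite [in RHS]opprB [in RHS]addrC addrA subrK.
by rewrite (siBl SL) ?hg ?hp ?subrr//; exact: (siB SL).
Qed.

Lemma hardy_proj_H2 f : H2 E f -> aeeq (hardy_proj f) f.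
Proof.
move=> Hf; apply: hardy_proj_unique => //; first exact: H2_L2.
by move=> h /H2_L2 Lh; rewrite subrr (si0l SL).
Qed.

Lemma hardy_proj_contract f : L2 E f ->
  Re (L2inner (hardy_proj f) (hardy_proj f)) <= Re (L2inner f f).
Proof.
move=> Lf; have [Hp hp] := hardy_projP Lf; have Lp := H2_L2 Hp.
have Ld : L2 E (f - hardy_proj f) by exact: (siB SL).
have e := nsqD SL Ld Lp; rewrite subrK (hp _ Hp) Re0 mulr0 addr0 in e.
by rewrite e lerDr (si_ge0 SL).
Qed.

End hardy_space.

(** * Lifting a bounded form along two isometries *)

Section pair_semi_inner.
Variables (R : realType) (V1 V2 : lmodType R[i]) (S1 : set V1) (S2 : set V2).
Variables (B1 : V1 -> V1 -> R[i]) (B2 : V2 -> V2 -> R[i]).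
Hypotheses (I1 : semi_inner S1 B1) (I2 : semi_inner S2 B2).

Definition pair_form (p q : V1 * V2) := B1 p.1 q.1 + B2 p.2 q.2.

Lemma semi_inner_pair : semi_inner (S1 `*` S2) pair_form.
Proof.
split.
- by split; [exact: (si0 I1)|exact: (si0 I2)].
- by move=> a x y [? ?] [? ?]; split; [exact: (siP I1)|exact: (siP I2)].
- move=> a x y z [? ?] [? ?] [? ?].
  by rewrite /pair_form /= (si_linear I1)// (si_linear I2)//; ring.
- by move=> x y [? ?] [? ?]; rewrite /pair_form rmorphD/= -(siC I1)// -(siC I2).
- by move=> x [? ?]; rewrite ReD addr_ge0 ?(si_ge0 I1) ?(si_ge0 I2).
Qed.

Lemma si_complete_pair : si_complete S1 B1 -> si_complete S2 B2 ->
  si_complete (S1 `*` S2) pair_form.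
Proof.
move=> c1 c2 u Su cu.
have Su1 n := (Su n).1; have Su2 n := (Su n).2.
have p1 m n := si_ge0 I1 (siB I1 (Su1 m) (Su1 n)).
have p2 m n := si_ge0 I2 (siB I2 (Su2 m) (Su2 n)).
have [|l1 Sl1 h1] := c1 _ Su1.
  move=> e e0; have [N hN] := cu e e0; exists N => m n Nm Nn.
  by apply: le_trans (hN m n Nm Nn); rewrite ReD lerDl; exact: p2.
have [|l2 Sl2 h2] := c2 _ Su2.
  move=> e e0; have [N hN] := cu e e0; exists N => m n Nm Nn.
  by apply: le_trans (hN m n Nm Nn); rewrite ReD lerDr; exact: p1.
exists (l1, l2) => // e e0.
have [N1 k1] := h1 (e / 2) (divr_gt0 e0 (ltr0Sn _ 1)).
have [N2 k2] := h2 (e / 2) (divr_gt0 e0 (ltr0Sn _ 1)).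
exists (maxn N1 N2) => n; rewrite geq_max => /andP[n1 n2].
by rewrite ReD (splitr e) lerD ?k1 ?k2.
Qed.

End pair_semi_inner.

(** * Gram forms and powers of the adjoint isometry *)

Section gram.
Variables (R : realType) (V1 V2 : lmodType R[i]) (S1 : set V1) (S2 : set V2).
Variables (B1 : V1 -> V1 -> R[i]) (B2 : V2 -> V2 -> R[i]).
Hypotheses (I1 : semi_inner S1 B1) (I2 : semi_inner S2 B2).
Hypotheses (c1 : si_complete S1 B1) (c2 : si_complete S2 B2).
Local Notation Re := (@complex.Re R).
Local Notation nsq1 x := (Re (B1 x x)).
Local Notation nsq2 x := (Re (B2 x x)).

(** The bound is written as a product of two factors so that the arithmetic-geometric mean
    inequality applies to it directly. *)
Record bounded_sesqui (m : R) (beta : V1 -> V2 -> R[i]) : Prop := BoundedSesqui {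
  bs_l : forall a x y k, S1 x -> S1 y -> S2 k ->
    beta (a *: x + y) k = a * beta x k + beta y k ;
  bs_r : forall a h k l, S1 h -> S2 k -> S2 l ->
    beta h (a *: k + l) = a^* * beta h k + beta h l ;
  bs_bound : forall h k, S1 h -> S2 k ->
    Re (beta h k) ^+ 2 <= (m * nsq1 h) * (m * nsq2 k) }.

Variables (g m : R).
Hypotheses (m0 : 0 <= m) (mg : m < g).

Definition gram (beta : V1 -> V2 -> R[i]) (x y : V1 * V2) : R[i] :=
  g%:C%C * B1 x.1 y.1 + beta x.1 y.2 + (beta y.1 x.2)^* + g%:C%C * B2 x.2 y.2.

Section gram_form.
Variable beta : V1 -> V2 -> R[i].
Hypothesis bb : bounded_sesqui m beta.

Lemma Re_gram x : Re (gram beta x x) = g * nsq1 x.1 + g * nsq2 x.2 + 2 * Re (beta x.1 x.2).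
Proof. by rewrite /gram !ReImE /=; ring. Qed.

Lemma bs_norm h k : S1 h -> S2 k ->
  `|2 * Re (beta h k)| <= m * nsq1 h + m * nsq2 k.
Proof.
move=> Sh Sk; have := bs_bound bb Sh Sk => h1.
have p1 : 0 <= m * nsq1 h by rewrite mulr_ge0// (si_ge0 I1).
have p2 : 0 <= m * nsq2 k by rewrite mulr_ge0// (si_ge0 I2).
have h2 := h1; rewrite -sqrrN in h2.
have := amgm2 h1 p1 p2; have := amgm2 h2 p1 p2.
by move=> *; rewrite ler_norml; apply/andP; split; lra.
Qed.

(** Together with [gram_upper] this transfers completeness from the product norm; it is the place
    where m < g is essential. *)
Lemma gram_lower x : (S1 `*` S2) x ->
  (g - m) * (nsq1 x.1 + nsq2 x.2) <= Re (gram beta x x).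
Proof.
move=> [S1x S2x]; have := bs_norm S1x S2x; rewrite Re_gram ler_norml => /andP[? _].
lra.
Qed.

Lemma gram_upper x : (S1 `*` S2) x ->
  Re (gram beta x x) <= (g + m) * (nsq1 x.1 + nsq2 x.2).
Proof.
move=> [S1x S2x]; have := bs_norm S1x S2x; rewrite Re_gram ler_norml => /andP[_ ?].
lra.
Qed.

Lemma semi_inner_gram : semi_inner (S1 `*` S2) (gram beta).
Proof.
split.
- by split; [exact: (si0 I1)|exact: (si0 I2)].
- by move=> a x y [? ?] [? ?]; split; [exact: (siP I1)|exact: (siP I2)].
- move=> a x y z [? ?] [? ?] [? ?]; rewrite /gram /=.
  rewrite (si_linear I1)// (si_linear I2)// (bs_l bb)// (bs_r bb)//.
  by rewrite rmorphD rmorphM/= conjCK; ring.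
- move=> x y [? ?] [? ?]; rewrite /gram !rmorphD !rmorphM/= conjCK.
  rewrite -(siC I1)// -(siC I2)// !(conjC_conjc g%:C%C) conjc_real; ring.
- move=> x Sx; apply: le_trans (gram_lower Sx).
  by case: Sx => ? ?; apply: mulr_ge0; [rewrite subr_ge0 ltW|
    rewrite addr_ge0 ?(si_ge0 I1) ?(si_ge0 I2)].
Qed.

Lemma si_complete_gram : si_complete (S1 `*` S2) (gram beta).
Proof.
move=> u Su cu; have gm0 : 0 < g - m by rewrite subr_gt0.
have gp0 : 0 < g + m by apply: ltr_wpDr => //; exact: le_lt_trans m0 mg.
have [|l Sl hl] := si_complete_pair I1 I2 c1 c2 Su.
  move=> e e0.
  have [N hN] := cu ((g - m) * e) (mulr_gt0 gm0 e0); exists N => a b Na Nb.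
  rewrite ReD -(ler_pM2l gm0); apply: le_trans (hN a b Na Nb).
  by apply: gram_lower; exact: (siB (semi_inner_pair I1 I2)).
exists l => // e e0; have [N hN] := hl (e / (g + m)) (divr_gt0 e0 gp0).
exists N => n Nn; have := hN n Nn; rewrite ler_pdivlMr// mulrC.
apply: le_trans; rewrite /pair_form ReD.
exact: (gram_upper (siB (semi_inner_pair I1 I2) (Su n) Sl)).
Qed.

End gram_form.

Variables (Y : V1 -> V1) (Q : V2 -> V2) (beta : V1 -> V2 -> R[i]).
Hypothesis bb : bounded_sesqui m beta.
Hypothesis YS : forall h, S1 h -> S1 (Y h).
Hypothesis QS : forall k, S2 k -> S2 (Q k).
Hypothesis YP : forall a x y, Y (a *: x + y) = a *: Y x + Y y.
Hypothesis QP : forall a x y, Q (a *: x + y) = a *: Q x + Q y.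
Hypothesis Yiso : forall x y, S1 x -> S1 y -> B1 (Y x) (Y y) = B1 x y.
Hypothesis Qiso : forall x y, S2 x -> S2 y -> B2 (Q x) (Q y) = B2 x y.
Hypothesis YQ : forall h k, S1 h -> S2 k -> beta (Y h) k = beta h (Q k).

Local Notation K := (S1 `*` S2).
Local Notation G := (gram beta).
Local Notation IG := (semi_inner_gram bb).

Let Y0 : Y 0 = 0.
Proof.
have := YP 1 0 0; rewrite !scale1r addr0 => /eqP.
by rewrite addrC -subr_eq subrr => /eqP.
Qed.

Let Q0 : Q 0 = 0.
Proof.
have := QP 1 0 0; rewrite !scale1r addr0 => /eqP.
by rewrite addrC -subr_eq subrr => /eqP.
Qed.

Let bb' : bounded_sesqui m (fun h k => beta h (Q k)).
Proof.
split.
- by move=> a x y k Sx Sy Sk; apply: (bs_l bb) => //; exact: QS.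
- by move=> a h k l Sh Sk Sl; rewrite QP (bs_r bb)//; exact: QS.
- by move=> h k Sh Sk; have := bs_bound bb Sh (QS Sk); rewrite Qiso.
Qed.

Let gram_isometry a b : K a -> K b ->
  G (Y a.1, a.2) (Y b.1, b.2) = G (a.1, Q a.2) (b.1, Q b.2).
Proof. by move=> [? ?] [? ?]; rewrite /gram /= Yiso// Qiso// !YQ. Qed.

(** Pulled back along (h, k) |-> (h, Q k), the Gram form becomes the Gram form of a twisted beta
    with the same bound, hence complete. Riesz representation then applies on the whole space, and
    closedness of the range of [Q] need not be discussed. *)
Let gram_shifted a b : K a -> K b ->
  gram (fun h k => beta h (Q k)) a b = G (a.1, Q a.2) (b.1, Q b.2).
Proof. by move=> [? ?] [? ?]; rewrite /gram /= Qiso. Qed.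

(* [x |-> ((D x).1, Q (D x).2)] is the adjoint of the isometry
   [(h, Q k) |-> (Y h, k)] of the Gram space. *)
Lemma lifting_operator : exists D : V1 * V2 -> V1 * V2, forall x, K x ->
  K (D x) /\ forall y, K y ->
    G (y.1, Q y.2) ((D x).1, Q (D x).2) = G (Y y.1, y.2) x.
Proof.
have KY y : K y -> K (Y y.1, y.2) by move=> [? ?]; split => //; exact: YS.
suff /choice[D hD] : forall x, exists d, K x -> K d /\ forall y, K y ->
    G (y.1, Q y.2) (d.1, Q d.2) = G (Y y.1, y.2) x by exists D.
move=> x; have [Kx|Kx] := pselect (K x); last by exists 0.
have [||d Kd hd] := @riesz_representation _ _ _ _ (semi_inner_gram bb')
    (si_complete_gram bb') (fun y => G (Y y.1, y.2) x) _ (Re (G x x)).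
- move=> a y z Ky Kz; rewrite -(si_linear IG)//; try exact: KY.
  by rewrite /= YP.
- move=> y Ky; rewrite gram_shifted// -gram_isometry// mulrC.
  by apply: (si_CS IG) => //; exact: KY.
- by exists d => _; split => // y Ky; rewrite -gram_shifted//; exact/esym/hd.
Qed.

(* With [C] the adjoint above, [ell i h k] is the Gram product of [C^i (h, 0)] and
   [(0, k)]; the inequality is the positivity of [C^N (h, 0) + (0, k_N)] for
   [k_(i+1) = Q k_i + kap i], as [C] is a contraction. *)
Theorem coefficient_lifting : exists ell : nat -> V1 -> V2 -> R[i], [/\
  forall h k, S1 h -> S2 k -> ell 0%N h k = beta h k,
  forall i a h h' k, S1 h -> S1 h' -> S2 k ->
    ell i (a *: h + h') k = a * ell i h k + ell i h' k,
  forall i a h k k', S1 h -> S2 k -> S2 k' ->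
    ell i h (a *: k + k') = a^* * ell i h k + ell i h k',
  forall i h k, S1 h -> S2 k -> ell i.+1 (Y h) k = ell i h k &
  forall N h k0 (kap : nat -> V2), S1 h -> S2 k0 -> (forall i, S2 (kap i)) ->
    (forall i k, S2 k -> B2 (Q k) (kap i) = 0) ->
    0 <= g * nsq1 h + g * nsq2 k0 + 2 * Re (beta h k0) +
      \sum_(i < N) (g * nsq2 (kap i) + 2 * Re (ell i.+1 h (kap i)))].
Proof.
have [D hD] := lifting_operator.
have KD x : K x -> K (D x) by move=> /hD[].
pose emb a := (a.1, Q a.2) : V1 * V2.
pose C x := emb (D x).
have Kemb a : K a -> K (emb a) by move=> [? ?]; split => //; exact: QS.
have KC x : K x -> K (C x) by move=> Kx; exact/Kemb/KD.
have embP a x y : emb (a *: x + y) = a *: emb x + emb y by rewrite /emb /= QP.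
have embD x y : emb (x + y) = emb x + emb y.
  by rewrite -[x in LHS]scale1r embP scale1r.
have embB x y : emb (x - y) = emb x - emb y.
  by rewrite -[X in emb X]addrC -scaleN1r embP scaleN1r addrC.
have star x y : K x -> K y -> G (emb y) (C x) = G (Y y.1, y.2) x.
  by move=> Kx Ky; rewrite (hD x Kx).2.
have KY y : K y -> K (Y y.1, y.2) by move=> [? ?]; split => //; exact: YS.
have K0 k : S2 k -> K (0, k) by move=> Sk; split => //; exact: (si0 I1).
have Kh h : S1 h -> K (h, 0) by move=> Sh; split => //; exact: (si0 I2).
(* The adjoint sends (0, k), the image of (0, Q k) under the isometry, back to (0, Q k). The vector
   on the left is thus the image of x + (0, k), and contractivity follows from Cauchy-Schwarz. *)
have contr x k : K x -> S2 k ->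
    Re (G (C x + (0, Q k)) (C x + (0, Q k))) <= Re (G (x + (0, k)) (x + (0, k))).
  move=> Kx Sk; pose a := D x + (0, k).
  have Ka : K a by apply: (siD IG); [exact: KD|exact: K0].
  have -> : C x + (0, Q k) = emb a by rewrite /a embD.
  have Kxk : K (x + (0, k)) by apply: (siD IG) => //; exact: K0.
  set v := (Y a.1, a.2); have Kv : K v by exact: KY.
  have vv : G v v = G (emb a) (emb a) by rewrite gram_isometry.
  have uu : G (emb a) (emb a) = G v (x + (0, k)).
    rewrite [X in G _ X](_ : _ = C x + emb (0, k)); last by rewrite /a embD.
    have Kek : K (emb (0, k)) by exact/Kemb/K0.
    rewrite (siDr IG) ?star//; [|exact: KC|exact: Kemb].
    rewrite (siDr IG)//; last exact: K0.
    congr (_ + _); have := gram_isometry Ka (K0 k Sk).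
    by rewrite /= Y0 => <-.
  have := si_CS IG Kv Kxk; rewrite -uu vv.
  have := si_ge0 IG Kxk; have := si_ge0 IG (Kemb a Ka).
  move: (Re (G (emb a) (emb a))) (Re (G (x + _) _)) => p q p0 q0.
  rewrite le_eqVlt in p0; case/predU1P: p0 => [<-//|p0].
  by rewrite expr2 ler_pM2l.
have null_emb a : K a -> (forall y, K y -> G (emb y) (emb a) = 0) -> Re (G (emb a) (emb a)) = 0.
  by move=> Ka h; rewrite h.
have Cnull x : K x -> Re (G x x) = 0 -> Re (G (C x) (C x)) = 0.
  move=> Kx x0; have := contr x 0 Kx (si0 I2); rewrite Q0.
  have -> : (0, 0) = 0 :> V1 * V2 by [].
  rewrite !addr0 x0 => h; apply/eqP; rewrite eq_le h.
  by rewrite (si_ge0 IG)//; exact: KC.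
(* [D] comes from a choice, so [C] is linear only up to Gram-null vectors; these pair to zero with
   every vector, hence do not affect [ell]. *)
have Clin a x y : K x -> K y ->
    Re (G (C (a *: x + y) - (a *: C x + C y)) (C (a *: x + y) - (a *: C x + C y))) = 0.
  move=> Kx Ky; have Kxy := siP IG a Kx Ky.
  have KDD : K (D (a *: x + y) - (a *: D x + D y)).
    apply: (siB IG); first exact: KD.
    by apply: (siP IG); exact: KD.
  have eC : emb (D (a *: x + y) - (a *: D x + D y)) = C (a *: x + y) - (a *: C x + C y).
    by rewrite embB embP.
  rewrite -eC; apply: null_emb => // b Kb; rewrite eC.
  have Keb := Kemb b Kb.
  have Kv := KY b Kb; have KCx := KC x Kx; have KCy := KC y Ky.
  have KCC := siP IG a KCx KCy; have KCxy := KC _ Kxy.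
  rewrite (siBr IG KCxy KCC Keb) (siPr IG a KCx KCy Keb).
  by rewrite (star _ _ Kxy Kb) (star _ _ Kx Kb) (star _ _ Ky Kb) (siPr IG a Kx Ky Kv) subrr.
have nullD x y : K x -> K y -> Re (G x x) = 0 -> Re (G y y) = 0 -> Re (G (x + y) (x + y)) = 0.
  by move=> Kx Ky x0 y0; rewrite (nsqD IG)// x0 y0 (si_null IG)//= mulr0 !addr0.
have nullZ a x : K x -> Re (G x x) = 0 -> Re (G (a *: x) (a *: x)) = 0.
  by move=> Kx x0; rewrite (nsqZ IG)// x0 mulr0.
have Cdiff x y : K x -> K y -> Re (G (x - y) (x - y)) = 0 ->
    Re (G (C x - C y) (C x - C y)) = 0.
  move=> Kx Ky xy0; have Kxy := siB IG Kx Ky.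
  have Kt : K (C (1 *: (x - y) + y) - (1 *: C (x - y) + C y)).
    apply: (siB IG); first by apply: KC; exact: (siP IG).
    by apply: (siP IG); exact: KC.
  have -> : C x - C y = (C (1 *: (x - y) + y) - (1 *: C (x - y) + C y)) + C (x - y).
    by rewrite !scale1r subrK opprD addrA addrAC subrK.
  by apply: nullD => //; [exact: KC|exact: Clin|exact: Cnull].
pose d i h := iter i C (h, 0).
have Kd i h : S1 h -> K (d i h).
  by move=> Sh; elim: i => [|i IH]; [exact: Kh|exact: KC].
have null0 : Re (G 0 0) = 0 by rewrite (si0l IG)//; exact: (si0 IG).
have dlin i a h h' : S1 h -> S1 h' ->
    Re (G (d i (a *: h + h') - (a *: d i h + d i h'))
          (d i (a *: h + h') - (a *: d i h + d i h'))) = 0.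
  move=> Sh Sh'; have Shh := siP I1 a Sh Sh'.
  elim: i => [|i IH].
    rewrite (_ : _ - _ = 0)//; apply/eqP; rewrite subr_eq0; apply/eqP.
    by congr pair; rewrite /= scaler0 addr0.
  have Kp := siP IG a (Kd i h Sh) (Kd i h' Sh').
  have -> : d i.+1 (a *: h + h') - (a *: d i.+1 h + d i.+1 h') =
      (C (d i (a *: h + h')) - C (a *: d i h + d i h')) +
      (C (a *: d i h + d i h') - (a *: C (d i h) + C (d i h'))).
    by rewrite addrA subrK.
  apply: nullD.
  - by apply: (siB IG); apply: KC => //; exact: Kd.
  - by apply: (siB IG); [exact: KC|apply: (siP IG); apply: KC; exact: Kd].
  - by apply: Cdiff => //; exact: Kd.
  - by apply: Clin; exact: Kd.
(* The isometry maps (h, 0) to (Y h, 0) since Q 0 = 0, so its adjoint maps (Y h, 0) back to (h,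
   0). *)
have dshift h : S1 h -> Re (G (C (Y h, 0) - (h, 0)) (C (Y h, 0) - (h, 0))) = 0.
  move=> Sh; have KY0 := Kh _ (YS Sh); have K0h := Kh _ Sh.
  have eh : emb (h, 0) = (h, 0) by rewrite /emb /= Q0.
  have Ka : K (D (Y h, 0) - (h, 0)) by apply: (siB IG) => //; exact: KD.
  have ea : emb (D (Y h, 0) - (h, 0)) = C (Y h, 0) - (h, 0).
    by rewrite embB eh.
  rewrite -[X in G X _]ea (siBr IG (KC _ KY0) K0h (Kemb _ Ka)) (star _ _ KY0 Ka).
  have := gram_isometry Ka K0h; rewrite [(h, 0).1]/= [(h, 0).2]/= Q0 => ->.
  by rewrite subrr.
have dY i h : S1 h -> Re (G (d i.+1 (Y h) - d i h) (d i.+1 (Y h) - d i h)) = 0.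
  move=> Sh; elim: i => [|i IH]; first exact: dshift.
  by apply: (Cdiff (d i.+1 (Y h)) (d i h)) => //; apply: Kd => //; exact: YS.
have b0k k : S2 k -> beta 0 k = 0.
  move=> Sk; have := bs_l bb 1 (si0 I1) (si0 I1) Sk.
  by rewrite scale1r addr0 mul1r => /eqP; rewrite addrC -subr_eq subrr => /eqP.
have Kk k : S2 k -> K (0, k) by exact: K0.
exists (fun i h k => G (d i h) (0, k)); split.
- move=> h k Sh Sk; rewrite /gram /= (si0r I1)// (si0l I2)// b0k; last exact: (si0 I2).
  by rewrite !mulr0 rmorph0 add0r !addr0.
- move=> i a h h' k Sh Sh' Sk; apply/eqP.
  have Kp := siP IG a (Kd i h Sh) (Kd i h' Sh').
  have Kl := Kd i _ (siP I1 a Sh Sh').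
  rewrite -(si_linear IG) ?(Kd _ _ Sh) ?(Kd _ _ Sh')//; try exact: Kk; try exact: Kd.
  rewrite -subr_eq0 -(siBl IG)//; last exact: Kk.
  by rewrite (si_null IG)//; [exact: (siB IG)|exact: Kk|exact: dlin].
- move=> i a h k k' Sh Sk Sk'.
  have -> : (0, a *: k + k') = a *: (0, k) + (0, k') :> V1 * V2.
    by congr pair; rewrite /= scaler0 addr0.
  rewrite (siDr IG) ?(siZr IG)//; try exact: Kd; try exact: Kk.
  by apply: (siZ IG); exact: Kk.
- move=> i h k Sh Sk; apply/eqP.
  have K1 := Kd i.+1 _ (YS Sh); have K2 := Kd i _ Sh.
  rewrite -subr_eq0 -(siBl IG)//; last exact: Kk.
  by rewrite (si_null IG)//; [exact: (siB IG)|exact: Kk|exact: dY].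
move=> N h k0 kap Sh Sk0 Skap wand.
have nk k : S2 k -> Re (G (0, k) (0, k)) = g * nsq2 k.
  by move=> Sk; rewrite Re_gram [(0, k).1]/= [(0, k).2]/= (b0k k Sk) (si0l I1 (si0 I1)) Re0 !mulr0 add0r addr0.
(* [contr] advances the recursion by one step, and orthogonality of kap to the range of [Q] removes
   the cross term. *)
have [k [Sk hk]] : exists k, S2 k /\ Re (G (d N h + (0, k)) (d N h + (0, k))) <=
    Re (G ((h, 0) + (0, k0)) ((h, 0) + (0, k0))) +
    \sum_(i < N) (g * nsq2 (kap i) + 2 * Re (G (d i.+1 h) (0, kap i))).
  elim: N => [|N [k [Sk hk]]]; first by exists k0; split => //; rewrite big_ord0 addr0.
  exists (Q k + kap N); split; first by apply: (siD I2) => //; exact: QS.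
  rewrite big_ord_recr /= addrA; apply: (@le_trans _ _ (
      Re (G (C (d N h) + (0, Q k)) (C (d N h) + (0, Q k))) +
      (g * nsq2 (kap N) + 2 * Re (G (d N.+1 h) (0, kap N))))); last first.
    by rewrite lerD2r; apply: le_trans hk; apply: contr => //; exact: Kd.
  have -> : (0, Q k + kap N) = (0, Q k) + (0, kap N) :> V1 * V2.
    by congr pair; rewrite /= addr0.
  have KQ := Kk _ (QS Sk); have Kc := KC _ (Kd N h Sh); have Kp := Kk _ (Skap N).
  have Kcq := siD IG Kc KQ.
  rewrite addrA (nsqD IG Kcq Kp) (nk _ (Skap N)) (siDl IG Kc KQ Kp) ReD.
  have -> : G (0, Q k) (0, kap N) = 0.
    rewrite /gram /= (wand _ _ Sk) (b0k _ (Skap N)) (b0k _ (QS Sk)) (si0l I1 (si0 I1)).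
    by rewrite !mulr0 rmorph0 !addr0.
  by rewrite Re0 addr0 addrA.
have Kn : K (d N h + (0, k)) by apply: (siD IG); [exact: Kd|exact: Kk].
apply: le_trans (si_ge0 IG Kn) (le_trans hk _).
by rewrite lerD2r Re_gram /= addr0 add0r.
Qed.

End gram.

(** * Shift, flip and intertwiners *)

Section shift_flip.
Variables (R : realType) (E : hilbertType R).
Hypothesis sepE : separable E.
Local Notation circ := (circle R).
Local Notation Re := (@complex.Re R).
Local Notation SE := (semi_inner_hilbert E).
Local Notation SL := (semi_inner_L2 sepE).
Implicit Types f g h : circ -> E.

(* MathComp-Analysis has another [shift]. *)
Local Notation shift := (@Defs.shift R E).

Definition shiftJ f : circ -> E := fun z => (sval z)^* *: f z.

Lemma shiftP a f g : shift (a *: f + g) = a *: shift f + shift g.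
Proof.
apply/funext => z; rewrite -[RHS]/(a *: (sval z *: f z) + sval z *: g z).
by rewrite -[LHS]/(sval z *: (a *: f z + g z)) scalerDr !scalerA mulrC.
Qed.

Lemma shiftJP a f g : shiftJ (a *: f + g) = a *: shiftJ f + shiftJ g.
Proof.
apply/funext => z; rewrite -[RHS]/(a *: ((sval z)^* *: f z) + (sval z)^* *: g z).
by rewrite -[LHS]/((sval z)^* *: (a *: f z + g z)) scalerDr !scalerA mulrC.
Qed.

Lemma shiftK f : shiftJ (shift f) = f.
Proof.
by apply/funext => z; rewrite /shiftJ /shift scalerA mulrC circle_mulJ scale1r.
Qed.

Lemma shiftJK f : shift (shiftJ f) = f.
Proof. by apply/funext => z; rewrite /shiftJ /shift scalerA circle_mulJ scale1r. Qed.

Lemma L2_shift f : L2 E f -> L2 E (shift f).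
Proof. exact: (L2_svalX sepE 1). Qed.

Lemma L2_shiftJ f : L2 E f -> L2 E (shiftJ f).
Proof. exact: (L2_svalJX sepE 1). Qed.

Lemma L2inner_shift f g : L2inner (shift f) g = L2inner f (shiftJ g).
Proof.
by congr cintegral; apply/funext => z; rewrite (siZl SE)// (siZr SE)// conjCK.
Qed.

Lemma L2inner_shiftJ f g : L2inner (shiftJ f) g = L2inner f (shift g).
Proof. by congr cintegral; apply/funext => z; rewrite (siZl SE)// (siZr SE). Qed.

Lemma shift_zmon n (x : E) : shift (zmon n x) = zmon n.+1 x.
Proof. by apply/funext => z; rewrite /shift scalerA -exprS. Qed.

Lemma shiftJ_zmon n (x : E) : shiftJ (zmon n.+1 x) = zmon n x.
Proof. by rewrite -shift_zmon shiftK. Qed.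

Lemma shiftJ_zmonJ n (x : E) : shiftJ (zmonJ n x) = zmonJ n.+1 x.
Proof. by apply/funext => z; rewrite /shiftJ scalerA -exprS. Qed.

Lemma zmon0 (x : E) : zmon 0 x = (fun _ : circ => x).
Proof. by apply/funext => z; rewrite /zmon scale1r. Qed.

Lemma zmonJ0 (x : E) : zmonJ 0 x = (fun _ : circ => x).
Proof. by apply/funext => z; rewrite /zmonJ scale1r. Qed.

Lemma H2_cst (x : E) : H2 E (fun=> x).
Proof. by rewrite -zmon0; exact: (H2_zmon sepE). Qed.

Lemma H2_shift f : H2 E f -> H2 E (shift f).
Proof.
move=> [Lf f0]; split; first exact: L2_shift.
move=> n x n0; rewrite -L2inner_zmonJ L2inner_shift shiftJ_zmonJ L2inner_zmonJ.
exact: f0.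
Qed.

Lemma flipK f : flip (flip f) = f.
Proof.
apply/funext => z; rewrite /flip circle_conjK scalerA.
by rewrite -[X in X *: _]/((sval z)^* * ((sval z)^*)^*) conjCK mulrC circle_mulJ scale1r.
Qed.

Lemma L2_flip f : L2 E f -> L2 E (flip f).
Proof.
move=> Lf; have /(L2E sepE)[mf _] := Lf.
apply: (@L2_shiftJ (fun z => f (circle_conj z))).
split; first exact: wmeasurable_circle_conj.
have mn := measurable_hnorm_sqr sepE mf.
rewrite (ge0_integral_haar_conj (f := fun z => (hnorm (f z) ^+ 2)%:E)); first exact: Lf.2.
  exact/measurable_EFinP.
by move=> z; rewrite lee_fin sqr_ge0.
Qed.

Lemma L2inner_flip f g : L2 E f -> L2 E g ->
  L2inner (flip f) g = L2inner f (flip g).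
Proof.
move=> Lf Lg; have mf := (proj1 (L2E sepE f) Lf).1.
have mg := (proj1 (L2E sepE _) (L2_flip Lg)).1.
rewrite /L2inner -[RHS]cintegral_haar_conj; last exact: cmeasurable_inner.
congr cintegral; apply/funext => z; rewrite (siZl SE)// (siZr SE)// circle_conjK.
by rewrite -conjC_conjc circle_conjE conjCK.
Qed.

Lemma flip_zmon n (x : E) : flip (zmon n x) = zmonJ n.+1 x.
Proof.
by apply/funext => z; rewrite /flip /zmon /zmonJ circle_conjE scalerA -exprS.
Qed.

Lemma flip_zmonJ n (x : E) : flip (zmonJ n.+1 x) = zmon n x.
Proof. by rewrite -flip_zmon flipK. Qed.

(** [flip] turns z^n into conj z^(n+1), so the image of an analytic function has no coefficient of
    index at least 0. *)
Lemma flip_H2_orth f h : H2 E f -> H2 E h -> L2inner (flip f) h = 0.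
Proof.
move=> Hf Hh; have Lf := H2_L2 Hf; have Lff := L2_flip Lf.
rewrite (siC SL (H2_L2 Hh) Lff) (H2_orth sepE Lff) ?rmorph0// => n x.
have Lz := L2_zmon sepE n x.
rewrite (siC SL Lff Lz) L2inner_flip// flip_zmon L2inner_zmonJ.
by rewrite Hf.2 ?rmorph0.
Qed.

Lemma aeeq_refl f : aeeq f f. Proof. exact: aeW. Qed.

Lemma aeeq_sym f g : aeeq f g -> aeeq g f.
Proof. by apply: filterS => z ->. Qed.

Lemma aeeq_trans g f h : aeeq f g -> aeeq g h -> aeeq f h.
Proof. by move=> fg gh; apply: filterS2 fg gh => z -> ->. Qed.

Lemma aeeqP a f f' g g' : aeeq f f' -> aeeq g g' -> aeeq (a *: f + g) (a *: f' + g').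
Proof.
move=> ff gg; apply: filterS2 ff gg => z e1 e2.
by rewrite -[LHS]/(a *: f z + g z) e1 e2.
Qed.

Lemma aeeq_shift f g : aeeq f g -> aeeq (shift f) (shift g).
Proof. by apply: filterS => z e; rewrite /shift e. Qed.

Lemma aeeq_nsq f g : L2 E f -> L2 E g -> aeeq f g -> L2inner f f = L2inner g g.
Proof.
move=> Lf Lg fg; rewrite (L2inner_ae sepE Lf Lg Lf fg).
by rewrite (siC SL Lf Lg) (L2inner_ae sepE Lf Lg Lg fg) -(siC SL).
Qed.

(** The projection of conj z k to [H2] is an adjoint vector, which excludes the default value of
    [xget]. *)
Lemma H2adjoint_shiftP k : H2 E k -> H2 E (H2adjoint shift k) /\
  forall h, H2 E h -> L2inner (shift h) k = L2inner h (H2adjoint shift k).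
Proof.
move=> Hk; rewrite /H2adjoint; case: xgetP => [g -> []//|/(_ _) nog].
have [g Hg hg] := H2_projection sepE (L2_shiftJ (H2_L2 Hk)).
exfalso; apply: (nog g); split => // h Hh.
by rewrite L2inner_shift hg.
Qed.

Lemma L2_ext f g : L2 E f -> L2 E g ->
  (forall n x, L2inner f (zmon n x) = L2inner g (zmon n x)) ->
  (forall n x, L2inner f (zmonJ n.+1 x) = L2inner g (zmonJ n.+1 x)) -> aeeq f g.
Proof.
move=> Lf Lg e1 e2; apply/aeeqB; apply: (L2_fourier_ae0 sepE); first exact: (siB SL).
  by move=> n x; rewrite (siBl SL)// ?e1 ?subrr//; exact: L2_zmon.
case=> [|n] x.
  by rewrite zmonJ0 -zmon0 (siBl SL)// ?e1 ?subrr//; exact: L2_zmon.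
by rewrite (siBl SL)// ?e2 ?subrr//; exact: L2_zmonJ.
Qed.

Lemma H2_ext f g : H2 E f -> H2 E g ->
  (forall n x, L2inner f (zmon n x) = L2inner g (zmon n x)) -> aeeq f g.
Proof.
move=> Hf Hg e; apply: (L2_ext (H2_L2 Hf) (H2_L2 Hg) e) => n x.
by rewrite !L2inner_zmonJ Hf.2// Hg.2.
Qed.

Lemma L2inner_cst (x y : E) : L2inner (fun=> x) (fun=> y) = inner x y.
Proof.
by rewrite -!zmon0 L2inner_zmon_zmon eqxx mul1r.
Qed.

End shift_flip.

(** * Functions in [H2] with prescribed coefficients *)

Section synthesis.
Variables (R : realType) (E : hilbertType R).
Hypothesis sepE : separable E.
Local Notation circ := (circle R).
Local Notation Re := (@complex.Re R).
Local Notation SH := (semi_inner_H2 sepE).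
Variables (c : nat -> E) (C : R).
Hypothesis cC : forall N, \sum_(i < N) Re (inner (c i) (c i)) <= C.

Let s N : R := \sum_(i < N) Re (inner (c i) (c i)).
Let v N : circ -> E := \sum_(i < N) zmon i (c i).

Let Hv N : H2 E (v N).
Proof.
by elim: N => [|N IH]; rewrite /v ?big_ord0 ?big_ord_recr;
  [exact: (si0 SH)|apply: (siD SH IH); exact: H2_zmon].
Qed.

Let v_zmon N n x : L2inner (v N) (zmon n x) = (n < N)%:R * inner (c n) x.
Proof.
elim: N => [|N IH]; first by rewrite /v big_ord0 (si0l SH) ?mul0r//; exact: H2_zmon.
rewrite /v big_ord_recr -/(v N) (siDl SH) ?IH//; try exact: H2_zmon.
rewrite L2inner_zmon_zmon ltnS [(n <= N)%N]leq_eqVlt [n == N]eq_sym /=.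
by have [->|_] := eqVneq N n; rewrite ?ltnn !(mul0r, mul1r, add0r, addr0).
Qed.

Let v_v f N : H2 E f -> (forall n x, (n < N)%N -> L2inner f (zmon n x) = inner (c n) x) ->
  Re (L2inner f (v N)) = s N.
Proof.
move=> Hf; elim: N => [|N IH] h; first by rewrite /v /s !big_ord0 (si0r SH).
rewrite /v /s !big_ord_recr -/(v N) -/(s N) (siDr SH) ?ReD ?IH ?h//.
- by move=> n x nN; apply: h; exact: ltnW.
- exact: H2_zmon.
Qed.

Let nsq_vB m n : (n <= m)%N -> Re (L2inner (v m - v n) (v m - v n)) = s m - s n.
Proof.
move=> nm; have h k : Re (L2inner (v k) (v k)) = s k.
  by apply: v_v => // i x ik; rewrite v_zmon ik mul1r.
rewrite (nsqB SH)// !h v_v//; first by ring.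
by move=> i x iN; rewrite v_zmon (leq_trans iN nm) mul1r.
Qed.

(** The partial sums satisfy |v m - v n|^2 = s m - s n for n <= m, hence are Cauchy; each
    coefficient is constant from some index on and passes to the limit. *)
Lemma H2_synthesis : exists u : circ -> E, [/\ H2 E u,
  forall n x, L2inner u (zmon n x) = inner (c n) x & Re (L2inner u u) <= C].
Proof.
have ss m n : (m <= n)%N -> s m <= s n.
  by move=> mn; rewrite -subr_ge0 -nsq_vB// (si_ge0 SH)//; exact: (siB SH).
have sup_s : has_sup (range s).
  by split; [exists (s 0%N), 0%N|exists C => _ [N _ <-]; exact: cC].
have [|u Hu hu] := H2_complete sepE Hv.
  move=> e e0; have [_ [N _ <-] hN] := sup_adherent e0 sup_s; exists N => m n Nm Nn.
  wlog nm : m n Nm Nn / (n <= m)%N.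
    have [nm|mn] := leqP n m; first exact.
    by rewrite (nsqBC SH)//; apply => //; exact: ltnW.
  rewrite nsq_vB//; have := ss _ _ Nn.
  have : s m <= sup (range s) by apply: ub_le_sup; [exact: sup_s.2|exists m].
  by move: hN; set S := sup _; lra.
have uz n x : L2inner u (zmon n x) = inner (c n) x.
  have Hz y := H2_zmon sepE n y.
  have zz : L2inner (zmon n (c n)) (zmon n x) = inner (c n) x.
    by rewrite L2inner_zmon_zmon eqxx mul1r.
  apply/eqP; rewrite -subr_eq0 -zz -(siBl SH)//; apply/eqP.
  (* The shift of the index by [n.+1] makes the coefficient of index n present in every term of the
     sequence. *)
  apply: (@si_cvg_orth _ _ _ _ SH (fun N => v (N + n.+1) - zmon n (c n))) => //.
  - by move=> N; apply: (siB SH).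
  - exact: (siB SH).
  - move=> e e0; have [N hN] := hu e e0; exists N => k Nk.
    rewrite (_ : _ - _ = v (k + n.+1) - u); last by rewrite opprB addrA subrK.
    by apply: hN; rewrite (leq_trans Nk)// leq_addr.
  - move=> N; rewrite (siBl SH)// v_zmon zz.
    by rewrite (_ : (n < N + n.+1)%N) ?mul1r ?subrr// addnS ltnS leq_addl.
exists u; split => //; apply/ler_addgt0Pr => e e0.
have [N /(_ N (leqnn _))] := hu e e0.
have vv : Re (L2inner (v N) (v N)) = s N.
  by apply: v_v => // n x nN; rewrite v_zmon nN mul1r.
have uv : Re (L2inner u (v N)) = s N by exact: v_v.
rewrite (nsqBC SH)// (nsqB SH)// vv uv.
by have := cC N; rewrite -/(s N); move: (Re _) => a; lra.
Qed.

End synthesis.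

(** * The lift of [W] to an operator commuting with multiplication by z *)

Section intertwining_lift.
Variables (R : realType) (E F : hilbertType R).
Hypotheses (sepE : separable E) (sepF : separable F).
Local Notation circ := (circle R).
Local Notation Re := (@complex.Re R).
Local Notation pairs := ((circ -> E) * (circ -> F))%type.
Local Notation shiftF := (@Defs.shift R F).
Local Notation LE := (semi_inner_L2 sepE).
Local Notation LF := (semi_inner_L2 sepF).
Local Notation HE := (semi_inner_H2 sepE).
Local Notation HF := (semi_inner_H2 sepF).
Local Notation SF := (semi_inner_hilbert F).
Local Notation sf := (pair_form (@L2inner R E) (@L2inner R F)).
Local Notation nsq p := (Re (sf p p)).
Implicit Types (W : pairs -> pairs) (h k p : pairs).

Lemma sum_norm_sqr p :
  sum_norm (@L2norm R E) (@L2norm R F) p ^+ 2 = nsq p.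
Proof. by rewrite sqr_sqrtr ?addr_ge0 ?sqr_ge0// !L2norm_sqr -ReD. Qed.

Lemma sum_norm_ge0 p : 0 <= sum_norm (@L2norm R E) (@L2norm R F) p.
Proof. exact: sqrtr_ge0. Qed.

Lemma sum_norm_le p q (c : R) : 0 <= c ->
  (sum_norm (@L2norm R E) (@L2norm R F) p <=
    c * sum_norm (@L2norm R E) (@L2norm R F) q) = (nsq p <= c ^+ 2 * nsq q).
Proof.
move=> c0; rewrite -!sum_norm_sqr -exprMn ler_sqr// nnegrE ?mulr_ge0//;
  exact: sum_norm_ge0.
Qed.

Lemma opnorm_lt W (g : R) : (H2sum_opnorm W < g%:E)%E ->
  exists m : R, [/\ 0 <= m, m < g & forall p, H2sum p -> nsq (W p) <= m ^+ 2 * nsq p].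
Proof.
move=> /ereal_inf_lt[_ [m [m0 hm] <-]]; rewrite lte_fin => mg; exists m; split => //.
by move=> p Hp; rewrite -sum_norm_le//; exact: hm.
Qed.

Variables (W : pairs -> pairs) (g : R).
Hypothesis W_bounded : bounded_operator W.
Hypothesis WY_XW : operator_eq (W \o @opY R E F) (@opX R E F \o W).
Hypothesis Wg : (H2sum_opnorm W < g%:E)%E.

Local Notation S1 := (H2 E `*` H2 F).
Local Notation S2 := (L2 E `*` H2 F).
Local Notation I1 := (semi_inner_pair HE HF).
Local Notation I2 := (semi_inner_pair LE HF).
Local Notation opY := (@opY R E F).

Lemma opY_H2sum h : H2sum h -> H2sum (opY h).
Proof. by move=> [h1 h2]; split; exact: H2_shift. Qed.

Lemma pair_aeeq_inner p q k : S2 p -> S2 q -> S2 k -> pair_aeeq p q -> sf p k = sf q k.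
Proof.
move=> [p1 /H2_L2 p2] [q1 /H2_L2 q2] [k1 /H2_L2 k2] [e1 e2]; rewrite /pair_form.
by rewrite (L2inner_ae sepE p1 q1 k1 e1) (L2inner_ae sepF p2 q2 k2 e2).
Qed.

Let S12 p : S1 p -> S2 p. Proof. by move=> [/H2_L2]. Qed.

Let W2 p : S1 p -> S2 (W p).
Proof. by move=> Sp; apply: S12; exact: (bo_stable W_bounded). Qed.

Let Q k : pairs := (shiftJ k.1, shiftF k.2).

Let QS k : S2 k -> S2 (Q k).
Proof. by move=> [k1 k2]; split; [exact: L2_shiftJ|exact: H2_shift]. Qed.

Let beta h k := sf (W h) k.

(** The backward shift on the second entry of W h becomes the shift on the second slot of k, and the
    shift on the first entry becomes multiplication by conj z, its adjoint on L^2. *)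
Let beta_shift h k : S1 h -> S2 k -> beta (opY h) k = beta h (Q k).
Proof.
move=> Sh Sk; have SW := bo_stable W_bounded Sh.
have [ka kb] := H2adjoint_shiftP sepF SW.2.
have SX : S2 (opX (W h)).
  by split => //; apply: L2_shift => //; exact: (H2_L2 SW.1).
rewrite /beta (pair_aeeq_inner _ SX Sk (WY_XW Sh)); last exact: W2 (opY_H2sum Sh).
rewrite /pair_form /= L2inner_shift; congr (_ + _).
have [_ Hk] := Sk; rewrite (siC HF Hk ka) -kb//.
exact: esym (siC HF (H2_shift sepF Hk) SW.2).
Qed.

(* [G h] has the nonnegative Fourier coefficients [l i h] and the negative ones of
   [flip (W h).2]. *)
Theorem intertwining_lift : exists G : pairs -> circ -> F, [/\
  forall h, H2sum h -> L2 F (G h),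
  forall a h k, H2sum h -> H2sum k -> aeeq (G (a *: h + k)) (a *: G h + G k),
  forall h, H2sum h -> aeeq (G (opY h)) (shiftF (G h)),
  forall h, H2sum h -> Re (L2inner (W h).1 (W h).1) + Re (L2inner (G h) (G h)) <=
    g ^+ 2 * nsq h &
  forall h n x, H2sum h -> L2inner (G h) (zmonJ n.+1 x) = L2inner (W h).2 (zmon n x)].
Proof.
have [m [m0 mg hm]] := opnorm_lt Wg.
have g0 : 0 < g by exact: le_lt_trans mg.
have bb : bounded_sesqui S1 S2 sf sf m beta.
  split.
  - move=> a x y k Sx Sy Sk; rewrite -(si_linear I2)//; try exact: W2.
    apply: pair_aeeq_inner => //; last exact: (bo_linear W_bounded).
      by apply: W2; exact: (siP I1).
    by apply: (siP I2); exact: W2.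
  - move=> a h k l Sh Sk Sl; have SW := W2 Sh; have Sak := siZ I2 a Sk.
    by rewrite /beta (siDr I2 Sak Sl SW) (siZr I2).
  - move=> h k Sh Sk; apply: le_trans (si_CS I2 (W2 Sh) Sk) _.
    rewrite mulrACA -expr2 mulrA; apply: ler_wpM2r; first exact: (si_ge0 I2).
    exact: hm.
have YP a x y : opY (a *: x + y) = a *: opY x + opY y.
  by rewrite /Defs.opY /= !shiftP.
have QP a x y : Q (a *: x + y) = a *: Q x + Q y.
  by rewrite /Q /= shiftP shiftJP.
have Yiso x y : S1 x -> S1 y -> sf (opY x) (opY y) = sf x y.
  by rewrite /pair_form /= !L2inner_shift !shiftK.
have Qiso x y : S2 x -> S2 y -> sf (Q x) (Q y) = sf x y.
  by rewrite /pair_form /= L2inner_shiftJ L2inner_shift shiftK shiftJK.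
have [ell [ell0 elll ellr ellY ellN]] := coefficient_lifting I1 I2
  (si_complete_pair HE HF (H2_complete sepE) (H2_complete sepF))
  (si_complete_pair LE HF (L2_complete sepE) (H2_complete sepF))
  m0 mg bb opY_H2sum QS YP QP Yiso Qiso beta_shift.
(* Constants in the second slot are orthogonal to the range of [Q], as [coefficient_lifting]
   requires of kap. *)
pose cF (x : F) : pairs := (0, fun=> x).
have ScF x : S2 (cF x) by split; [exact: (si0 LE)|exact: H2_cst].
have wand x k : S2 k -> sf (Q k) (cF x) = 0.
  move=> [k1 k2]; rewrite /pair_form /= (si0r LE) ?add0r; last exact: L2_shiftJ.
  by rewrite L2inner_shift -zmonJ0 shiftJ_zmonJ L2inner_zmonJ k2.2.
have cFP a x y : cF (a *: x + y) = a *: cF x + cF y.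
  by rewrite /cF; congr pair; rewrite /= scaler0 addr0.
have cF_nsq x : nsq (cF x) = Re (inner x x).
  by rewrite /pair_form !L2inner_cst (si0l (semi_inner_hilbert E)) ?add0r.
have [l hl] : exists l : nat -> pairs -> F, forall i h, H2sum h -> forall x,
    ell i.+1 h (cF x) = inner (l i h) x.
  suff /choice[l hl] : forall ih : nat * pairs, exists l : F, H2sum ih.2 -> forall x,
      ell ih.1.+1 ih.2 (cF x) = inner l x.
    by exists (fun i h => l (i, h)) => i h; exact: hl (i, h).
  move=> [i h] /=; have [Sh|Sh] := pselect (H2sum h); last by exists 0.
  (* The conjugate is taken because [ell] is conjugate-linear in its last argument. *)
  have [||r _ hr] := @riesz_representation _ _ _ _ SF (@si_complete_hilbert _ F)
      (fun x => (ell i.+1 h (cF x))^*) _ (g * (g * nsq h)).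
  - move=> a x y _ _; rewrite cFP ellr//; try exact: ScF.
    by rewrite rmorphD rmorphM/= conjCK.
  - move=> x _; rewrite ReJ.
    rewrite -(mulrA g) [_ * Re (inner x x)]mulrC mulrA mulrC [X in _ <= X]mulrC.
    (* With k0 = 0 and kap equal to t x at index i and 0 elsewhere, [ellN] says that a quadratic in
       t is nonnegative; its discriminant bounds the functional. *)
    apply: quadratic_ge0 => [|t]; first by rewrite mulr_ge0 ?(si_ge0 SF)// ltW.
    pose kap j := if j == i then t%:C%C *: cF x else 0.
    have Skap j : S2 (kap j).
      rewrite /kap; case: ifP => _; last exact: (si0 I2).
      by apply: (siZ I2); exact: ScF.
    have kapw j k : S2 k -> sf (Q k) (kap j) = 0.
      move=> Sk; rewrite /kap; case: ifP => _; last by rewrite (si0r I2)//; exact: QS.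
      by rewrite (siZr I2) ?wand ?mulr0//; exact: QS.
    have b0 : beta h 0 = 0 by rewrite /beta (si0r I2)//; exact: W2.
    have l0 j : ell j h 0 = 0.
      have := ellr j 1 h 0 0 Sh (si0 I2) (si0 I2).
      rewrite scaler0 addr0 rmorph1 mul1r => /eqP.
      by rewrite addrC -subr_eq subrr eq_sym => /eqP.
    have lt j : ell j h (t%:C%C *: cF x) = t%:C%C * ell j h (cF x).
      have := ellr j t%:C%C h (cF x) 0 Sh (ScF x) (si0 I2).
      by rewrite !addr0 l0 addr0 conjC_conjc conjc_real.
    have sum_kap : \sum_(j < i.+1) (g * nsq (kap j) + 2 * Re (ell j.+1 h (kap j))) =
        g * (t ^+ 2 * Re (inner x x)) + 2 * (t * Re (ell i.+1 h (cF x))).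
      rewrite big_ord_recr big1; last first.
        move=> j _; rewrite (_ : kap _ = 0) ?(si0l I2 (si0 I2)) ?l0 ?mulr0 ?addr0//.
        by rewrite /kap (ltn_eqF (ltn_ord j)).
      have kii : kap i = t%:C%C *: cF x by rewrite /kap eqxx.
      rewrite -[LHS]/(0 + (g * nsq (kap i) + 2 * Re (ell i.+1 h (kap i)))) kii add0r.
      rewrite (nsqZ I2 t%:C%C (ScF x)) cF_nsq lt Re_mul.
      rewrite -[Re t%:C%C]/t -[complex.Im t%:C%C]/(0 : R).
      by rewrite expr0n mul0r subr0 addr0.
    have := ellN i.+1 h 0 kap Sh (si0 I2) Skap kapw.
    rewrite sum_kap (si0l I2 (si0 I2)) b0 mulr0 Re0 mulr0 !addr0.
    by move: (Re (inner x x)) (Re (ell _ _ _)) (nsq h) => *; lra.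
  exists r => _ x; have := hr x I; rewrite (siC SF (x := r))// => /(congr1 Num.conj).
  by rewrite !conjCK.
have inner_ext (x y : F) : (forall t, inner x t = inner y t) -> x = y.
  move=> xy; apply/eqP; rewrite -subr_eq0 -(dnorm_eq0 (@inner R F)).
  by rewrite (siBl SF)// xy subrr.
have lP i a h k : H2sum h -> H2sum k -> l i (a *: h + k) = a *: l i h + l i k.
  move=> Sh Sk; apply: inner_ext => x; rewrite -hl; last exact: (siP I1).
  by rewrite elll// (si_linear SF)// !hl.
have lS i h : H2sum h -> l i.+1 (opY h) = l i h.
  move=> Sh; apply: inner_ext => x; rewrite -!hl//; last exact: opY_H2sum.
  exact: ellY.
(* The constant term of G (Y h) is the coefficient of index -1 of G h, which comes from the second
   entry of W h; this joins the two halves of [G]. *)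
have l0 h x : H2sum h -> inner (l 0%N (opY h)) x = L2inner (W h).2 (fun=> x).
  move=> Sh; rewrite -hl; last exact: opY_H2sum.
  rewrite ellY// ell0// /beta /pair_form (si0r LE) ?add0r//.
  exact: (W2 Sh).1.
have lC h N : H2sum h ->
    \sum_(i < N) Re (inner (l i h) (l i h)) <= g ^+ 2 * nsq h - nsq (W h).
  (* The minimiser -1/g of g r^2 + 2 r. With k0 = r W h and kap j = r l_j(h), multiplying [ellN] by
     g gives the stated inequality. *)
  move=> Sh; pose r : R[i] := (- g^-1)%:C%C.
  have rr : Re r ^+ 2 + complex.Im r ^+ 2 = g^-1 ^+ 2.
    by rewrite /= expr0n addr0 sqrrN.
  pose kap j := r *: cF (l j h).
  have Skap j : S2 (kap j) by apply: (siZ I2); exact: ScF.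
  have kapw j k : S2 k -> sf (Q k) (kap j) = 0.
    by move=> Sk; rewrite (siZr I2 r (ScF _) (QS Sk)) wand ?mulr0.
  have SW := W2 Sh; have Sk0 := siZ I2 r SW.
  have rJ : r^* = r by rewrite conjC_conjc conjc_real.
  have Rer x : Re (r * x) = - g^-1 * Re x.
    by rewrite Re_mul -[Re r]/(- g^-1) -[complex.Im r]/(0 : R) mul0r subr0.
  have lr j x : S2 x -> ell j h (r *: x) = r * ell j h x.
    move=> Sx; have := ellr j r h x 0 Sh Sx (si0 I2).
    have := ellr j 1 h 0 0 Sh (si0 I2) (si0 I2).
    rewrite scaler0 addr0 rmorph1 mul1r => /eqP.
    rewrite addrC -subr_eq subrr eq_sym => /eqP ->.
    by rewrite !addr0 rJ.
  have sum_kap : \sum_(j < N) (g * nsq (kap j) + 2 * Re (ell j.+1 h (kap j))) =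
      - g^-1 * \sum_(j < N) Re (inner (l j h) (l j h)).
    rewrite mulr_sumr; apply: eq_bigr => j _.
    rewrite (nsqZ I2 r (ScF _)) rr cF_nsq (lr _ _ (ScF _)) Rer hl//.
    by move: (Re _) => a; field; rewrite gt_eqF.
  have := ellN N h _ kap Sh Sk0 Skap kapw; rewrite sum_kap.
  rewrite (nsqZ I2 r SW) rr /beta (siZr I2 r SW SW) rJ Rer.
  move: (\sum_(_ < _) _) (nsq h) (nsq (W h)) => s a b H.
  have : 0 <= g * (g * a + g * (g^-1 ^+ 2 * b) + 2 * (- g^-1 * b) + - g^-1 * s).
    by rewrite mulr_ge0// ltW.
  have -> : g * (g * a + g * (g^-1 ^+ 2 * b) + 2 * (- g^-1 * b) + - g^-1 * s) =
      g ^+ 2 * a - b - s by field; rewrite gt_eqF.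
  lra.
have /choice[u hu] : forall h, exists u, H2sum h -> [/\ H2 F u,
    forall n x, L2inner u (zmon n x) = inner (l n h) x &
    Re (L2inner u u) <= g ^+ 2 * nsq h - nsq (W h)].
  move=> h; have [Sh|Sh] := pselect (H2sum h); last by exists 0.
  by have [u hu] := @H2_synthesis _ _ sepF (l^~ h) _ (fun N => lC h N Sh); exists u.
have HW h : H2sum h -> H2 F (W h).2 by move=> Sh; exact: (W2 Sh).2.
have LfW h : H2sum h -> L2 F (flip (W h).2) by move=> /HW/H2_L2/(L2_flip sepF).
have Hu h : H2sum h -> H2 F (u h) by move=> /hu[].
pose G h := flip (W h).2 + u h.
have LG h : H2sum h -> L2 F (G h).
  by move=> Sh; apply: (siD LF); [exact: LfW|exact: H2_L2 (Hu h Sh)].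
have Gp h n x : H2sum h -> L2inner (G h) (zmon n x) = inner (l n h) x.
  move=> Sh; have [Hh uh _] := hu h Sh; have Lz := H2_zmon sepF n x.
  rewrite (siDl LF (LfW h Sh) (H2_L2 Hh) (H2_L2 Lz)) uh.
  by rewrite (flip_H2_orth sepF (HW h Sh) Lz) add0r.
have Gn h n x : H2sum h -> L2inner (G h) (zmonJ n.+1 x) = L2inner (W h).2 (zmon n x).
  move=> Sh; have [Hh uh _] := hu h Sh; have Lz := L2_zmonJ sepF n.+1 x.
  rewrite (siDl LF (LfW h Sh) (H2_L2 Hh) Lz) L2inner_zmonJ -L2inner_zmonJ.
  rewrite [X in _ + X]L2inner_zmonJ Hh.2// addr0.
  by rewrite (L2inner_flip sepF (H2_L2 (HW h Sh)) Lz) flip_zmonJ.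
exists G; split => //.
- move=> a h k Sh Sk; have Shk := siP I1 a Sh Sk.
  have LGh := LG h Sh; have LGk := LG k Sk.
  apply: (L2_ext sepF (LG _ Shk) (siP LF a LGh LGk)) => n x.
    rewrite (si_linear LF a LGh LGk (L2_zmon sepF n x)) !Gp// lP//.
    by rewrite (si_linear SF).
  rewrite (si_linear LF a LGh LGk (L2_zmonJ sepF n.+1 x)) !Gn//.
  have [Lh Lk] := (H2_L2 (HW h Sh), H2_L2 (HW k Sk)).
  have Lz := L2_zmon sepF n x.
  rewrite -(si_linear LF a Lh Lk Lz).
  apply: (L2inner_ae sepF (H2_L2 (HW _ Shk)) (siP LF a Lh Lk) Lz).
  exact: (bo_linear W_bounded a Sh Sk).2.
(* Coefficients are compared: [lS] for index at least 1, [l0] for index 0, and the second entry of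
   WY = XW for negative indices. *)
- move=> h Sh; have SY := opY_H2sum Sh.
  apply: (L2_ext sepF (LG _ SY) (L2_shift sepF (LG h Sh))) => n x.
    rewrite Gp// L2inner_shift; case: n => [|n].
      by rewrite l0// zmon0 -zmonJ0 shiftJ_zmonJ Gn// zmon0 zmonJ0.
    by rewrite shiftJ_zmon Gp// lS.
  rewrite Gn// L2inner_shift shiftJ_zmonJ Gn//.
  have Hz := H2_zmon sepF n x.
  have [Ha ha] := H2adjoint_shiftP sepF (HW h Sh).
  rewrite (L2inner_ae sepF (H2_L2 (HW _ SY)) (H2_L2 Ha) (H2_L2 Hz) (WY_XW Sh).2).
  rewrite (siC HF Hz Ha) -ha// shift_zmon -(siC HF)//; first exact: H2_zmon.
  exact: HW.
- move=> h Sh; have [Hh uh nu] := hu h Sh.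
  have Lf := LfW h Sh; rewrite (nsqD LF Lf (H2_L2 Hh)).
  rewrite (flip_H2_orth sepF (HW h Sh) Hh) (L2inner_flip sepF (H2_L2 (HW h Sh)) Lf) flipK.
  by move: nu; rewrite /pair_form ReD Re0 mulr0 addr0; lra.
Qed.

End intertwining_lift.

(** * Polynomial multiples and pointwise bounds *)

Section polynomial_multiple.
Variables (R : realType) (E : hilbertType R).
Hypothesis sepE : separable E.
Local Notation circ := (circle R).
Local Notation P := (haar R).
Local Notation Re := (@complex.Re R).
Local Notation SE := (semi_inner_hilbert E).
Implicit Types (f h : circ -> E) (p : {poly R[i]}).

Definition pmul p f : circ -> E := fun z => p.[sval z] *: f z.

Lemma pmul0 f : pmul 0 f = 0.
Proof. by apply/funext => z; rewrite /pmul horner0 scale0r. Qed.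

Lemma pmul_cons p (c : R[i]) f :
  pmul (p * 'X + c%:P) f = c *: f + Defs.shift (pmul p f).
Proof.
apply/funext => z; rewrite -[RHS]/(c *: f z + sval z *: (p.[sval z] *: f z)) /pmul.
by rewrite hornerD hornerMX hornerC scalerDl addrC scalerA [_ * sval z]mulrC.
Qed.

Lemma pmulXn n f : pmul 'X^n f = fun z => sval z ^+ n *: f z.
Proof. by apply/funext => z; rewrite /pmul hornerXn. Qed.

Lemma pmulXn_cst n (x : E) : pmul 'X^n (fun=> x) = zmon n x.
Proof. exact: pmulXn. Qed.

Lemma pmulD p f h : pmul p (f + h) = pmul p f + pmul p h.
Proof. by apply/funext => z; rewrite /pmul -[RHS]/(_ *: _ + _ *: _) -scalerDr. Qed.

Lemma aeeq_pmul p f h : aeeq f h -> aeeq (pmul p f) (pmul p h).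
Proof. by apply: filterS => z e; rewrite /pmul e. Qed.

Lemma H2_pmul p h : H2 E h -> H2 E (pmul p h).
Proof.
move=> Hh; elim/poly_ind: p => [|p c IH]; first by rewrite pmul0; exact: (si0 (semi_inner_H2 sepE)).
by rewrite pmul_cons; apply: (siP (semi_inner_H2 sepE)) => //; exact: H2_shift.
Qed.

Lemma L2_pmul p f : L2 E f -> L2 E (pmul p f).
Proof.
move=> Lf; elim/poly_ind: p => [|p c IH]; first by rewrite pmul0; exact: (si0 (semi_inner_L2 sepE)).
by rewrite pmul_cons; apply: (siP (semi_inner_L2 sepE)) => //; exact: L2_shift.
Qed.

Lemma Re_L2inner_pmul p f : Re (L2inner (pmul p f) (pmul p f)) =
  \int[P]_z (normsq p.[sval z] * Re (inner (f z) (f z))).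
Proof. by apply: eq_Rintegral => z _; rewrite (nsqZ SE). Qed.

Lemma L2_integrable f : L2 E f ->
  P.-integrable setT (EFin \o (fun z => Re (inner (f z) (f z)))).
Proof. by move=> Lf; have [] := cintegrable_inner sepE Lf Lf. Qed.

End polynomial_multiple.

Section pointwise_bound.
Variables (R : realType) (E F : hilbertType R).
Hypotheses (sepE : separable E) (sepF : separable F).
Local Notation circ := (circle R).
Local Notation P := (haar R).
Local Notation Re := (@complex.Re R).

(** Two functions are tested together because the bound wanted in the end is for both rows of a
    symbol jointly. *)
Lemma pmul_bound (u : circ -> E) (v : circ -> F) (c : R) : L2 E u -> L2 F v ->
  (forall p, Re (L2inner (pmul p u) (pmul p u)) + Re (L2inner (pmul p v) (pmul p v)) <=
    \int[P]_z (normsq p.[sval z] * c)) ->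
  {ae P, forall z, Re (inner (u z) (u z)) + Re (inner (v z) (v z)) <= c}.
Proof.
move=> Lu Lv hp; have iu := L2_integrable sepE Lu; have iv := L2_integrable sepF Lv.
have ic := integrable_cst (R := R) (- c).
have iuv := integrable_addr iu iv; have iw := integrable_addr iuv ic.
have : {ae P, forall z, Re (inner (u z) (u z)) + Re (inner (v z) (v z)) + - c <= 0}.
  apply: ae_le0_of_horner => // p.
  have i1 := integrable_horner_mul p iu; have i2 := integrable_horner_mul p iv.
  have i3 := integrable_horner_mul p (integrable_cst (R := R) c).
  under eq_Rintegral do rewrite mulrBr mulrDr.
  rewrite RintegralB//; last exact: integrable_addr.
  by rewrite RintegralD// subr_le0 -!Re_L2inner_pmul.
by apply: filterS => z; rewrite subr_le0.
Qed.

End pointwise_bound.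

Section intertwiner.
Variables (R : realType) (E F : hilbertType R).
Hypotheses (sepE : separable E) (sepF : separable F).
Local Notation circ := (circle R).
Local Notation P := (haar R).
Local Notation Re := (@complex.Re R).
Local Notation HE := (semi_inner_H2 sepE).
Local Notation LF := (semi_inner_L2 sepF).
Local Notation SF := (semi_inner_hilbert F).

Record intertwiner (g : R) (T : (circ -> E) -> circ -> F) : Prop := Intertwiner {
  it_L2 : forall h, H2 E h -> L2 F (T h) ;
  it_linear : forall a h k, H2 E h -> H2 E k ->
    aeeq (T (a *: h + k)) (a *: T h + T k) ;
  it_shift : forall h, H2 E h -> aeeq (T (Defs.shift h)) (Defs.shift (T h)) ;
  it_bound : forall h, H2 E h ->
    Re (L2inner (T h) (T h)) <= g ^+ 2 * Re (L2inner h h) }.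

(** The Riesz vector of phi is orthogonal to all monomials; this takes the place of approximation by
    polynomials. *)
Lemma H2_functional_null (phi : (circ -> E) -> R[i]) (M : R) :
  (forall a f h, H2 E f -> H2 E h -> phi (a *: f + h) = a * phi f + phi h) ->
  (forall f, H2 E f -> Re (phi f) ^+ 2 <= M * Re (L2inner f f)) ->
  (forall n x, phi (zmon n x) = 0) -> forall h, H2 E h -> phi h = 0.
Proof.
move=> phiP phiM phi0 h Hh; have [r Hr hr] := riesz_H2 sepE phiP phiM.
rewrite hr//; apply: (H2_orth sepE (H2_L2 Hr)) => // n x.
by rewrite -hr ?phi0//; exact: H2_zmon.
Qed.

Variables (g : R) (T : (circ -> E) -> circ -> F).
Hypothesis iT : intertwiner g T.

Lemma it0 : aeeq (T 0) 0.
Proof.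
have := it_linear iT 1 (si0 HE) (si0 HE).
rewrite scale1r addr0; apply: filterS => z.
rewrite -[X in _ = X]/(1 *: T 0 z + T 0 z) scale1r => /eqP.
by rewrite addrC -subr_eq subrr eq_sym => /eqP.
Qed.

Lemma it_pmul p h : H2 E h -> aeeq (T (pmul p h)) (pmul p (T h)).
Proof.
move=> Hh; elim/poly_ind: p => [|p c IH]; first by rewrite !pmul0; exact: it0.
have Hp := H2_pmul sepE p Hh.
rewrite !pmul_cons; apply: aeeq_trans (it_linear iT c Hh (H2_shift sepE Hp)) _.
apply: aeeqP; first exact: aeeq_refl.
by apply: aeeq_trans (it_shift iT Hp) _; exact: aeeq_shift.
Qed.

Lemma it_cst_bound x :
  {ae P, forall z, Re (inner (T (fun=> x) z) (T (fun=> x) z)) <= g ^+ 2 * Re (inner x x)}.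
Proof.
have Hx := H2_cst sepE x; have LT := it_L2 iT Hx.
have L0 : L2 F 0 := si0 LF.
have := @pmul_bound _ _ _ sepF sepF _ _ (g ^+ 2 * Re (inner x x)) LT L0.
have h p : Re (L2inner (pmul p (T (fun=> x))) (pmul p (T (fun=> x)))) +
    Re (L2inner (pmul p (0 : circ -> F)) (pmul p (0 : circ -> F))) <=
    \int[P]_z (normsq p.[sval z] * (g ^+ 2 * Re (inner x x))).
  have Hp := H2_pmul sepE p Hx; have LTp := it_L2 iT Hp; have Lp := L2_pmul sepF p LT.
  rewrite -(aeeq_nsq sepF LTp Lp (it_pmul p Hx)).
  rewrite (_ : pmul p 0 = 0); last by apply/funext => z; rewrite /pmul scaler0.
  rewrite (si0l LF L0) Re0 addr0; apply: le_trans (it_bound iT Hp) _.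
  have ip := integrable_horner_mul p (integrable_cst (R := R) (Re (inner x x))).
  rewrite Re_L2inner_pmul -RintegralZl// le_eqVlt; apply/orP; left; apply/eqP.
  by apply: eq_Rintegral => z _; rewrite mulrCA.
move/(_ h); apply: filterS => z; apply: le_trans.
by rewrite lerDl (si_ge0 SF).
Qed.

End intertwiner.

(** * Symbols of intertwiners *)

Section linear_extension.
Variables (R : realType) (E F : hilbertType R).
Local Notation Re := (@complex.Re R).
Local Notation SE := (semi_inner_hilbert E).
Local Notation SF := (semi_inner_hilbert F).
Local Notation nE x := (Re (@inner R E x x)).
Local Notation nF x := (Re (@inner R F x x)).

Lemma complex_dense_seq : exists b : nat -> R[i], forall a (e : R), 0 < e ->
  exists q, normsq (a - b q) < e.
Proof.
pose b k : R[i] := if unpickle k is Some (r, s) then (ratr r +i* ratr s)%C else 0.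
exists b => -[x y] e e0.
have s0 : 0 < Num.sqrt (e / 2) by rewrite sqrtr_gt0 divr_gt0.
have sE : Num.sqrt (e / 2) ^+ 2 = e / 2 by rewrite sqr_sqrtr// ltW ?divr_gt0.
move: (Num.sqrt _) s0 sE => s s0 sE.
have near (u : R) : exists r : rat, (u - ratr r) ^+ 2 < e / 2.
  have [r] := rat_in_itvoo (ltac:(by rewrite ltrDl) : u < u + s).
  rewrite in_itv /= => /andP[r1 r2]; exists r; rewrite -sE; nra.
have [[r hr] [t ht]] := (near x, near y).
by exists (pickle (r, t)); rewrite /b pickleK /normsq /=; lra.
Qed.

Variables (d : nat -> E) (t : nat -> F) (b : nat -> R[i]) (c : R).
Hypothesis dd : forall x (e : R), 0 < e -> exists n, nE (x - d n) < e.
Hypothesis db : forall a (e : R), 0 < e -> exists q, normsq (a - b q) < e.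
Hypothesis c0 : 0 <= c.
Hypothesis tB : forall p n, nF (t p - t n) <= c * nE (d p - d n).
Hypothesis tP : forall p n m q,
  nF (t p - (b q *: t n + t m)) <= c * nE (d p - (b q *: d n + d m)).

Let c4 : 0 <= 4 * c. Proof. by rewrite mulr_ge0. Qed.

(** The relation y = T x in terms of the countable data only. The factor 4 comes from two uses of |a
    + b|^2 <= 2|a|^2 + 2|b|^2; uniqueness of y would hold with any constant, by density. *)
Let graph x y := forall n, nF (y - t n) <= 4 * c * nE (x - d n).

Let dd_small (x : E) (M e : R) : 0 <= M -> 0 < e -> exists n, M * nE (x - d n) <= e.
Proof.
move=> M0 e0; have M1 : 0 < M + 1 by lra.
have [n hn] := dd x (divr_gt0 e0 M1); exists n.
rewrite ltr_pdivlMr// in hn; have := si_ge0 SE (x := x - d n) I.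
by move: (nE _) hn => u; nra.
Qed.

Let graph_unique x y y' : graph x y -> graph x y' -> y = y'.
Proof.
move=> h h'; apply/eqP; rewrite -subr_eq0 -(dnorm_eq0 (@inner R F)).
apply/eqP; rewrite (si_nsq SF)// (_ : Re _ = 0)//; apply/eqP; rewrite eq_le.
rewrite (si_ge0 SF)// andbT; apply/ler_addgt0Pr => e e0; rewrite add0r.
have [n hn] := dd_small x (ltac:(by rewrite mulr_ge0) : 0 <= 16 * c) e0.
have := nsq_triangle SF (x := y) (y := t n) (z := y') I I I.
rewrite (nsqBC SF (x := t n))//; have := h n; have := h' n; lra.
Qed.

Let graph_ex x : exists y, graph x y.
Proof.
have /choice[i hi] : forall k : nat, exists n, nE (x - d n) < k.+1%:R^-1.
  by move=> k; apply: dd; rewrite invr_gt0.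
have small (M e : R) : 0 <= M -> 0 < e -> exists N, forall k, (N <= k)%N ->
    M * nE (x - d (i k)) <= e.
  move=> M0 e0; exists (Num.truncn (M / e)) => k Nk.
  have q0 : 0 < (k.+1%:R : R) by [].
  have h : M / e < k.+1%:R.
    have := truncnS_gt (M / e); move/lt_le_trans; apply.
    by rewrite ler_nat ltnS.
  rewrite ltr_pdivrMr// in h.
  apply: (@le_trans _ _ (M * k.+1%:R^-1)); first by rewrite ler_wpM2l// ltW.
  by rewrite ler_pdivrMr// mulrC ltW.
have [|y _ hy] := si_complete_hilbert (u := fun k => t (i k)) (fun=> I).
  move=> e e0; have [N hN] := small (4 * c) e c4 e0.
  exists N => m n Nm Nn; apply: le_trans (tB _ _) _.
  have := nsq_triangle SE (x := d (i m)) (y := x) (z := d (i n)) I I I.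
  rewrite (nsqBC SE (x := d (i m)) (y := x))// => /(ler_wpM2l c0).
  by have := hN _ Nm; have := hN _ Nn; lra.
exists y => n; apply/ler_addgt0Pr => e e0.
have [N1 hN1] := hy (e / 4) (divr_gt0 e0 (ltr0Sn _ _)).
have [N2 hN2] := small (4 * c) (e / 2) c4 (divr_gt0 e0 (ltr0Sn _ _)).
pose k := maxn N1 N2; have := hN1 k (leq_maxl _ _); have := hN2 k (leq_maxr _ _).
have := nsq_triangle SF (x := y) (y := t (i k)) (z := t n) I I I.
rewrite (nsqBC SF (x := y) (y := t (i k)))//.
have := tB (i k) n.
have := nsq_triangle SE (x := d (i k)) (y := x) (z := d n) I I I.
rewrite (nsqBC SE (x := d (i k)) (y := x))// => /(ler_wpM2l c0); lra.
Qed.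

Let combB (V : hilbertType R) (a a' : R[i]) (x x' y y' : V) :
  Re (inner (a *: x + y - (a' *: x' + y')) (a *: x + y - (a' *: x' + y'))) <=
  4 * (normsq a' * Re (inner (x - x') (x - x'))) +
  4 * (normsq (a - a') * Re (inner x x)) + 2 * Re (inner (y - y') (y - y')).
Proof.
have SV := semi_inner_hilbert V.
have -> : a *: x + y - (a' *: x' + y') = (a' *: (x - x') + (a - a') *: x) + (y - y').
  rewrite opprD addrACA; congr (_ + _).
  by rewrite scalerBr scalerBl [RHS]addrC addrA subrK.
have := nsqD_le SV (x := a' *: (x - x') + (a - a') *: x) (y := y - y') I I.
have := nsqD_le SV (x := a' *: (x - x')) (y := (a - a') *: x) I I.
rewrite !(nsqZ SV)// -!/(normsq _); lra.
Qed.

Let graphP a x1 x2 y1 y2 : graph x1 y1 -> graph x2 y2 ->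
  graph (a *: x1 + x2) (a *: y1 + y2).
Proof.
move=> h1 h2 n; apply/ler_addgt0Pr => e e0.
(* The errors add up to (88 c + 8) s: 48 c + 8 from approximating y1, the scalar a and y2, and 40 c
   from [tP] combined with the bound 10 s of [g1]. *)
pose D : R := 88 * c + 8; have D0 : 0 < D by rewrite ltr_wpDl ?mulr_ge0.
pose s := e / D; have s0 : 0 < s by exact: divr_gt0.
have eD : e = D * s by rewrite /s mulrCA mulfV ?mulr1 ?gt_eqF.
have p1 := si_ge0 SE (x := x1) I; have p2 := si_ge0 SF (x := y1) I.
have q1 : 0 < nE x1 + nF y1 + 1 by lra.
have [q hq] := db a (divr_gt0 s0 q1); rewrite ltr_pdivlMr// in hq.
have [m hm] := dd_small x1 (normsq_ge0 (b q)) s0.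
have [k hk] := dd_small x2 ler01 s0; rewrite mul1r in hk.
have b0 := normsq_ge0 (b q); have ab0 := normsq_ge0 (a - b q).
have e1 := combB a (b q) x1 (d m) x2 (d k).
have e2 := combB a (b q) y1 (t m) y2 (t k).
have e3 := tP n m k q.
have e4 := nsq_triangle SF (x := a *: y1 + y2) (y := b q *: t m + t k) (z := t n) I I I.
have e5 := nsq_triangle SE (x := d n) (y := a *: x1 + x2) (z := b q *: d m + d k) I I I.
rewrite (nsqBC SF (x := b q *: t m + t k) (y := t n))// in e4.
rewrite (nsqBC SE (x := d n) (y := a *: x1 + x2))// in e5.
have := h1 m; have := h2 k => f2 f1.
have f3 : normsq (b q) * nF (y1 - t m) <= 4 * c * s.
  apply: le_trans (ler_wpM2l b0 f1) _; rewrite mulrCA.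
  exact: ler_wpM2l.
have f4 : normsq (a - b q) * nE x1 <= s.
  by apply: le_trans (ltW hq); apply: ler_wpM2l => //; rewrite -addrA lerDl addr_ge0.
have f5 : normsq (a - b q) * nF y1 <= s.
  by apply: le_trans (ltW hq); apply: ler_wpM2l => //; rewrite addrAC lerDr addr_ge0.
have f6 : nF (y2 - t k) <= 4 * c * s.
  by apply: le_trans f2 _; exact: ler_wpM2l.
have g1 : nE (a *: x1 + x2 - (b q *: d m + d k)) <= 10 * s.
  by clear e2 e3 e4 e5 f1 f2 f3 f5 f6 hq p1 p2 q1 b0 ab0 D0 eD s0; lra.
have g2 : c * nE (a *: x1 + x2 - (b q *: d m + d k)) <= c * (10 * s) by exact: ler_wpM2l.
have g3 := ler_wpM2l c0 e5.
by rewrite eD /D; clear e1 e5 f1 f2 f4 hm hk hq g1 p1 p2 q1 b0 ab0 D0 eD s0; lra.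
Qed.

(* The pairs [(d n, t n)] determine a bounded operator once the estimate holds for
   the combinations [b q *: d n + d m]; the constants are not optimal. *)
Theorem linear_extension : exists T : E -> F, [/\ linear T,
  forall x, nF (T x) <= 16 * c * nE x,
  forall x n, nF (T x - t n) <= 4 * c * nE (x - d n) &
  forall x y, (forall n, nF (y - t n) <= 4 * c * nE (x - d n)) -> T x = y].
Proof.
have /choice[T hT] := graph_ex.
have lT : linear T by move=> a x y; apply: graph_unique (hT _) (graphP _ (hT x) (hT y)).
have T0 : T 0 = 0.
  by have := lT 1 0 0; rewrite !scale1r addr0 => /eqP; rewrite -subr_eq subrr eq_sym => /eqP.
exists T; split => //; last by move=> x y; exact: graph_unique (hT x).
move=> x; apply/ler_addgt0Pr => e e0.
have [n hn] := dd_small x (ltac:(by rewrite mulr_ge0) : 0 <= 24 * c) e0.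
have := hT 0 n; rewrite T0 (nsqBC SF)// (nsqBC SE)// !subr0 => a1.
have := nsqD_le SF (x := T x - t n) (y := t n) I I; rewrite subrK.
have := nsqD_le SE (x := d n - x) (y := x) I I; rewrite subrK (nsqBC SE)//.
by move=> /(ler_wpM2l c0); have := hT x n; lra.
Qed.

End linear_extension.

(** * Operator norms and multiplication by bounded symbols *)

Section operator_norm.
Variables (R : realType) (X Y : Type) (nX : X -> R) (nY : Y -> R) (D : set X).
Hypothesis nX0 : forall x, 0 <= nX x.
Implicit Types T : X -> Y.

(** The infimum is attained: the slack e / (nX x + 1) costs at most e at x. *)
Lemma opnormP T (c : R) : 0 <= c ->
  (opnorm nX nY D T <= c%:E)%E <-> forall x, D x -> nY (T x) <= c * nX x.
Proof.
move=> c0; split=> [Tc x Dx|Tc]; last by apply: ereal_inf_lbound; exists c.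
apply/ler_addgt0Pr => e e0.
have n1 : 0 < nX x + 1 by rewrite ltr_wpDl.
have /ereal_inf_lt[_ [c' [c'0 hc'] <-]] : (opnorm nX nY D T < (c + e / (nX x + 1))%:E)%E.
  by apply: le_lt_trans Tc _; rewrite lte_fin ltrDl divr_gt0.
rewrite lte_fin => /ltW cc; apply: le_trans (hc' x Dx) _.
apply: le_trans (ler_wpM2r (nX0 x) cc) _; rewrite mulrDl lerD2l.
by rewrite -mulrA ler_piMr ?(ltW e0)// mulrC ler_pdivrMr// mul1r lerDl.
Qed.

Lemma opnorm_ge0 T : (0 <= opnorm nX nY D T)%E.
Proof. by apply: le_ereal_inf_tmp => _ [c [c0 _] <-]; rewrite lee_fin. Qed.

Lemma opnorm_bound T : (opnorm nX nY D T < +oo)%E -> exists2 c, 0 <= c &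
  opnorm nX nY D T = c%:E /\ forall x, D x -> nY (T x) <= c * nX x.
Proof.
move=> Too; have := opnorm_ge0 T; case e : (opnorm nX nY D T) Too => [c||]// _.
by rewrite lee_fin => c0; exists c => //; split => //; apply/opnormP; rewrite ?e.
Qed.

End operator_norm.

Section bounded_symbol.
Variables (R : realType) (E F : hilbertType R).
Hypotheses (sepE : separable E) (sepF : separable F).
Local Notation circ := (circle R).
Local Notation P := (haar R).
Local Notation Re := (@complex.Re R).
Local Notation SE := (semi_inner_hilbert E).
Local Notation SF := (semi_inner_hilbert F).
Implicit Types (Psi : circ -> E -> F) (h : circ -> E).

Lemma hnorm_le_sqr (x : E) (y : F) (c : R) : 0 <= c ->
  (hnorm y <= c * hnorm x) = (Re (inner y y) <= c ^+ 2 * Re (inner x x)).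
Proof.
move=> c0; rewrite -!hnorm_sqr -exprMn ler_sqr// nnegrE ?mulr_ge0//;
  exact: hnorm_ge0.
Qed.

Lemma haarT_gt0 : (0 < P setT)%E.
Proof. by rewrite probability_setT. Qed.

Lemma ess_sup_bound (f : circ -> \bar R) : (forall z, 0 <= f z)%E ->
  (ess_sup P f < +oo)%E -> exists2 c : R, 0 <= c &
  ess_sup P f = c%:E /\ {ae P, forall z, (f z <= c%:E)%E}.
Proof.
move=> f0 foo; have : (0 <= ess_sup P f)%E.
  by apply: ess_sup_gee; [exact: haarT_gt0|exact: aeW].
case e : (ess_sup P f) foo => [c||]// _; rewrite lee_fin => c0.
by exists c => //; split => //; rewrite -e; exact: ess_sup_ge.
Qed.

Lemma Linfty_bound Psi : Linfty E F Psi -> exists2 c : R, 0 <= c &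
  {ae P, forall z, forall x, Re (inner (Psi z x) (Psi z x)) <= c ^+ 2 * Re (inner x x)}.
Proof.
move=> [_ _ _ Poo]; have [|c c0 [_ hc]] := ess_sup_bound _ Poo.
  by move=> z; exact: opnorm_ge0.
exists c => //; apply: filterS hc => z zc x; rewrite -hnorm_le_sqr//.
by have /opnormP := zc; apply => //; exact: hnorm_ge0.
Qed.

(* Pointwise adjoints turn [z |-> <Psi z (h z), y>] into [z |-> <h z, k z>]
   with [k] weakly measurable. *)
Lemma wmeasurable_symbol Psi h : Linfty E F Psi -> wmeasurable h ->
  wmeasurable (fun z => Psi z (h z)).
Proof.
move=> [lP bP mP _] mh y.
have /choice[k hk] : forall z, exists k, forall x, inner (Psi z x) y = inner x k.
  move=> z; have [c c0 [_ hc]] := opnorm_bound (@hnorm_ge0 _ E) (bP z).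
  have [||k _ hk] := @riesz_representation _ _ _ _ SE (@si_complete_hilbert _ E)
      (fun x => inner (Psi z x) y) _ (Re (inner y y) * c ^+ 2).
  - by move=> a u v _ _; rewrite lP (si_linear SF).
  - move=> x _; apply: le_trans (si_CS SF (x := Psi z x) (y := y) I I) _.
    rewrite mulrC -mulrA; apply: ler_wpM2l; first exact: (si_ge0 SF).
    by rewrite -hnorm_le_sqr//; exact: hc.
  - by exists k => x; exact: hk.
have mk : wmeasurable k.
  move=> x; under eq_fun do rewrite (siC SE (x := x))// -hk.
  by apply: cmeasurable_conj; exact: mP.
by under eq_fun do rewrite hk; exact: (cmeasurable_inner sepE).
Qed.

Lemma L2_ae_le (f : circ -> F) h (c : R) : 0 <= c -> wmeasurable f -> L2 E h ->
  {ae P, forall z, Re (inner (f z) (f z)) <= c * Re (inner (h z) (h z))} ->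
  L2 F f /\ Re (L2inner f f) <= c * Re (L2inner h h).
Proof.
move=> c0 mf Lh fh; have [mh hi] := (L2E sepE h).1 Lh.
have mf2 := measurable_hnorm_sqr sepF mf; have mh2 := measurable_hnorm_sqr sepE mh.
have ci := integrable_mulr c hi.
have le : (\int[P]_z (hnorm (f z) ^+ 2)%:E <= \int[P]_z (c * hnorm (h z) ^+ 2)%:E)%E.
  apply: ae_ge0_le_integral => //.
  - by move=> z _; rewrite lee_fin sqr_ge0.
  - exact/measurable_EFinP.
  - by move=> z _; rewrite lee_fin mulr_ge0// sqr_ge0.
  - exact: measurable_int ci.
  - by apply: filterS fh => z zh _ /=; rewrite lee_fin !hnorm_sqr.
have ci_fin : (\int[P]_z (c * hnorm (h z) ^+ 2)%:E)%E \is a fin_num.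
  exact: integrable_fin_num.
have Lf : L2 F f by split => //; apply: le_lt_trans le _; rewrite ltey_eq ci_fin.
split => //; have [_ fi] := (L2E sepF f).1 Lf.
rewrite !Re_L2inner -RintegralZl//; apply: fine_le => //.
exact: integrable_fin_num.
Qed.

Definition smul Psi h : circ -> F := fun z => Psi z (h z).

Lemma smulP Psi a f h : (forall z, linear (Psi z)) ->
  smul Psi (a *: f + h) = a *: smul Psi f + smul Psi h.
Proof. by move=> lP; apply/funext => z; exact: lP. Qed.

Lemma smulZ Psi (u : circ -> R[i]) h : (forall z, linear (Psi z)) ->
  smul Psi (fun z => u z *: h z) = fun z => u z *: smul Psi h z.
Proof.
move=> lP; apply/funext => z; have := lP z (u z) (h z) 0; rewrite !addr0 => /= h0.
have := lP z 1 0 0; rewrite !scale1r addr0 => /eqP.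
by rewrite -subr_eq subrr eq_sym => /eqP P0; rewrite /smul h0 P0 addr0.
Qed.

Lemma smul0 Psi : (forall z, linear (Psi z)) -> smul Psi 0 = 0.
Proof.
move=> lP; rewrite (_ : 0 = fun z : circ => (0 : R[i]) *: (0 : E)); last first.
  by apply/funext => z; rewrite scale0r.
by rewrite (smulZ (fun=> 0) (fun=> 0))//; apply/funext => z; rewrite scale0r.
Qed.

Lemma smul_bound Psi : Linfty E F Psi -> exists c : R, forall h, L2 E h ->
  L2 F (smul Psi h) /\ Re (L2inner (smul Psi h) (smul Psi h)) <= c ^+ 2 * Re (L2inner h h).
Proof.
move=> LP; have [c _ hc] := Linfty_bound LP; exists c => h Lh.
have mh := ((L2E sepE h).1 Lh).1.
apply: (L2_ae_le (sqr_ge0 c) (wmeasurable_symbol LP mh) Lh).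
by apply: filterS hc => z; exact.
Qed.

Lemma L2_smul Psi h : Linfty E F Psi -> L2 E h -> L2 F (smul Psi h).
Proof. by move=> /smul_bound[c hc] /hc[]. Qed.

End bounded_symbol.

(** * The symbol of an intertwiner *)

Section symbol_of_intertwiner.
Variables (R : realType) (E F : hilbertType R).
Hypotheses (sepE : separable E) (sepF : separable F).
Local Notation circ := (circle R).
Local Notation P := (haar R).
Local Notation Re := (@complex.Re R).
Local Notation SE := (semi_inner_hilbert E).
Local Notation SF := (semi_inner_hilbert F).
Local Notation HE := (semi_inner_H2 sepE).
Local Notation LF := (semi_inner_L2 sepF).
Variables (g : R) (T : (circ -> E) -> circ -> F).
Hypothesis iT : intertwiner g T.

Let Tc x : circ -> F := T (fun=> x).

Let Tc_comb a x y : {ae P, forall z, Tc (a *: x + y) z = a *: Tc x z + Tc y z}.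
Proof. exact: (it_linear iT a (H2_cst sepE x) (H2_cst sepE y)). Qed.

Let Tc_sub x y : {ae P, forall z, Tc (x - y) z = Tc x z - Tc y z}.
Proof.
have := Tc_comb (-1) y x; rewrite scaleN1r addrC.
by apply: filterS => z ->; rewrite scaleN1r addrC.
Qed.

Let Tc_lipschitz x y : {ae P, forall z, Re (inner (Tc x z - Tc y z) (Tc x z - Tc y z)) <=
  g ^+ 2 * Re (inner (x - y) (x - y))}.
Proof. by apply: filterS2 (Tc_sub x y) (it_cst_bound sepE sepF iT (x - y)) => z <-. Qed.

(** [Linfty] asks for linearity and boundedness at every z, while T yields them off a null set
    depending on the vectors. Countably many instances hold off one null set [A]; on [A] the values
    at the dense sequence are replaced by 0, and [linear_extension] then applies at each z. *)
Lemma symbol_on_constants : exists2 Psi, Linfty E F Psi &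
  forall x, aeeq (fun z => Psi z x) (T (fun=> x)).
Proof.
have [d dd] := dense_seq sepE; have [b db] := complex_dense_seq R.
have : {ae P, forall z, forall p n,
    Re (inner (Tc (d p) z - Tc (d n) z) (Tc (d p) z - Tc (d n) z)) <=
    g ^+ 2 * Re (inner (d p - d n) (d p - d n))}.
  by apply/ae_foralln => p; apply/ae_foralln => n; exact: Tc_lipschitz.
have : {ae P, forall z, forall p n m q,
    let y := Tc (d p) z - (b q *: Tc (d n) z + Tc (d m) z) in
    let x := d p - (b q *: d n + d m) in
    Re (inner y y) <= g ^+ 2 * Re (inner x x)}.
  apply/ae_foralln => p; apply/ae_foralln => n; apply/ae_foralln => m.
  apply/ae_foralln => q; have := Tc_comb (b q) (d n) (d m).
  by apply: filterS2 (Tc_lipschitz (d p) (b q *: d n + d m)) => z + e; rewrite e.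
move=> h1 h2; have [A [mA A0 hA]] := filterI h1 h2.
pose t n z : F := (\1_(~` A) z : R)%:C%C *: Tc (d n) z.
have good z : ~ A z -> (forall n, t n z = Tc (d n) z) /\
    (forall p n, Re (inner (Tc (d p) z - Tc (d n) z) (Tc (d p) z - Tc (d n) z)) <=
      g ^+ 2 * Re (inner (d p - d n) (d p - d n))) /\
    forall p n m q,
    let y := Tc (d p) z - (b q *: Tc (d n) z + Tc (d m) z) in
    let x := d p - (b q *: d n + d m) in
    Re (inner y y) <= g ^+ 2 * Re (inner x x).
  move=> Az; split.
    by move=> n; rewrite /t indicE mem_set// scale1r.
  by have [] := contra_notP (hA z) Az.
have bad z : A z -> forall n, t n z = 0.
  by move=> Az n; rewrite /t indicE memNset ?scale0r//= => /(_ Az).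
have c0 := sqr_ge0 g.
have /choice[Psi hPsi] : forall z, exists Psi : E -> F, [/\ linear Psi,
    forall x, Re (inner (Psi x) (Psi x)) <= 16 * g ^+ 2 * Re (inner x x),
    forall x n, Re (inner (Psi x - t n z) (Psi x - t n z)) <=
      4 * g ^+ 2 * Re (inner (x - d n) (x - d n)) &
    forall x y, (forall n, Re (inner (y - t n z) (y - t n z)) <=
      4 * g ^+ 2 * Re (inner (x - d n) (x - d n))) -> Psi x = y].
  move=> z; apply: (linear_extension dd db c0).
    move=> p n; have [Az|/good[tE [h _]]] := pselect (A z); last by rewrite !tE.
    by rewrite !bad// subrr (si0l SF)// mulr_ge0// (si_ge0 SE).
  move=> p n m q; have [Az|/good[tE [_ h]]] := pselect (A z); last by rewrite !tE; exact: h.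
  by rewrite !bad// scaler0 addr0 subrr (si0l SF)// mulr_ge0// (si_ge0 SE).
have Psi_bound z x : hnorm (Psi z x) <= 4 * `|g| * hnorm x.
  rewrite hnorm_le_sqr ?mulr_ge0// exprMn real_normK ?num_real//.
  by rewrite -natrX; have [_] := hPsi z.
have Psi_opnorm z : (opnorm (@hnorm R E) (@hnorm R F) setT (Psi z) <= (4 * `|g|)%:E)%E.
  by apply/opnormP; rewrite ?mulr_ge0//; exact: hnorm_ge0.
exists Psi.
  split.
  - by move=> z; have [] := hPsi z.
  - by move=> z; apply: le_lt_trans (Psi_opnorm z) _; exact: ltry.
  (* For measurability: [Psi z x] is the pointwise limit of the t (i k) as d (i k) tends to x. *)
  - move=> x; have /choice[i hi] : forall k : nat, exists n,
        Re (inner (x - d n) (x - d n)) < k.+1%:R^-1.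
      by move=> k; apply: dd; rewrite invr_gt0.
    apply: (@wmeasurable_cvg _ _ (fun k z => t (i k) z)).
      move=> k; apply: wmeasurable_mul; last first.
        exact: (it_L2 iT (H2_cst sepE (d (i k)))).1.
      split => /=; last exact: measurable_cst.
      by apply: measurable_indic; exact: measurableC.
    move=> z e e0; exists (Num.truncn (4 * g ^+ 2 / e)) => k Nk.
    rewrite (nsqBC SF)//; have [_ _ h _] := hPsi z; apply: le_trans (h x (i k)) _.
    have {}h : 4 * g ^+ 2 / e < k.+1%:R.
      by have := truncnS_gt (4 * g ^+ 2 / e); move/lt_le_trans; apply; rewrite ler_nat ltnS.
    rewrite ltr_pdivrMr// in h.
    apply: (@le_trans _ _ (4 * g ^+ 2 * k.+1%:R^-1)); first by apply: ler_wpM2l; [rewrite mulr_ge0|exact: ltW (hi k)].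
    by rewrite ler_pdivrMr// [e * _]mulrC; exact: ltW.
  - apply: (@le_lt_trans _ _ (4 * `|g|)%:E); last exact: ltry.
    by apply/ess_supP; exact: aeW.
move=> x; have hx : {ae P, forall z, forall n,
    Re (inner (Tc x z - Tc (d n) z) (Tc x z - Tc (d n) z)) <=
    g ^+ 2 * Re (inner (x - d n) (x - d n))}.
  by apply/ae_foralln => n; exact: Tc_lipschitz.
have hA0 : {ae P, forall z, ~ A z}.
  by exists A; split => // z /=; exact: contrapT.
(* The Lipschitz estimates of T x against the dense sequence characterise [Psi z x]; the factor 4 is
   slack here. *)
apply: filterS2 hx hA0 => z zx /good[tE _]; have [_ _ _] := hPsi z; apply=> n.
rewrite tE; apply: le_trans (zx n) _; rewrite -mulrA ler_peMl//.
  by rewrite mulr_ge0// (si_ge0 SE).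
by rewrite ler1n.
Qed.

(** Agreement on constants passes to monomials because both sides commute with powers of z, and from
    monomials to [H2] because each Fourier coefficient of the difference is a bounded functional. *)
Theorem symbol_of_intertwiner : exists2 Psi, Linfty E F Psi &
  forall h, H2 E h -> aeeq (smul Psi h) (T h).
Proof.
have [Psi LP hP] := symbol_on_constants; exists Psi => // h Hh.
have lP z : linear (Psi z) by case: LP.
have [c hc] := smul_bound sepE sepF LP.
have LS f (Hf : H2 E f) := (hc f (H2_L2 Hf)).1.
have LT f (Hf : H2 E f) := it_L2 iT Hf.
have key k : L2 F k ->
    (forall n x, L2inner (T (zmon n x)) k = L2inner (smul Psi (zmon n x)) k) ->
    L2inner (smul Psi h) k = L2inner (T h) k.
  move=> Lk hk; apply/eqP; rewrite -subr_eq0; apply/eqP.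
  pose phi f := L2inner (smul Psi f) k - L2inner (T f) k.
  apply: (@H2_functional_null _ _ sepE phi
    (Re (L2inner k k) * (2 * c ^+ 2 + 2 * g ^+ 2))) => //.
  - move=> a f f' Hf Hf'; have Hff := siP HE a Hf Hf'; rewrite /phi.
    rewrite (L2inner_ae sepF (LT _ Hff) (siP LF a (LT _ Hf) (LT _ Hf')) Lk (it_linear iT a Hf Hf')).
    rewrite (si_linear LF a (LT _ Hf) (LT _ Hf') Lk) smulP//.
    by rewrite (si_linear LF a (LS _ Hf) (LS _ Hf') Lk); ring.
  - move=> f Hf; rewrite /phi -(siBl LF (LS _ Hf) (LT _ Hf) Lk).
    apply: le_trans (si_CS LF (siB LF (LS _ Hf) (LT _ Hf)) Lk) _.
    rewrite mulrC -mulrA; apply: ler_wpM2l; first exact: (si_ge0 LF).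
    have := nsq_triangle LF (LS _ Hf) (si0 LF) (LT _ Hf); rewrite !subr0 sub0r.
    rewrite (siNl LF (LT _ Hf) (siN LF (LT _ Hf))) (siNr LF (LT _ Hf) (LT _ Hf)) opprK.
    have := (hc f (H2_L2 Hf)).2; have := it_bound iT Hf; lra.
  - by move=> n x; rewrite /phi hk subrr.
have zm n x : aeeq (T (zmon n x)) (smul Psi (zmon n x)).
  rewrite -pmulXn_cst; apply: aeeq_trans (it_pmul sepE iT _ (H2_cst sepE x)) _.
  by rewrite smulZ//; apply: filterS (hP x) => z e; rewrite /pmul -e.
have zk k n x : L2 F k -> L2inner (T (zmon n x)) k = L2inner (smul Psi (zmon n x)) k.
  have Hz := H2_zmon sepE n x.
  by move=> Lk; exact: (L2inner_ae sepF (LT _ Hz) (LS _ Hz) Lk).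
apply: (L2_ext sepF (LS h Hh) (LT h Hh)) => n x; apply: key.
- exact: L2_zmon.
- by move=> m y; apply: zk; exact: L2_zmon.
- exact: L2_zmonJ.
- by move=> m y; apply: zk; exact: L2_zmonJ.
Qed.

End symbol_of_intertwiner.

Lemma aeeqD (R : realType) (E : hilbertType R) (f f' g g' : circle R -> E) :
  aeeq f f' -> aeeq g g' -> aeeq (f + g) (f' + g').
Proof. by move=> ff gg; have := aeeqP 1 ff gg; rewrite !scale1r. Qed.

(** * Analytic symbols and projections of flipped functions *)

Section analytic_symbol.
Variables (R : realType) (E F : hilbertType R).
Hypotheses (sepE : separable E) (sepF : separable F).
Local Notation circ := (circle R).
Local Notation Re := (@complex.Re R).
Local Notation SF := (semi_inner_hilbert F).
Local Notation LF := (semi_inner_L2 sepF).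
Implicit Types Psi : circ -> E -> F.

(** Each negative coefficient of Psi h is a bounded functional of h; on a monomial of degree m it is
    the coefficient of Psi at a constant, with index lower by m. *)
Lemma H2_smul Psi h : Hinfty E F Psi -> H2 E h -> H2 F (smul Psi h).
Proof.
move=> [LP P0] Hh; have lP z : linear (Psi z) by case: LP.
have [c hc] := smul_bound sepE sepF LP.
have LS f (Hf : H2 E f) := (hc f (H2_L2 Hf)).1.
split; first exact: LS.
move=> n x n0; rewrite -L2inner_zmonJ; have Lz := L2_zmonJ sepF n x.
pose phi f := L2inner (smul Psi f) (zmonJ n x).
apply: (@H2_functional_null _ _ sepE phi (Re (L2inner (zmonJ n x) (zmonJ n x)) * c ^+ 2)) => //.
- by move=> a f f' Hf Hf'; rewrite /phi smulP// (si_linear LF a (LS _ Hf) (LS _ Hf') Lz).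
- move=> f Hf; apply: le_trans (si_CS LF (LS _ Hf) Lz) _.
  rewrite mulrC -mulrA; apply: ler_wpM2l; first exact: (si_ge0 LF).
  exact: (hc f (H2_L2 Hf)).2.
- move=> m y; rewrite /phi L2inner_zmonJ smulZ//.
  rewrite -(P0 (n + m)%N y x) ?addn_gt0 ?n0//; congr cintegral; apply/funext => z.
  by rewrite (siZl SF)// mulrA -exprD.
Qed.

Lemma Hinfty_of_H2 Psi : Linfty E F Psi ->
  (forall x n y, L2inner (smul Psi (fun=> x)) (zmonJ n.+1 y) = 0) -> Hinfty E F Psi.
Proof. by move=> LP P0; split => // -[//|n] x y _; rewrite -(P0 x n y) L2inner_zmonJ. Qed.

(** P J f sees only the negative coefficients of f, reflected to the nonnegative side. *)
Lemma hardy_proj_flip (f g : circ -> F) : L2 F f -> H2 F g ->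
  (forall n x, L2inner f (zmonJ n.+1 x) = L2inner g (zmon n x)) ->
  aeeq (hardy_proj (flip f)) g.
Proof.
move=> Lf Hg fg; have Lff := L2_flip sepF Lf; have Lg := H2_L2 Hg.
have Ld := siB LF Lff Lg.
apply: (hardy_proj_unique sepF) => // h Hh; have Lh := H2_L2 Hh.
rewrite (siC LF Lh Ld) (H2_orth sepF Ld) ?rmorph0// => n x.
have Lz := L2_zmon sepF n x; rewrite (siC LF Ld Lz) (siBl LF Lff Lg Lz).
by rewrite (L2inner_flip sepF Lf Lz) flip_zmon fg subrr rmorph0.
Qed.

Lemma L2inner_hardy_proj_flip (f : circ -> F) n x : L2 F f ->
  L2inner (hardy_proj (flip f)) (zmon n x) = L2inner f (zmonJ n.+1 x).
Proof.
move=> Lf; have Lff := L2_flip sepF Lf; have [/H2_L2 Lp hp] := hardy_projP sepF Lff.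
have Hz := H2_zmon sepF n x; have Lz := H2_L2 Hz.
have := hp _ Hz; rewrite (siBl LF Lff Lp Lz) => /eqP; rewrite subr_eq0 => /eqP <-.
by rewrite (L2inner_flip sepF Lf Lz) flip_zmon.
Qed.

End analytic_symbol.

(** * Operators on pairs and the symbol of [W] *)

Section pair_intertwiner.
Variables (R : realType) (E F K : hilbertType R).
Hypotheses (sepE : separable E) (sepF : separable F).
Local Notation circ := (circle R).
Local Notation Re := (@complex.Re R).
Local Notation pairs := ((circ -> E) * (circ -> F))%type.
Local Notation HE := (semi_inner_H2 sepE).
Local Notation HF := (semi_inner_H2 sepF).
Local Notation sf := (pair_form (@L2inner R E) (@L2inner R F)).

(** Covers both rows of the lifted operator, [(W h).1] and [G h]; restricting each to one slot of
    the pair produces the four entries of the symbol. *)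
Record pair_intertwiner (g : R) (S : pairs -> circ -> K) : Prop := PairIntertwiner {
  pit_L2 : forall h, H2sum h -> L2 K (S h) ;
  pit_linear : forall a h k, H2sum h -> H2sum k ->
    aeeq (S (a *: h + k)) (a *: S h + S k) ;
  pit_shift : forall h, H2sum h -> aeeq (S (@opY R E F h)) (Defs.shift (S h)) ;
  pit_bound : forall h, H2sum h -> Re (L2inner (S h) (S h)) <= g ^+ 2 * Re (sf h h) }.

Variables (g : R) (S : pairs -> circ -> K).
Hypothesis iS : pair_intertwiner g S.

Lemma H2sum_left h : H2 E h -> H2sum (h, 0 : circ -> F).
Proof. by split => //; exact: (si0 HF). Qed.

Lemma H2sum_right h : H2 F h -> H2sum (0 : circ -> E, h).
Proof. by split => //; exact: (si0 HE). Qed.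

Lemma shift0 (V : hilbertType R) : Defs.shift (0 : circ -> V) = 0.
Proof. by apply/funext => z; rewrite /Defs.shift scaler0. Qed.

Lemma pit_left : intertwiner g (fun h => S (h, 0)).
Proof.
split.
- by move=> h /H2sum_left; exact: (pit_L2 iS).
- move=> a h k Hh Hk; have := pit_linear iS a (H2sum_left Hh) (H2sum_left Hk).
  by rewrite (_ : a *: (h, 0) + (k, 0) = (a *: h + k, 0))//; congr pair; rewrite /= scaler0 addr0.
- by move=> h /H2sum_left/(pit_shift iS); rewrite /opY /= shift0.
- move=> h /H2sum_left/(pit_bound iS); rewrite /pair_form.
  by rewrite (_ : L2inner (h, 0).2 _ = 0) ?addr0//; exact: (si0l HF (si0 HF)).
Qed.

Lemma pit_right : intertwiner g (fun h => S (0, h)).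
Proof.
split.
- by move=> h /H2sum_right; exact: (pit_L2 iS).
- move=> a h k Hh Hk; have := pit_linear iS a (H2sum_right Hh) (H2sum_right Hk).
  by rewrite (_ : a *: (0, h) + (0, k) = (0, a *: h + k))//; congr pair; rewrite /= scaler0 addr0.
- by move=> h /H2sum_right/(pit_shift iS); rewrite /opY /= shift0.
- move=> h /H2sum_right/(pit_bound iS); rewrite /pair_form.
  by rewrite (_ : L2inner (0, h).1 _ = 0) ?add0r//; exact: (si0l HE (si0 HE)).
Qed.

Lemma pit_split h k : H2 E h -> H2 F k -> aeeq (S (h, k)) (S (h, 0) + S (0, k)).
Proof.
move=> Hh Hk; have := pit_linear iS 1 (H2sum_left Hh) (H2sum_right Hk).
by rewrite !scale1r (_ : (h, 0) + (0, k) = (h, k))//; congr pair; rewrite /= ?addr0 ?add0r.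
Qed.

Lemma pit_pmul p h k : H2 E h -> H2 F k ->
  aeeq (S (pmul p h, pmul p k)) (pmul p (S (h, k))).
Proof.
move=> Hh Hk; apply: aeeq_trans (pit_split (H2_pmul sepE p Hh) (H2_pmul sepF p Hk)) _.
have := aeeq_pmul p (pit_split Hh Hk); rewrite pmulD => /aeeq_sym; apply: aeeq_trans.
have := it_pmul sepF pit_right p Hk; have := it_pmul sepE pit_left p Hh.
by apply: filterS2 => z e1 e2; rewrite -[LHS]/(_ + _) e1 e2.
Qed.

End pair_intertwiner.

Section operator_symbol.
Variables (R : realType) (E F : hilbertType R).
Hypotheses (sepE : separable E) (sepF : separable F).
Local Notation circ := (circle R).
Local Notation P := (haar R).
Local Notation Re := (@complex.Re R).
Local Notation pairs := ((circ -> E) * (circ -> F))%type.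
Local Notation HE := (semi_inner_H2 sepE).
Local Notation HF := (semi_inner_H2 sepF).
Local Notation LF := (semi_inner_L2 sepF).
Implicit Types (Phi : symbol E F).

Definition upper_row Phi h : circ -> E := smul (symA Phi) h.1 + smul (symB Phi) h.2.
Definition lower_row_fun Phi h : circ -> F := smul (symC Phi) h.1 + smul (symD Phi) h.2.

Lemma H2_upper_row Phi h : Gamma_infty Phi -> H2sum h -> H2 E (upper_row Phi h).
Proof. by move=> [A B _ _] [h1 h2]; apply: (siD HE); exact: H2_smul. Qed.

Lemma L2_lower_row Phi h : Gamma_infty Phi -> H2sum h -> L2 F (lower_row_fun Phi h).
Proof.
by move=> [_ _ C D] [/H2_L2 h1 /H2_L2 h2]; apply: (siD LF); exact: L2_smul.
Qed.

Lemma opV_H2sum Phi h : Gamma_infty Phi -> H2sum h -> H2sum (opV Phi h).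
Proof.
move=> [[A _] [B _] C D] [/H2_L2 h1 /H2_L2 h2].
by split; [apply: (siD HE)|apply: (siD HF)]; apply: (proj1 (hardy_projP _ _)) => //;
  rewrite -/(smul _ _); do ?[apply: L2_flip => //]; exact: L2_smul.
Qed.

Lemma opV_upper Phi h : Gamma_infty Phi -> H2sum h ->
  aeeq (opV Phi h).1 (upper_row Phi h).
Proof.
move=> [A B _ _] [h1 h2].
have HA := H2_smul sepE sepE A h1; have HB := H2_smul sepF sepE B h2.
by apply: aeeqD; exact: hardy_proj_H2.
Qed.

Lemma opV_lower Phi h n x : Gamma_infty Phi -> H2sum h ->
  L2inner (opV Phi h).2 (zmon n x) = L2inner (lower_row_fun Phi h) (zmonJ n.+1 x).
Proof.
move=> [_ _ C D] [/H2_L2 h1 /H2_L2 h2].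
have LC := L2_smul sepE sepF C h1; have LD := L2_smul sepF sepF D h2.
have HC := (hardy_projP sepF (L2_flip sepF LC)).1.
have HD := (hardy_projP sepF (L2_flip sepF LD)).1.
rewrite (siDl HF HC HD (H2_zmon sepF n x)) (siDl LF LC LD (L2_zmonJ sepF n.+1 x)).
by rewrite !L2inner_hardy_proj_flip.
Qed.

(** The bound concerns both rows jointly but one constant pair (e, f) at a time, so its exceptional
    null set still depends on the pair. *)
Theorem operator_symbol (W : pairs -> pairs) (g : R) :
  bounded_operator W -> operator_eq (W \o @opY R E F) (@opX R E F \o W) ->
  (H2sum_opnorm W < g%:E)%E ->
  exists Phi, [/\ Gamma_infty Phi, operator_eq W (opV Phi) & forall e f,
    {ae P, forall z, let p := symbol_fun Phi z (e, f) in
      Re (inner p.1 p.1) + Re (inner p.2 p.2) <=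
      g ^+ 2 * (Re (inner e e) + Re (inner f f))}].
Proof.
move=> bW WYX Wg; have [G [LG lG sG nG coefG]] := intertwining_lift sepE sepF bW WYX Wg.
have HW h (Sh : H2sum h) := bo_stable bW Sh.
have iW : pair_intertwiner g (fun h => (W h).1).
  split.
  - by move=> h /HW[/H2_L2].
  - by move=> a h k Sh Sk; exact: (bo_linear bW a Sh Sk).1.
  - by move=> h Sh; exact: (WYX h Sh).1.
  - by move=> h Sh; apply: le_trans (nG h Sh); rewrite lerDl Re_L2inner_ge0.
have iG : pair_intertwiner g G.
  split => //.
  by move=> h Sh; apply: le_trans (nG h Sh); rewrite lerDr Re_L2inner_ge0.
have [A LA hA] := symbol_of_intertwiner sepE sepE (pit_left sepF iW).
have [B LB hB] := symbol_of_intertwiner sepF sepE (pit_right sepE iW).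
have [C LC hC] := symbol_of_intertwiner sepE sepF (pit_left sepF iG).
have [D LD hD] := symbol_of_intertwiner sepF sepF (pit_right sepE iG).
pose Phi := Symbol A B C D.
have Hc (V : hilbertType R) sepV := @H2_cst R V sepV.
have GPhi : Gamma_infty Phi.
  split => //.
    (* Analyticity of A and B comes from [(W h).1] lying in [H2] for constant h. *)
    apply: (Hinfty_of_H2 LA) => x n y; have Hx := Hc E sepE x.
    have HWx := (HW _ (H2sum_left sepF Hx)).1.
    rewrite (L2inner_ae sepE (L2_smul sepE sepE LA (H2_L2 Hx)) (H2_L2 HWx) (L2_zmonJ sepE n.+1 y) (hA _ Hx)).
    by rewrite L2inner_zmonJ HWx.2.
  apply: (Hinfty_of_H2 LB) => x n y; have Hx := Hc F sepF x.
  have HWx := (HW _ (H2sum_right sepE Hx)).1.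
  rewrite (L2inner_ae sepE (L2_smul sepF sepE LB (H2_L2 Hx)) (H2_L2 HWx) (L2_zmonJ sepE n.+1 y) (hB _ Hx)).
  by rewrite L2inner_zmonJ HWx.2.
have upper h : H2sum h -> aeeq (W h).1 (upper_row Phi h).
  case: h => h k [/= Hh Hk]; apply: aeeq_trans (pit_split sepE sepF iW Hh Hk) _.
  by apply: aeeqD; apply: aeeq_sym; [exact: hA|exact: hB].
have lower h : H2sum h -> aeeq (G h) (lower_row_fun Phi h).
  case: h => h k [/= Hh Hk]; apply: aeeq_trans (pit_split sepE sepF iG Hh Hk) _.
  by apply: aeeqD; apply: aeeq_sym; [exact: hC|exact: hD].
exists Phi; split => //.
- move=> h Sh; split; first exact: aeeq_trans (upper h Sh) (aeeq_sym (opV_upper GPhi Sh)).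
  apply: (H2_ext sepF (HW h Sh).2 (opV_H2sum GPhi Sh).2) => n x.
  rewrite opV_lower// -coefG//.
  by rewrite (L2inner_ae sepF (LG h Sh) (L2_lower_row GPhi Sh) (L2_zmonJ sepF n.+1 x) (lower h Sh)).
- move=> e f; pose h : pairs := (fun=> e, fun=> f).
  have He := Hc E sepE e; have Hf := Hc F sepF f.
  have Sh : H2sum h by split.
  have := @pmul_bound _ _ _ sepE sepF _ _ (g ^+ 2 * (Re (inner e e) + Re (inner f f)))
    (H2_L2 (HW h Sh).1) (LG h Sh).
  (* The bound of the lift at p times the constant pair, where p factors out of both rows. *)
  have hp p : Re (L2inner (pmul p (W h).1) (pmul p (W h).1)) +
      Re (L2inner (pmul p (G h)) (pmul p (G h))) <=
      \int[P]_z (normsq p.[sval z] * (g ^+ 2 * (Re (inner e e) + Re (inner f f)))).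
    have Sp : H2sum (pmul p (fun=> e), pmul p (fun=> f)) by split; exact: H2_pmul.
    have := nG _ Sp.
    rewrite (aeeq_nsq sepE (H2_L2 (HW _ Sp).1) _ (pit_pmul sepE sepF iW p He Hf)); last first.
      by apply: L2_pmul => //; exact: H2_L2 (HW h Sh).1.
    rewrite (aeeq_nsq sepF (LG _ Sp) _ (pit_pmul sepE sepF iG p He Hf)); last first.
      by apply: L2_pmul => //; exact: LG.
    move/le_trans; apply; rewrite /pair_form ReD !Re_L2inner_pmul.
    have ic (c : R) := integrable_horner_mul p (integrable_cst (R := R) c).
    rewrite -RintegralD// -RintegralZl//; last exact: integrable_addr.
    rewrite le_eqVlt; apply/orP; left; apply/eqP.
    by apply: eq_Rintegral => z _; rewrite -mulrDr mulrCA.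
  move/(_ hp); have := lower h Sh; have := upper h Sh.
  by apply: filterS3 => z -> ->.
Qed.

End operator_symbol.

(** * Norm formula *)

Section dense_bound.
Variables (R : realType) (V2 : lmodType R[i]).
Variable B2 : V2 -> V2 -> R[i].
Hypothesis I2 : semi_inner setT B2.
Local Notation Re := (@complex.Re R).
Local Notation nsq2 x := (Re (B2 x x)).

(** Comes from |t x - y|^2 >= 0 divided by t. For small t the factor of |x|^2 is close to 1, so
    sharp constants survive, unlike with the factor 2 of [nsqD_le]. *)
Lemma nsqD_weighted x y (t : R) : 0 < t ->
  nsq2 (x + y) <= (1 + t) * nsq2 x + (1 + t^-1) * nsq2 y.
Proof.
move=> t0; have := si_ge0 I2 (x := t%:C%C *: x - y) I.
rewrite (nsqB I2)// (nsqD I2)// (nsqZ I2)// (siZl I2)// Re_mul /=.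
rewrite expr0n addr0 mul0r subr0 => h.
have : 0 <= t^-1 * (t ^+ 2 * nsq2 x + nsq2 y - 2 * (t * Re (B2 x y))).
  by rewrite mulr_ge0// invr_ge0 ltW.
have -> : t^-1 * (t ^+ 2 * nsq2 x + nsq2 y - 2 * (t * Re (B2 x y))) =
    t * nsq2 x + t^-1 * nsq2 y - 2 * Re (B2 x y) by field; rewrite gt_eqF.
by move: (nsq2 x) (nsq2 y) (Re _) => *; lra.
Qed.

End dense_bound.

(** The crude bound M only multiplies the error of approximation by [D]. This error is made small
    for fixed t, and t afterwards, which preserves the constant c. *)
Lemma dense_bound (R : realType) (V1 V2 : lmodType R[i])
    (B1 : V1 -> V1 -> R[i]) (B2 : V2 -> V2 -> R[i]) (T : V1 -> V2) (D : set V1) (c M : R) :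
  semi_inner setT B1 -> semi_inner setT B2 ->
  (forall x y, T (x + y) = T x + T y) ->
  0 <= c -> 0 <= M ->
  (forall x, complex.Re (B2 (T x) (T x)) <= M * complex.Re (B1 x x)) ->
  (forall x (e : R), 0 < e -> exists2 d, D d & complex.Re (B1 (x - d) (x - d)) <= e) ->
  (forall d, D d -> complex.Re (B2 (T d) (T d)) <= c * complex.Re (B1 d d)) ->
  forall x, complex.Re (B2 (T x) (T x)) <= c * complex.Re (B1 x x).
Proof.
move=> I1 I2 TD c0 M0 TM DD Dc x.
set X := complex.Re (B1 x x); have X0 : 0 <= X := si_ge0 I1 (x := x) I.
set Y := complex.Re (B2 _ _).
have step (t : R) : 0 < t -> Y <= (1 + t) ^+ 2 * (c * X).
  move=> t0; have ti : 0 < t^-1 by rewrite invr_gt0.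
  (* The total coefficient of |x - d|^2 in the two weighted inequalities. *)
  pose K := (1 + t) * c * (1 + t^-1) + (1 + t^-1) * M.
  have K0 : 0 <= K by rewrite addr_ge0 ?mulr_ge0 ?addr_ge0// ltW.
  apply/ler_addgt0Pr => e e0; have K1 : 0 < K + 1 by rewrite ltr_wpDl.
  have [d Dd hd] := DD x _ (divr_gt0 e0 K1).
  have Kd : K * complex.Re (B1 (x - d) (x - d)) <= e.
    have p := si_ge0 I1 (x := x - d) I; rewrite ler_pdivlMr// in hd.
    by apply: le_trans hd; rewrite mulrC ler_wpM2l// lerDl.
  have := nsqD_weighted I2 (T d) (T (x - d)) t0; rewrite -TD addrC subrK -/Y.
  have := nsqD_weighted I1 x (d - x) t0; rewrite addrC subrK (nsqBC I1)// -/X.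
  have := Dc d Dd; have := TM (x - d).
  move: (complex.Re (B1 d d)) (complex.Re (B2 (T d) _)) (complex.Re (B2 _ _)) Kd.
  move: (complex.Re _) => u v w s; rewrite /K => Kd h1 h2 h3 h4.
  have t1 : 0 <= 1 + t by rewrite addr_ge0// ltW.
  have ti1 : 0 <= 1 + t^-1 by rewrite addr_ge0// ltW.
  have h1' := ler_wpM2l ti1 h1.
  have h2' := ler_wpM2l t1 h2.
  have h3' := ler_wpM2l (mulr_ge0 t1 c0) h3.
  by lra.
apply/ler_addgt0Pr => e e0; have cX := mulr_ge0 c0 X0.
(* For t <= 1 one has (1 + t)^2 <= 1 + 3 t, whence the 3. *)
pose t := Num.min 1 (e / (3 * (c * X + 1))).
have t0 : 0 < t by rewrite lt_min ltr01 divr_gt0// mulr_gt0// ltr_wpDl.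
have t1 : t <= 1 by rewrite ge_min lexx.
have te : t * (3 * (c * X + 1)) <= e.
  by rewrite -ler_pdivlMr ?mulr_gt0 ?ltr_wpDl// ge_min lexx orbT.
apply: le_trans (step t t0) _; move: (c * X) cX te => s s0 te.
have : t * t <= t by rewrite ler_piMr// ltW.
have : 0 <= t by exact: ltW.
move: t0 t1 te => _ t1 te t0 tt; nra.
Qed.

Section Linfty_closure.
Variables (R : realType) (E F : hilbertType R).
Local Notation circ := (circle R).
Local Notation Re := (@complex.Re R).
Local Notation SF := (semi_inner_hilbert F).

Lemma LinftyB (Psi Psi' : circ -> E -> F) : Linfty E F Psi -> Linfty E F Psi' ->
  Linfty E F (fun z x => Psi z x - Psi' z x).
Proof.
move=> LP LP'; have [l1 b1 m1 _] := LP; have [l2 b2 m2 _] := LP'.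
have [c c0 hc] := Linfty_bound LP; have [c' c'0 hc'] := Linfty_bound LP'.
have sub z (a a' : R) : 0 <= a -> 0 <= a' ->
    (forall x, hnorm (Psi z x) <= a * hnorm x) ->
    (forall x, hnorm (Psi' z x) <= a' * hnorm x) ->
    (opnorm (@hnorm R E) (@hnorm R F) setT (fun x => (Psi z x - Psi' z x)%R) <=
      (a + a')%:E)%E.
  move=> a0 a'0 ha ha'; apply/opnormP; rewrite ?addr_ge0//; first exact: hnorm_ge0.
  move=> x _; apply: le_trans (hnorm_triangle _ _) _; rewrite hnormN mulrDl.
  by apply: lerD.
split.
- by move=> z a x y; rewrite l1 l2 scalerBr opprD addrACA.
- move=> z; have [a a0 [_ ha]] := opnorm_bound (@hnorm_ge0 _ E) (b1 z).
  have [a' a'0 [_ ha']] := opnorm_bound (@hnorm_ge0 _ E) (b2 z).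
  apply: le_lt_trans (sub z a a' a0 a'0 _ _) (ltry _) => x; [exact: ha|exact: ha'].
- move=> x y; under eq_fun do rewrite (siBl SF)// -mulN1r.
  by apply: cmeasurableD => //; apply: cmeasurableM => //; exact: cmeasurable_cst.
- apply: (@le_lt_trans _ _ (c + c')%:E); last exact: ltry.
  apply/ess_supP; apply: filterS2 hc hc' => z hz hz'.
  by apply: sub => // x; rewrite hnorm_le_sqr.
Qed.

End Linfty_closure.

Lemma Rintegral_ae_le (R : realType) (u v : circle R -> R) :
  (haar R).-integrable setT (EFin \o u) -> (haar R).-integrable setT (EFin \o v) ->
  (forall z, 0 <= u z) -> (forall z, 0 <= v z) -> {ae haar R, forall z, u z <= v z} ->
  \int[haar R]_z u z <= \int[haar R]_z v z.
Proof.
move=> iu iv u0 v0 uv; apply: fine_le; try exact: integrable_fin_num.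
apply: ae_ge0_le_integral => //.
- by move=> z _; rewrite lee_fin.
- exact: measurable_int iu.
- by move=> z _; rewrite lee_fin.
- exact: measurable_int iv.
- by apply: filterS uv => z h _; rewrite lee_fin.
Qed.

(** * The two inequalities of the norm formula *)

Section norm_formula.
Variables (R : realType) (E F : hilbertType R).
Hypotheses (sepE : separable E) (sepF : separable F).
Local Notation circ := (circle R).
Local Notation P := (haar R).
Local Notation Re := (@complex.Re R).
Local Notation pairs := ((circ -> E) * (circ -> F))%type.
Local Notation SE := (semi_inner_hilbert E).
Local Notation SF := (semi_inner_hilbert F).
Local Notation HF := (semi_inner_H2 sepF).
Local Notation LF := (semi_inner_L2 sepF).
Local Notation EFform := (pair_form (@inner R E) (@inner R F)).
Local Notation EFnorm := (sum_norm (@hnorm R E) (@hnorm R F)).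
Implicit Types (Phi : symbol E F).

Lemma EFnorm_sqr p : EFnorm p ^+ 2 = Re (EFform p p).
Proof. by rewrite sqr_sqrtr ?addr_ge0 ?sqr_ge0// !hnorm_sqr -ReD. Qed.

Lemma EFnorm_ge0 p : 0 <= EFnorm p. Proof. exact: sqrtr_ge0. Qed.

Lemma EFnorm_le p q (c : R) : 0 <= c ->
  (EFnorm p <= c * EFnorm q) = (Re (EFform p p) <= c ^+ 2 * Re (EFform q q)).
Proof.
move=> c0; rewrite -!EFnorm_sqr -exprMn ler_sqr// nnegrE ?mulr_ge0//; exact: EFnorm_ge0.
Qed.

(** Subtracting an analytic lower row leaves the operator unchanged. The pointwise bound is then
    integrated, [flip] being isometric and [hardy_proj] contractive. *)
Lemma H2sum_opnorm_le Phi (M1 : circ -> E -> F) (M2 : circ -> F -> F) :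
  Gamma_infty Phi -> Hinfty E F M1 -> Hinfty F F M2 ->
  (H2sum_opnorm (opV Phi) <= Linfty_norm (fun z p =>
    symbol_fun Phi z p - symbol_fun (lower_row M1 M2) z p)%R)%E.
Proof.
move=> GP hL1 hL2; rewrite /Linfty_norm; set N := (X in ess_sup _ X).
have N0 z : (0 <= N z)%E by exact: opnorm_ge0.
have [->|Noo] := eqVneq (ess_sup P N) +oo%E; first exact: leey.
have [|c c0 [-> hc]] := ess_sup_bound N0; first by rewrite ltey.
apply/opnormP => // [p|h Sh]; first exact: sum_norm_ge0.
have [Hh1 Hh2] := Sh; have [Lh1 Lh2] := (H2_L2 Hh1, H2_L2 Hh2).
rewrite sum_norm_le//.
pose l : circ -> F := smul M1 h.1 + smul M2 h.2.
have Hl : H2 F l by apply: (siD HF); exact: H2_smul.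
pose f := lower_row_fun Phi h - l.
have Lr := L2_lower_row sepE sepF GP Sh; have Lf : L2 F f := siB LF Lr (H2_L2 Hl).
have Hu := H2_upper_row sepE sepF GP Sh.
have HV := opV_H2sum sepE sepF GP Sh.
have fV : aeeq (hardy_proj (flip f)) (opV Phi h).2.
  apply: (hardy_proj_flip sepF Lf HV.2) => n x; have Lz := L2_zmonJ sepF n.+1 x.
  rewrite (siBl LF Lr (H2_L2 Hl) Lz) opV_lower//.
  by rewrite [X in _ - X]L2inner_zmonJ Hl.2// subr0.
have Lff := L2_flip sepF Lf.
rewrite /pair_form !ReD (aeeq_nsq sepE (H2_L2 HV.1) (H2_L2 Hu) (opV_upper sepE sepF GP Sh)).
rewrite -(aeeq_nsq sepF (H2_L2 (hardy_projP sepF Lff).1) (H2_L2 HV.2) fV).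
apply: (@le_trans _ _ (Re (L2inner (upper_row Phi h) (upper_row Phi h)) + Re (L2inner f f))).
  rewrite lerD2l; apply: le_trans (hardy_proj_contract sepF Lff) _.
  by rewrite (L2inner_flip sepF Lf Lff) flipK.
have i1 := L2_integrable sepE (H2_L2 Hu); have i2 := L2_integrable sepF Lf.
have i3 := L2_integrable sepE Lh1; have i4 := L2_integrable sepF Lh2.
have i34 := integrable_addr i3 i4.
rewrite -(RintegralD measurableT i1 i2) -(RintegralD measurableT i3 i4) -RintegralZl//.
apply: Rintegral_ae_le.
- exact: integrable_addr.
- exact: integrable_mulr.
- by move=> z; rewrite addr_ge0// ?(si_ge0 SE) ?(si_ge0 SF).
- by move=> z; rewrite mulr_ge0 ?sqr_ge0// addr_ge0// ?(si_ge0 SE) ?(si_ge0 SF).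
- apply: filterS hc => z hz.
  have := (opnormP _ _ EFnorm_ge0 _ c0).1 hz (h.1 z, h.2 z) I.
  rewrite EFnorm_le// /pair_form !ReD /= addr0 subr0; exact.
Qed.

Lemma H2sum_opnorm_eq (W W' : pairs -> pairs) :
  (forall h, H2sum h -> H2sum (W h)) -> (forall h, H2sum h -> H2sum (W' h)) ->
  operator_eq W W' -> H2sum_opnorm W = H2sum_opnorm W'.
Proof.
move=> HW HW' WW'; rewrite /H2sum_opnorm /opnorm; congr ereal_inf.
suff e h : H2sum h -> sum_norm (@L2norm R E) (@L2norm R F) (W h) =
    sum_norm (@L2norm R E) (@L2norm R F) (W' h).
  apply/seteqP; split=> _ [c [c0 hc] <-]; exists c => //; split=> // h Sh.
    by rewrite -e//; exact: hc.
  by rewrite e//; exact: hc.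
move=> Sh; have [h1 h2] := HW h Sh; have [h1' h2'] := HW' h Sh; have [e1 e2] := WW' h Sh.
rewrite /sum_norm !L2norm_sqr (aeeq_nsq sepE (H2_L2 h1) (H2_L2 h1') e1).
by rewrite (aeeq_nsq sepF (H2_L2 h2) (H2_L2 h2') e2).
Qed.

(** For each r > 0 the lift with g = c + r supplies a symbol [Psi] of the same operator. Subtracting
    the difference of the lower rows, which is analytic, replaces the lower row of [Phi] by that of
    [Psi]. *)
Lemma H2sum_opnorm_ge (W : pairs -> pairs) Phi : bounded_operator W ->
  operator_eq (W \o @opY R E F) (@opX R E F \o W) ->
  Gamma_infty Phi -> operator_eq W (opV Phi) ->
  (ereal_inf [set Linfty_norm (fun z p =>
      symbol_fun Phi z p - symbol_fun (lower_row L.1 L.2) z p)%R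
    | L in Hinfty E F `*` Hinfty F F] <= H2sum_opnorm W)%E.
Proof.
move=> bW WYX GP WPhi.
have [c c0 [e _]] := opnorm_bound (@sum_norm_ge0 R E F) (bo_bounded bW).
rewrite /H2sum_opnorm e; apply/lee_addgt0Pr => r r0.
have g0 : 0 <= c + r by rewrite addr_ge0// ltW.
have [|Psi [GPsi WPsi bPsi]] := operator_symbol sepE sepF bW WYX (g := c + r).
  by rewrite /H2sum_opnorm e lte_fin ltrDl.
have VPsi h (Sh : H2sum h) : pair_aeeq (opV Phi h) (opV Psi h).
  have [a1 a2] := WPhi h Sh; have [b1 b2] := WPsi h Sh.
  by split; [exact: aeeq_trans (aeeq_sym a1) b1|exact: aeeq_trans (aeeq_sym a2) b2].
have [[LA HA0] [LB HB0] LC LD] := GP; have [_ _ LC' LD'] := GPsi.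
have coef h n x : H2sum h -> L2inner (lower_row_fun Phi h) (zmonJ n.+1 x) =
    L2inner (lower_row_fun Psi h) (zmonJ n.+1 x).
  move=> Sh; rewrite -(opV_lower sepE sepF n x GP Sh) -(opV_lower sepE sepF n x GPsi Sh).
  have HV := opV_H2sum sepE sepF GP Sh.
  have HV' := opV_H2sum sepE sepF GPsi Sh.
  exact: (L2inner_ae sepF (H2_L2 HV.2) (H2_L2 HV'.2) (L2_zmon sepF n x) (VPsi h Sh).2).
have lin (V V' : hilbertType R) (Q : circ -> V -> V') : Linfty V V' Q -> forall z, linear (Q z).
  by case.
pose M1 z x := symC Phi z x - symC Psi z x; pose M2 z x := symD Phi z x - symD Psi z x.
(* On constants both symbols give the same negative Fourier coefficients, so the difference has
   none. *)
have HL1 : Hinfty E F M1.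
  apply: (Hinfty_of_H2 (LinftyB LC LC')) => x n y; have Hx := H2_cst sepE x.
  have := coef (fun=> x, 0) n y (H2sum_left sepF Hx).
  rewrite /lower_row_fun /= !smul0 ?addr0; try exact: lin.
  have Lx := H2_L2 Hx; have Lz := L2_zmonJ sepF n.+1 y.
  move/eqP; rewrite -subr_eq0.
  by rewrite -(siBl LF (L2_smul sepE sepF LC Lx) (L2_smul sepE sepF LC' Lx) Lz) => /eqP.
have HL2 : Hinfty F F M2.
  apply: (Hinfty_of_H2 (LinftyB LD LD')) => x n y; have Hx := H2_cst sepF x.
  have := coef (0, fun=> x) n y (H2sum_right sepE Hx).
  rewrite /lower_row_fun /= !smul0 ?add0r; try exact: lin.
  have Lx := H2_L2 Hx; have Lz := L2_zmonJ sepF n.+1 y.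
  move/eqP; rewrite -subr_eq0.
  by rewrite -(siBl LF (L2_smul sepF sepF LD Lx) (L2_smul sepF sepF LD' Lx) Lz) => /eqP.
apply: (@le_trans _ _ (Linfty_norm (fun z p =>
    symbol_fun Phi z p - symbol_fun (lower_row M1 M2) z p)%R)).
  by apply: ereal_inf_lbound; exists (M1, M2).
rewrite /Linfty_norm; apply/ess_supP.
(* Upper row of [Phi], lower row of [Psi]: the bound of [Psi] applies because the upper rows agree
   almost everywhere on each constant pair. *)
pose T z (p : E * F) : E * F :=
  (symA Phi z p.1 + symB Phi z p.2, symC Psi z p.1 + symD Psi z p.2).
have TE z p : symbol_fun Phi z p - symbol_fun (lower_row M1 M2) z p = T z p.
  rewrite /T /symbol_fun /M1 /M2; congr pair; rewrite /= ?addr0 ?subr0//.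
  by rewrite opprD addrACA !subKr.
have [d dd] := dense_seq sepE; have [d' dd'] := dense_seq sepF.
have : {ae P, forall z, forall n m,
    Re (EFform (T z (d n, d' m)) (T z (d n, d' m))) <=
    (c + r) ^+ 2 * Re (EFform (d n, d' m) (d n, d' m))}.
  apply/ae_foralln => n; apply/ae_foralln => m.
  have Sh : H2sum ((fun=> d n) : circ -> E, (fun=> d' m) : circ -> F).
    by split; exact: H2_cst.
  have := opV_upper sepE sepF GPsi Sh; have := (VPsi _ Sh).1.
  have := opV_upper sepE sepF GP Sh.
  move=> h1 h2 h3; have h4 := aeeq_trans (aeeq_sym h1) (aeeq_trans h2 h3).
  apply: filterS2 h4 (bPsi (d n) (d' m)) => z.
  rewrite /upper_row -[X in X = _]/((T z (d n, d' m)).1) => h5.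
  by rewrite /pair_form !ReD [(T z _).1]h5.
apply: filterS => z hz; apply/opnormP => //; first exact: EFnorm_ge0.
move=> p _; rewrite TE EFnorm_le//.
have bnd (V V' : hilbertType R) (Q : circ -> V -> V') : Linfty V V' Q ->
    exists a : R, forall x, Re (inner (Q z x) (Q z x)) <= a ^+ 2 * Re (inner x x).
  move=> [_ bQ _ _]; have [a a0 [_ ha]] := opnorm_bound (@hnorm_ge0 _ V) (bQ z).
  by exists a => x; rewrite -hnorm_le_sqr//; exact: ha.
have [[a1 h1] [a2 h2]] := (bnd _ _ _ LA, bnd _ _ _ LB).
have [[a3 h3] [a4 h4]] := (bnd _ _ _ LC', bnd _ _ _ LD').
have IEF := semi_inner_pair SE SF; rewrite setXTT in IEF.
(* A crude bound at the given z; the sharp one is so far known only on a countable dense set of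
   pairs. *)
pose m := 2 * (a1 ^+ 2 + a2 ^+ 2 + a3 ^+ 2 + a4 ^+ 2).
apply: (@dense_bound _ _ _ _ _ (T z) [set (d nm.1, d' nm.2) | nm in @setT (nat * nat)]
  ((c + r) ^+ 2) m).
- exact: IEF.
- exact: IEF.
- have add (V V' : hilbertType R) (Q : circ -> V -> V') : Linfty V V' Q ->
      forall u v, Q z (u + v) = Q z u + Q z v.
    by move=> LQ u v; have := lin _ _ _ LQ z 1 u v; rewrite !scale1r.
  move=> x y; rewrite -[LHS]/(symA Phi z (x.1 + y.1) + symB Phi z (x.2 + y.2),
    symC Psi z (x.1 + y.1) + symD Psi z (x.2 + y.2)).
  rewrite (add _ _ _ LA) (add _ _ _ LB) (add _ _ _ LC') (add _ _ _ LD').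
  by congr pair; rewrite addrACA.
- exact: sqr_ge0.
- by rewrite mulr_ge0// !addr_ge0// sqr_ge0.
- move=> q; rewrite /pair_form !ReD /T /=.
  have := nsqD_le SE (x := symA Phi z q.1) (y := symB Phi z q.2) I I.
  have := nsqD_le SF (x := symC Psi z q.1) (y := symD Psi z q.2) I I.
  have := h1 q.1; have := h2 q.2; have := h3 q.1; have := h4 q.2.
  have p1 := si_ge0 SE (x := q.1) I; have p2 := si_ge0 SF (x := q.2) I.
  have := mulr_ge0 (sqr_ge0 a1) p2; have := mulr_ge0 (sqr_ge0 a2) p1.
  have := mulr_ge0 (sqr_ge0 a3) p2; have := mulr_ge0 (sqr_ge0 a4) p1.
  rewrite /m; move: (Re (inner q.1 q.1)) (Re (inner q.2 q.2)) p1 p2 => u v _ _; lra.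
- move=> q s s0; have s2 : 0 < s / 2 by rewrite divr_gt0.
  have [[n hn] [k hk]] := (dd q.1 _ s2, dd' q.2 _ s2).
  exists (d n, d' k); first by exists (n, k).
  by rewrite /pair_form !ReD /= (splitr s) lerD// ltW.
- by move=> _ [[n k] _ <-]; exact: hz.
Qed.

End norm_formula.

Theorem theorem2p3 (R : realType) (E F : hilbertType R)
    (sepE : separable E) (sepF : separable F)
    (W : (circle R -> E) * (circle R -> F) -> (circle R -> E) * (circle R -> F))
    (W_bounded : bounded_operator W)
    (WY_XW : operator_eq (W \o @opY R E F) (@opX R E F \o W)) :
  (exists2 Phi : symbol E F, Gamma_infty Phi & operator_eq W (opV Phi)) /\
  (forall Phi : symbol E F, Gamma_infty Phi -> operator_eq W (opV Phi) ->
    H2sum_opnorm (opV Phi) =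
    ereal_inf
      [set Linfty_norm (fun z p =>
             symbol_fun Phi z p - symbol_fun (lower_row L.1 L.2) z p)
      | L in Hinfty E F `*` Hinfty F F]).
Proof.
split=> [|Phi GPhi WPhi].
  have [c _ [e _]] := opnorm_bound (@sum_norm_ge0 R E F) (bo_bounded W_bounded).
  (* For the representation any g above the norm of [W] serves. *)
  have [|Phi [GPhi WPhi _]] := operator_symbol sepE sepF W_bounded WY_XW (g := c + 1).
    by rewrite /H2sum_opnorm e lte_fin ltrDl.
  by exists Phi.
apply/eqP; rewrite eq_le; apply/andP; split.
  by apply: le_ereal_inf_tmp => _ [[L1 L2] [/= hL1 hL2] <-]; exact: H2sum_opnorm_le.
rewrite -(H2sum_opnorm_eq sepE sepF (bo_stable W_bounded) _ WPhi).
  exact: H2sum_opnorm_ge.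
by move=> h Sh; exact: opV_H2sum.
Qed.
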